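(* Let $G$ be a finite simple graph and let $\mathcal R'$ be a partial representation of $G$. Then $\mathcal R'$ is extendible if and only if $G$ and $\mathcal R'$ contain no LB, SE, $k$-FAT, $k$-BI, $k$-FS, $k$-EFS, $k$-FB, $k$-EFB, $k$-FDS, $k$-EFDS, $k$-FNS and $(k,\ell)$-CE obstructions (for any admissible values of $k$ and $\ell$).
   Context: **Representations.** An interval representation of a graph $G$ assigns to each $x\in V(G)$ a closed interval $\langle x\rangle=[\ell(x),r(x)]$, $\ell(x)\le r(x)$, of the real line so that for $x\neq y$, $\langle x\rangle\cap\langle y\rangle\ne\emptyset$ iff $xy\in E(G)$; $G$ is an interval graph if it has one. A partial representation $\mathcal R'$ of $G$ is an interval representation $\{\langle x\rangle' : x\in V(G')\}$ of an induced subgraph $G'$ of $G$ (possibly empty); vertices of $G'$ and their intervals are called pre-drawn, the other vertices are free. It is extendible if $G$ has an interval representation $\mathcal R$ with $\langle x\rangle=\langle x\rangle'$ for all $x\in V(G')$. In what follows $\ell(x),r(x)$ denote the endpoints of pre-drawn intervals. An interval is on the left of another if its right endpoint is strictly smaller than the left endpoint of the other; $\langle y\rangle$ is between $\langle x\rangle$ and $\langle z\rangle$ if one of $\langle x\rangle,\langle z\rangle$ is on the left of $\langle y\rangle$ and the other is on its right. An interval covers a point if it contains it. **Obstructions.** An obstruction consists of a graph $H$ and a non-extendible partial representation $\mathcal R'_H$ of $H$. It is contained in $G$ and $\mathcal R'$ if $H$ is isomorphic to an induced subgraph of $G$ by an isomorphism such that pre-drawn vertices of $H$ are mapped to pre-drawn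 vertices of $G$ and the endpoints in $\mathcal R'_H$ have the same left-to-right order (including equalities) as the endpoints of the corresponding intervals in $\mathcal R'$. (Other vertices of the induced subgraph may be pre-drawn in $\mathcal R'$ as well.) Each class below also includes the obstructions obtained by reflecting the partial representation, $x\mapsto -x$. **LB.** $H$ is a minimal forbidden induced subgraph of interval graphs (i.e. $H$ is not an interval graph but every proper induced subgraph is), with $\mathcal R'_H=\emptyset$. **SE.** Pre-drawn vertices $u,v$ (possibly $u=v$) with $r(u)=\ell(v)$, and two free non-adjacent vertices $x,y$, both adjacent to $u$ and to $v$; if $u\ne v$, then $\ell(u)<\ell(v)=r(u)<r(v)$. **The graphs $H_k$ ($k\ge1$).** $H_1$ consists of vertices $x_1,y_1,z_1$ and an induced path $P_1$ from $x_1$ to $z_1$ (of length at least one), where $y_1$ is non-adjacent to all vertices of $P_1$. For $k\ge2$, $H_k$ is obtained from some $H_{k-1}$ by adding new vertices $x_k$ and $t_k$ and an induced path $P_k$ from $x_k$ to $t_k$ (with new inner vertices, length at least one); $t_k$ is adjacent to all vertices of $H_{k-1}$ except $x_{k-1}$, and all vertices of $H_{k-1}$ are non-adjacent to $x_k$ and to the inner vertices of $P_k$. Put $y_k=z_{k-1}$ and $z_k=y_{k-1}$. **$k$-FAT.** The graph $H_k$ with exactly $x_k,y_k,z_k$ pre-drawn, pairwise disjoint, with $\langle y_k\rangle'$ between $\langle x_k\rangle'$ and $\langle z_k\rangle'$. (So for $k=1$, $x_1,z_1$ are non-adjacent.) **Derived classes.** In each of the following, $\widetilde H_k$ is obtained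 from an $H_k$ by adding the listed vertices; an added vertex is adjacent to exactly those of $x_k,y_k,z_k$ that are listed; its adjacencies to the other vertices of $H_k$ are not prescribed; an added vertex may coincide with a vertex of $V(H_k)\setminus\{x_k,y_k,z_k\}$. Exactly the listed vertices are pre-drawn, and adjacencies between pre-drawn vertices agree with their intervals. - **$k$-BI** ($k\in\{1,2\}$): added $u,v$ (possibly $u=v$), each adjacent to $x_k,y_k,z_k$; pre-drawn $x_k,z_k,u,v$; $\ell(u)\le\ell(v)<r(u)\le r(v)$, $\langle x_k\rangle'$ covers $\ell(v)$ and $\langle z_k\rangle'$ covers $r(u)$. For $k=1$ one also allows $x_1=z_1$ (with $P_1$ of length zero). For $k=2$, $\langle x_2\rangle'$ is on the left of $\langle z_2\rangle'$. - **$k$-FS**: added $u$ adjacent to $y_k,z_k$; pre-drawn $x_k,y_k,u$; $\ell(y_k)\le\ell(u)\le r(y_k)<r(u)$ and $\langle x_k\rangle'$ is on the left of $\langle y_k\rangle'$. - **$k$-EFS**: added $u$ adjacent to $x_k,y_k,z_k$ and $v$ adjacent to $y_k,z_k$; pre-drawn $y_k,z_k,u,v$; $\ell(u)<\ell(v)<\ell(y_k)\le r(y_k)<\ell(z_k)\le r(z_k)<r(u)\le r(v)$. - **$k$-FB**: added $u$ adjacent to $y_k,z_k$; pre-drawn $x_k,z_k,u$; $\ell(u)<\ell(z_k)\le r(u)\le r(z_k)$ and $\langle x_k\rangle'$ is on the left of $\langle u\rangle'$. - **$k$-EFB**: added $u$ adjacent to $x_k,y_k,z_k$ and $v$ adjacent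 to $y_k,z_k$; pre-drawn $x_k,z_k,u,v$; $\ell(u)<\ell(x_k)\le r(x_k)<\ell(v)<\ell(z_k)\le r(u)\le r(z_k)<r(v)$. - **$k$-FDS**: added $u$ adjacent to $x_k,y_k,z_k$ and $v$ adjacent to $y_k,z_k$; pre-drawn $y_k,u,v$; $\ell(u)<\ell(y_k)\le\ell(v)\le r(y_k)<r(u)\le r(v)$. - **$k$-EFDS**: added $u$ adjacent to $x_k,y_k,z_k$, and $v,w$ each adjacent to $y_k,z_k$; pre-drawn $y_k,u,v,w$; $\ell(u)<\ell(v)<\ell(y_k)\le\ell(w)\le r(y_k)<r(w)<r(u)\le r(v)$. - **$k$-FNS**: added $u$ adjacent to $x_k,y_k,z_k$, and $v,w$ each adjacent to $y_k,z_k$; pre-drawn $z_k,u,v,w$; $\ell(u)<\ell(v)\le\ell(z_k)$, $\ell(u)<\ell(w)\le\ell(z_k)$ and $\ell(z_k)\le r(w)<r(u)\le r(v)$. **$(k,\ell)$-CE** ($k\ge\ell\ge 1$, with $\ell=1$ or $k=\ell=2$): the graph is the union of an induced subgraph $H_k$ and an induced subgraph $H'_\ell$ (a graph of type $H_\ell$ with vertices denoted $x'_i,y'_i,z'_i,t'_i$ and paths $P'_i$), where $z_k=z'_\ell$, $x_k=y'_\ell$, $y_k=x'_\ell$ and other vertices may be shared, together with a vertex $u$ adjacent to $x_k,y_k,z_k$ ($u$ may coincide with a vertex of $H_k$ or $H'_\ell$ other than $x_k,y_k,z_k$). Adjacencies not determined by this are not prescribed. Exactly $z_k$ and $u$ are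 pre-drawn, with $\ell(u)<\ell(z_k)\le r(u)\le r(z_k)$. *)

(* Defs.v *)
From mathcomp Require Import all_boot all_order all_algebra.
From mathcomp Require Import reals.

Set Implicit Arguments.
Unset Strict Implicit.
Unset Printing Implicit Defensive.

Import Order.TTheory GRing.Theory Num.Theory.
Local Open Scope ring_scope.

Record sgraph := SGraph {
  vertex :> finType;
  adj : rel vertex;
  adj_sym : symmetric adj;
  adj_irrefl : irreflexive adj
}.

Notation "x -- y" := (adj x y) (at level 30, no associativity).

(* [is_repr A l r]: the intervals [l x, r x], for x in A, represent the
   subgraph of G induced by A.  Values outside A are irrelevant. *)
Definition is_repr (R : realType) (G : sgraph) (A : {set G}) (l r : G -> R) :=
  (forall x, x \in A -> l x <= r x) /\
  (forall x y, x \in A -> y \in A -> x != y ->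
     (exists p : R, p \in `[l x, r x] /\ p \in `[l y, r y]) <-> x -- y).

Definition has_repr (R : realType) (G : sgraph) (A : {set G}) :=
  exists l r : G -> R, is_repr A l r.

Record partial_repr (R : realType) (G : sgraph) := PartialRepr {
  predrawn : {set G};
  lft : G -> R;
  rgt : G -> R;
  partial_reprP : is_repr predrawn lft rgt
}.

Definition extendible (R : realType) (G : sgraph) (S : partial_repr R G) :=
  exists l r : G -> R,
    is_repr [set: G] l r /\
    forall x, x \in predrawn S -> l x = lft S x /\ r x = rgt S x.

Definition left_of (R : realType) (G : sgraph) (S : partial_repr R G)
    (x y : G) : bool := rgt S x < lft S y.

Definition between (R : realType) (G : sgraph) (S : partial_repr R G)
    (x y z : G) : bool :=
  (left_of S x y && left_of S y z) || (left_of S z y && left_of S y x).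

Definition covers (R : realType) (G : sgraph) (S : partial_repr R G)
    (x : G) (p : R) : bool := p \in `[lft S x, rgt S x].

Lemma is_repr_opp (R : realType) (G : sgraph) (A : {set G}) (l r : G -> R) :
  is_repr A l r -> is_repr A (fun x => - r x) (fun x => - l x).
Proof.
move=> [lr lrP]; split=> [x xA|x y xA yA xy]; first by rewrite lerN2 lr.
have oppI (u v p : R) : (- p \in `[- u, - v]) = (p \in `[v, u]).
  by rewrite !in_itv /= !lerN2 andbC.
rewrite -(lrP x y xA yA xy); split=> -[p [px py]]; exists (- p).
  by rewrite -oppI -[_ \in `[l y, _]]oppI opprK.
by rewrite !oppI.
Qed.

Definition reflection (R : realType) (G : sgraph) (S : partial_repr R G) :
    partial_repr R G := PartialRepr (is_repr_opp (partial_reprP S)).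

Definition endpoint (R : realType) (G : sgraph) (S : partial_repr R G)
    (right : bool) (x : G) : R := if right then rgt S x else lft S x.

Definition contained (R : realType) (H : sgraph) (SH : partial_repr R H)
    (G : sgraph) (S : partial_repr R G) :=
  exists f : H -> G,
    [/\ injective f,
        forall x y, f x -- f y = x -- y,
        forall x, x \in predrawn SH -> f x \in predrawn S
      & forall x y (s t : bool), x \in predrawn SH -> y \in predrawn SH ->
          (endpoint S s (f x) <= endpoint S t (f y)) =
          (endpoint SH s x <= endpoint SH t y)].

Definition obstruction_class (R : realType) :=
  forall H : sgraph, partial_repr R H -> Prop.

(* An obstruction is by definition non-extendible, so this is required of every
   member of a class C, in addition to the shape prescribed by C.  The shapes
   other than FNS already force it; FNS does not when r w > r z. *)
Definition contains (R : realType) (G : sgraph) (S : partial_repr R G)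
    (C : obstruction_class R) :=
  exists (H : sgraph) (SH : partial_repr R H),
    [/\ ~ extendible SH, C H SH \/ C H (reflection SH) & contained SH S].

(* The vertices x :: p form, in this order, an induced path of length [size p]
   from x to [last x p]. *)
Definition induced_path (G : sgraph) (x : G) (p : seq G) :=
  uniq (x :: p) /\
  forall i j, (i < size (x :: p))%N -> (j < size (x :: p))%N ->
    nth x (x :: p) i -- nth x (x :: p) j = (j == i.+1) || (i == j.+1).

(* [Hgraph k A x y z]: the subgraph induced by A is an H_k with x_k = x,
   y_k = y and z_k = z.  The description of H_k determines the adjacency of all
   pairs of vertices of A.  In [Hgraph_S], the new path is x', ..., t. *)
Inductive Hgraph (G : sgraph) : nat -> {set G} -> G -> G -> G -> Prop :=
| Hgraph_1 (x y : G) (p : seq G) of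
    p != [::] & induced_path x p & y \notin x :: p &
    (forall a, a \in x :: p -> ~~ (y -- a)) :
    Hgraph 1%N (y |: [set a in x :: p]) x y (last x p)
| Hgraph_S (k : nat) (A : {set G}) (x y z x' : G) (p : seq G) of
    Hgraph k A x y z &
    p != [::] & induced_path x' p &
    (forall b, b \in x' :: p -> b \notin A) &
    (forall a, a \in A -> last x' p -- a = (a != x)) &
    (forall a b, a \in A -> b \in x' :: p -> b != last x' p -> ~~ (a -- b)) :
    Hgraph k.+1 (A :|: [set b in x' :: p]) x' z y.

(* u lies outside x, y, z and N is the set of its neighbours among them; u may
   belong to the rest of H_k. *)
Definition attached (G : sgraph) (x y z : G) (N : {set G}) (u : G) :=
  u \notin [set x; y; z] /\
  forall a, a \in [set x; y; z] -> u -- a = (a \in N).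

Definition LB (R : realType) : obstruction_class R := fun H S =>
  [/\ predrawn S = set0,
      ~ has_repr R [set: H]
    & forall A : {set H}, A \proper [set: H] -> has_repr R A].

Definition SE (R : realType) : obstruction_class R := fun H S =>
  let l := lft S in let r := rgt S in
  exists u v x y : H,
    [/\ [set: H] = [set u; v; x; y],
        predrawn S = [set u; v] /\ x \notin [set u; v] /\ y \notin [set u; v],
        x != y /\ ~~ (x -- y),
        [/\ x -- u, x -- v, y -- u & y -- v]
      & r u = l v /\ (u != v -> l u < l v /\ r u < r v)].

Definition FAT (R : realType) (k : nat) : obstruction_class R := fun H S =>
  exists x y z : H,
    [/\ Hgraph k [set: H] x y z,
        predrawn S = [set x; y; z]
      & between S x y z].

(* The second alternative for A is the degenerate case in which P_1 has length
   zero. *)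
Definition BI (R : realType) (k : nat) : obstruction_class R := fun H S =>
  let l := lft S in let r := rgt S in
  exists (A : {set H}) (x y z u v : H),
    [/\ Hgraph k A x y z \/
          [/\ k = 1%N, x = z, x != y, ~~ (x -- y) & A = [set x; y]],
        [set: H] = A :|: [set u; v] /\ predrawn S = [set x; z; u; v],
        attached x y z [set x; y; z] u /\ attached x y z [set x; y; z] v,
        [/\ l u <= l v, l v < r u & r u <= r v]
      & [/\ covers S x (l v), covers S z (r u) & k = 2%N -> left_of S x z]].

Definition FS (R : realType) (k : nat) : obstruction_class R := fun H S =>
  let l := lft S in let r := rgt S in
  exists (A : {set H}) (x y z u : H),
    [/\ Hgraph k A x y z,
        [set: H] = A :|: [set u] /\ predrawn S = [set x; y; u],
        attached x y z [set y; z] u,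
        [/\ l y <= l u, l u <= r y & r y < r u]
      & left_of S x y].

Definition EFS (R : realType) (k : nat) : obstruction_class R := fun H S =>
  let l := lft S in let r := rgt S in
  exists (A : {set H}) (x y z u v : H),
    [/\ Hgraph k A x y z,
        [set: H] = A :|: [set u; v] /\ predrawn S = [set y; z; u; v],
        attached x y z [set x; y; z] u /\ attached x y z [set y; z] v,
        [/\ l u < l v, l v < l y & l y <= r y]
      & [/\ r y < l z, l z <= r z, r z < r u & r u <= r v]].

Definition FB (R : realType) (k : nat) : obstruction_class R := fun H S =>
  let l := lft S in let r := rgt S in
  exists (A : {set H}) (x y z u : H),
    [/\ Hgraph k A x y z,
        [set: H] = A :|: [set u] /\ predrawn S = [set x; z; u],
        attached x y z [set y; z] u,
        [/\ l u < l z, l z <= r u & r u <= r z]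
      & left_of S x u].

Definition EFB (R : realType) (k : nat) : obstruction_class R := fun H S =>
  let l := lft S in let r := rgt S in
  exists (A : {set H}) (x y z u v : H),
    [/\ Hgraph k A x y z,
        [set: H] = A :|: [set u; v] /\ predrawn S = [set x; z; u; v],
        attached x y z [set x; y; z] u /\ attached x y z [set y; z] v,
        [/\ l u < l x, l x <= r x & r x < l v]
      & [/\ l v < l z, l z <= r u, r u <= r z & r z < r v]].

Definition FDS (R : realType) (k : nat) : obstruction_class R := fun H S =>
  let l := lft S in let r := rgt S in
  exists (A : {set H}) (x y z u v : H),
    [/\ Hgraph k A x y z,
        [set: H] = A :|: [set u; v] /\ predrawn S = [set y; u; v],
        attached x y z [set x; y; z] u /\ attached x y z [set y; z] v
      & [/\ l u < l y, l y <= l v, l v <= r y, r y < r u & r u <= r v]].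

Definition EFDS (R : realType) (k : nat) : obstruction_class R := fun H S =>
  let l := lft S in let r := rgt S in
  exists (A : {set H}) (x y z u v w : H),
    [/\ Hgraph k A x y z,
        [set: H] = A :|: [set u; v; w] /\ predrawn S = [set y; u; v; w],
        [/\ attached x y z [set x; y; z] u, attached x y z [set y; z] v
          & attached x y z [set y; z] w],
        [/\ l u < l v, l v < l y, l y <= l w & l w <= r y]
      & [/\ r y < r w, r w < r u & r u <= r v]].

Definition FNS (R : realType) (k : nat) : obstruction_class R := fun H S =>
  let l := lft S in let r := rgt S in
  exists (A : {set H}) (x y z u v w : H),
    [/\ Hgraph k A x y z,
        [set: H] = A :|: [set u; v; w] /\ predrawn S = [set z; u; v; w],
        [/\ attached x y z [set x; y; z] u, attached x y z [set y; z] v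
          & attached x y z [set y; z] w],
        [/\ l u < l v, l v <= l z, l u < l w & l w <= l z]
      & [/\ l z <= r w, r w < r u & r u <= r v]].

Definition CE (R : realType) (k m : nat) : obstruction_class R := fun H S =>
  let l := lft S in let r := rgt S in
  exists (A A' : {set H}) (x y z u : H),
    [/\ Hgraph k A x y z /\ Hgraph m A' y x z,
        [set: H] = A :|: A' :|: [set u],
        predrawn S = [set z; u],
        attached x y z [set x; y; z] u
      & [/\ l u < l z, l z <= r u & r u <= r z]].

(* Main.v *)
(* A representation induces an orientation of the non-edges of G, "x lies left
   of y", which is an interval order.  Conversely, given such an orientation,
   the endpoints consistent with it solve a system of inequalities with
   constants, which is solvable iff the orientation contains every pair
   (x, y) with  a <= b  for some upper bound a of l x and some lower bound b of
   r y read off a pre-drawn interval.  These forced pairs form a Ferrers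
   relation.

   Let x < z < y in an orientation.  Peeling off the component of x in
   G - N[y] and recursing on the mirrored triple yields either an H_k with
   x_k = x, y_k = y, z_k = z, which excludes every representation with y between
   x and z, or an autonomous set containing y and z but not x, whose reversal
   produces such a representation.  By induction along autonomous sets it
   follows that a Ferrers relation extends to an orientation unless two of its
   pairs contradict each other in every orientation.  Finally, two contradicting
   forced pairs are reduced to three or four vertices, and the positions of the
   pre-drawn intervals involved single out one of the obstructions. *)

Require Import Defs.
From mathcomp Require Import all_boot all_order all_algebra.
From mathcomp Require Import reals boolp lra zify.
Set Implicit Arguments.
Unset Strict Implicit.
Unset Printing Implicit Defensive.

(** * Orientations and the graphs H_k *)

(** Containment preserves only the order of drawn endpoints, so intervals cannot be copied between a
    graph and an obstruction; orientations carry the whole argument. Being forced is a threshold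
    comparison, hence Ferrers, and nested rows exclude long cycles: this is why two forced pairs
    already witness non-extendibility. An autonomous set of one orientation need not be autonomous
    in the others. One that every orientation respects can be contracted; a maximal proper one that
    some orientation splits has no edge to the outside, which leaves only the edgeless case. If
    nothing can be contracted and the order is prime, each chain of three yields an H_k in both
    directions, so the orientation is unique up to reversal. A conflict is kept semantic, as two
    pairs opposed in every orientation; vertices can then be exchanged for neighbours until drawn
    intervals take part. The index bounds of BI and CE come from a shortcut: for k >= 3 an H_k
    contains an H_1 for the triple with x and y exchanged. *)

Ltac nlia :=
  repeat match goal with H : is_true (leq _ _) |- _ => revert H end;
  clear; intros; lia.

Section Orientation.
Variable G : sgraph.
Implicit Types (A B W : {set G}) (lt : rel G).

(** [oriI] is the 2+2-free condition that characterises interval orders. Together with the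
    irreflexivity contained in [oriE] (take [x = y]) it yields asymmetry and transitivity. *)
Record orientation A lt : Prop := Orientation {
  oriE : {in A &, forall x y, lt x y || lt y x = (x != y) && ~~ (x -- y)};
  oriI : forall a b c d, a \in A -> b \in A -> c \in A -> d \in A ->
    lt a b -> lt c d -> lt a d || lt c b }.

Lemma adj_neq (x y : G) : x -- y -> x != y.
Proof. by apply: contraTneq => ->; rewrite adj_irrefl. Qed.

(** The predecessor sets of an interval order form a chain, so their sizes [L] can serve as left
    endpoints; [H x] is the last left endpoint among the vertices not comparable with [x], itself
    included. In these intervals most arguments about a single orientation become linear
    arithmetic. *)
Lemma orientation_nat A lt : orientation A lt ->
  exists L H : G -> nat,
    [/\ {in A, forall x, L x <= H x},
        {in A &, forall x y, lt x y = (H x < L y)}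
      & {in A &, forall x y, x != y -> x -- y = (L x <= H y) && (L y <= H x)}].
Proof.
case=> ltE ltI.
have ltxx x : x \in A -> lt x x = false.
  by move=> xA; have := ltE x x xA xA; rewrite eqxx orbb.
pose L x := #|[set y in A | lt y x]|.
pose H x := \max_(y in A | ~~ lt x y && ~~ lt y x) L y.
have LH x y : x \in A -> y \in A -> ~~ lt x y -> ~~ lt y x -> L y <= H x.
  by move=> xA yA nxy nyx; apply: (bigmax_sup y) => //; rewrite yA nxy nyx.
have HL x y : x \in A -> y \in A -> lt x y -> H x < L y.
  move=> xA yA xy; have L0 : 0 < L y.
    by apply/card_gt0P; exists x; rewrite inE xA.
  (* Predecessors of [z] are predecessors of [y], while [x] precedes [y] but not [z]; hence
     [L z < L y]. *)
  rewrite -(prednK L0) ltnS; apply/bigmax_leqP => z /and3P[zA nxz nzx].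
  rewrite -ltnS (prednK L0); apply: proper_card; apply/properP; split.
    apply/subsetP=> w; rewrite !inE => /andP[wA wz]; rewrite wA /=.
    by have := ltI _ _ _ _ wA zA xA yA wz xy; rewrite (negbTE nxz) orbF.
  by exists x; rewrite !inE xA //= negbK in nxz *.
have LL x : x \in A -> L x <= H x by move=> xA; apply: LH; rewrite ?ltxx.
have main : {in A &, forall x y, lt x y = (H x < L y)}.
  move=> x y xA yA; apply/idP/idP; first exact: HL.
  apply: contraTT => nxy; rewrite -leqNgt.
  have [yx|nyx] := boolP (lt y x); last exact: LH.
  by have := HL _ _ yA xA yx; have := LL _ xA; have := LL _ yA; lia.
exists L, H; split=> // x y xA yA nxy.
have := ltE x y xA yA; rewrite nxy !main //=.
by move=> /(congr1 negb); rewrite negbK => <-; rewrite negb_or -!leqNgt andbC.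
Qed.

Lemma orientation_sub A B lt : B \subset A -> orientation A lt -> orientation B lt.
Proof.
move=> /subsetP sBA [E I]; split=> [x y xB yB|a b c d aB bB cB dB].
  by apply: E; apply: sBA.
by apply: I; apply: sBA.
Qed.

Lemma orientation_rev A lt : orientation A lt -> orientation A (fun x y => lt y x).
Proof.
case=> E I; split=> [x y xA yA|a b c d aA bA cA dA ba dc]; first by rewrite orbC E.
by rewrite orbC; apply: I.
Qed.

(* A transitive orientation is an interval order as soon as G has no induced
   4-cycle; the hypothesis on lt0 provides that. *)
Lemma orientation_trans A lt0 lt : orientation A lt0 ->
  {in A &, forall x y, lt x y || lt y x = (x != y) && ~~ (x -- y)} ->
  {in A &, forall x y, ~~ (lt x y && lt y x)} ->
  (forall a b c, a \in A -> b \in A -> c \in A -> lt a b -> lt b c -> lt a c) ->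
  orientation A lt.
Proof.
move=> /orientation_nat[L [H [LH ltE0 adjE]]] ltE asym tr; split=> //.
have ltxx x : x \in A -> lt x x = false.
  by move=> xA; have := ltE x x xA xA; rewrite eqxx orbb.
have inc x y : x \in A -> y \in A -> ~~ lt x y -> ~~ lt y x -> x != y -> x -- y.
  move=> xA yA nxy nyx ne; apply: contraT => na.
  by have := ltE x y xA yA; rewrite ne na (negbTE nxy) (negbTE nyx).
move=> a b c d aA bA cA dA ab cd; apply: contraT; rewrite negb_or => /andP[nad ncb].
have ltna x y : x \in A -> y \in A -> lt x y -> (x != y) && ~~ (x -- y).
  by move=> xA yA xy; rewrite -ltE // xy.
have nda : ~~ lt d a.
  apply: contra ncb => da; apply: (tr _ a) => //; exact: (tr _ d).
have nbc : ~~ lt b c.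
  apply: contra nad => bc; apply: (tr _ c) => //; exact: (tr _ b).
have nac : ~~ lt a c by apply: contra nad => /(tr _ _ _ aA cA dA); apply.
have nca : ~~ lt c a by apply: contra ncb => /(tr _ _ _ cA aA bA); apply.
have nbd : ~~ lt b d by apply: contra nad => /(tr _ _ _ aA bA dA ab); apply.
have ndb : ~~ lt d b by apply: contra ncb => /(tr _ _ _ cA dA bA cd); apply.
have ead : a != d.
  by apply: contraNneq ncb => e; apply: (tr _ a) => //; rewrite e.
have ebc : b != c.
  by apply: contraNneq nad => e; apply: (tr _ c) => //; rewrite -e.
have eac : a != c by apply: contraNneq nad => ->.
have ebd : b != d by apply: contraNneq ncb => ->.
(* The pairs [a d], [b c], [a c], [b d] are edges and [a b], [c d] are not: an induced 4-cycle,
   which the intervals of [lt0] exclude. *)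
have := inc _ _ aA dA nad nda ead; have := inc _ _ bA cA nbc ncb ebc.
have := inc _ _ aA cA nac nca eac; have := inc _ _ bA dA nbd ndb ebd.
case/andP: (ltna _ _ aA bA ab) => eab; case/andP: (ltna _ _ cA dA cd) => ecd.
rewrite !adjE // !negb_and -!ltnNge => ncd' nab' /andP[? ?] /andP[? ?] /andP[? ?] /andP[? ?].
by case/orP: ncd'; case/orP: nab' => ? ?; nlia.
Qed.

Definition autonomous A lt W := forall v w w', v \in A -> v \notin W ->
  w \in W -> w' \in W -> lt v w = lt v w' /\ lt w v = lt w' v.

Definition flip lt W : rel G :=
  fun x y => if (x \in W) && (y \in W) then lt y x else lt x y.

Lemma orientation_irr A lt x : orientation A lt -> x \in A -> lt x x = false.
Proof. by move=> o xA; have := oriE o xA xA; rewrite eqxx orbb. Qed.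

Lemma orientation_asym A lt x y : orientation A lt -> x \in A -> y \in A ->
  lt x y -> lt y x = false.
Proof.
move=> o xA yA xy; apply/negbTE/negP=> yx.
by have := oriI o xA yA yA xA xy yx; rewrite !(orientation_irr o).
Qed.

Lemma orientation_tr A lt x y z : orientation A lt -> x \in A -> y \in A -> z \in A ->
  lt x y -> lt y z -> lt x z.
Proof.
move=> o xA yA zA xy yz.
by have := oriI o xA yA yA zA xy yz; rewrite (orientation_irr o yA) orbF.
Qed.

(** Reversing inside [W] changes no comparability, so by [orientation_trans] only asymmetry and
    transitivity remain; chains partly outside [W] are settled because an outside vertex sees all of
    [W] alike. *)
Lemma orientation_flip A lt W : orientation A lt -> autonomous A lt W ->
  orientation A (flip lt W).
Proof.
move=> o aW.
apply: (orientation_trans o) => [x y xA yA|x y xA yA|a b c aA bA cA];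
  rewrite /flip.
- by rewrite [(y \in W) && _]andbC; case: ifP => _; rewrite ?[lt y x || _]orbC (oriE o).
- rewrite [(y \in W) && _]andbC; case: ifP => _; apply/negP=> /andP[xy yx].
    by rewrite (orientation_asym o xA yA yx) in xy.
  by rewrite (orientation_asym o xA yA xy) in yx.
have [aW'|aW'] := boolP (a \in W); have [bW|bW] := boolP (b \in W);
  have [cW|cW] := boolP (c \in W) => //= ab bc.
- exact: orientation_tr o cA bA aA bc ab.
- by have [_ <-] := aW c b a cA cW bW aW'.
- have [e _] := aW b c a bA bW cW aW'.
  by rewrite e (orientation_asym o aA bA ab) in bc.
- exact: orientation_tr o aA bA cA ab bc.
- by have [<- _] := aW a b c aA aW' bW cW.
- exact: orientation_tr o aA bA cA ab bc.
- exact: orientation_tr o aA bA cA ab bc.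
- exact: orientation_tr o aA bA cA ab bc.
Qed.

Definition never_between A (x y z : G) := forall lt, orientation A lt ->
  ~~ (lt x y && lt y z) && ~~ (lt z y && lt y x).

Lemma Hgraph_mem k A x y z : Hgraph k A x y z ->
  [/\ x \in A, y \in A & z \in A].
Proof.
elim=> [{}x {}y p _ _ _ _|{}k {}A {}x {}y {}z x' p _ [xA yA zA] _ _ _ _ _].
  by rewrite !in_setU1 !in_set mem_last mem_head eqxx !orbT.
by rewrite !in_setU in_set mem_head yA zA orbT.
Qed.

Lemma Hgraph_gt0 k A x y z : Hgraph k A x y z -> 0 < k.
Proof. by case. Qed.

Lemma induced_path_path (x : G) p : induced_path x p -> path (@adj G) x p.
Proof.
move=> [_ ip]; apply/(pathP x) => i ltip.
by rewrite -[nth x p i]/(nth x (x :: p) i.+1) ip ?eqxx //= ltnS ltnW.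
Qed.

Lemma last_neq (x : G) p : p != [::] -> uniq (x :: p) -> last x p != x.
Proof.
case: p => // a p _ /= /andP[xap _]; apply: contraNneq xap => <-; exact: mem_last.
Qed.

Lemma Hgraph_indep k A x y z : Hgraph k A x y z ->
  [/\ x != y, x != z, y != z, ~~ (x -- y) & ~~ (y -- z)].
Proof.
elim=> [{}x {}y p pn [u _] yp np|{}k {}A {}x {}y {}z x' p hA [xy xz yz nxy nyz] pn [u _] pA ta pa].
  have lp := mem_last x p; rewrite [x == last _ _]eq_sym last_neq // np //.
  split=> //; first by apply: contraNneq yp => <-; rewrite mem_head.
    by apply: contraNneq yp => ->.
  by rewrite adj_sym np // mem_head.
have [xA yA zA] := Hgraph_mem hA; have x'A := pA _ (mem_head x' p).
split; first by apply: contraNneq x'A => ->.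
- by apply: contraNneq x'A => ->.
- by rewrite eq_sym.
- by rewrite adj_sym pa ?mem_head // eq_sym last_neq.
- by rewrite adj_sym.
Qed.

(** Otherwise [w] would separate two intersecting intervals. *)
Lemma nonadj_side A lt a b w : orientation A lt -> a \in A -> b \in A -> w \in A ->
  a -- b -> w != a -> w != b -> ~~ (w -- a) -> ~~ (w -- b) ->
  lt a w = lt b w /\ lt w a = lt w b.
Proof.
move=> o aA bA wA ab wa wb nwa nwb; have [L [H [LH ltE adjE]]] := orientation_nat o.
have nab := adj_neq ab; move: ab nwa nwb.
rewrite !adjE // !ltE // !negb_and -!ltnNge.
have := LH a aA; have := LH b bA; have := LH w wA.
move=> ? ? ? /andP[? ?] /orP[] ? /orP[] ?; split; apply/idP/idP => ?; nlia.
Qed.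

Lemma path_side A lt x p w : orientation A lt -> {subset x :: p <= A} -> w \in A ->
  path (@adj G) x p -> w \notin x :: p -> (forall a, a \in x :: p -> ~~ (w -- a)) ->
  lt x w = lt (last x p) w /\ lt w x = lt w (last x p).
Proof.
move=> o; elim: p x => [|a p IH] x //= sA wA /andP[xa pa] wn nw.
have xp : x \in [:: x, a & p] by rewrite mem_head.
have ap : a \in [:: x, a & p] by rewrite !inE eqxx orbT.
have [||-> ->] := nonadj_side o (sA _ xp) (sA _ ap) wA xa _ _ (nw _ xp) (nw _ ap).
  by apply: contraNneq wn => ->; rewrite mem_head.
  by apply: contraNneq wn => ->; rewrite !inE eqxx orbT.
apply: IH => // [b bp||b bp].
- by apply: sA; rewrite in_cons bp orbT.
- by apply: contra wn => wp; rewrite in_cons wp orbT.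
- by apply: nw; rewrite in_cons bp orbT.
Qed.

(** Inside H_k the vertex [x] is linked to [z] along P_1, or to [y] along P_k and through t_k; a
    vertex that misses all of H_k lies on one side of such a path. *)
Lemma Hgraph_side k A x y z B lt w : Hgraph k A x y z -> orientation B lt ->
  A \subset B -> w \in B -> w \notin A -> (forall a, a \in A -> ~~ (w -- a)) ->
  lt x w -> lt y w || lt z w.
Proof.
case=> [{}x {}y p pn ip yp np|{}k {}A {}x {}y {}z x' p hA pn ip pA ta pa] o /subsetP AB wB wA nw xw.
  have [|||<- _] := @path_side B lt x p w o _ wB (induced_path_path ip).
  - by move=> a ap; apply: AB; rewrite !inE -in_cons ap orbT.
  - by apply: contra wA; rewrite !inE -in_cons => ->; rewrite orbT.
  - by move=> a ap; apply: nw; rewrite !inE -in_cons ap orbT.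
  by rewrite xw orbT.
have [xA yA zA] := Hgraph_mem hA; have [xy xz yz _ _] := Hgraph_indep hA.
have tp := mem_last x' p.
have sub a : a \in x' :: p -> a \in A :|: [set b in x' :: p].
  by move=> ap; rewrite in_setU in_set ap orbT.
have [|||] := @path_side B lt x' p w o _ wB (induced_path_path ip).
- by move=> a /sub /AB.
- by apply: contra wA => /sub.
- by move=> a /sub /nw.
rewrite xw => tw _; apply/orP; left.
have zB : z \in A :|: [set b in x' :: p] by rewrite in_setU zA.
have tA := sub _ tp; have tz : last x' p -- z by rewrite ta // eq_sym.
have [||<- _] := nonadj_side o (AB _ tA) (AB _ zB) wB tz _ _ (nw _ tA) (nw _ zB).
- by apply: contraNneq wA => ->.
- by apply: contraNneq wA => ->.
by rewrite -tw.
Qed.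

(** Induction on k, in one direction only, since orientations can be reversed. Let x_k < y_k < z_k.
    The vertex x_{k-1} misses P_k and lies on one side of it. If on the right, then, as t_k meets
    y_{k-1}, one gets z_{k-1} < y_{k-1} < x_{k-1}, against the induction hypothesis; if on the left,
    [Hgraph_side] puts y_{k-1} or z_{k-1} before x_k. *)
Lemma Hgraph_never_between k A x y z : Hgraph k A x y z -> never_between A x y z.
Proof.
have half : Hgraph k A x y z ->
    forall lt, orientation A lt -> ~~ (lt x y && lt y z).
  elim=> [{}x {}y p pn ip yp np|{}k {}A {}x {}y {}z x' p hA IH pn ip pA ta pa] lt o.
    have sub a : a \in x :: p -> a \in y |: [set b in x :: p].
      by move=> ap; rewrite in_setU1 in_set ap orbT.
    have yA : y \in y |: [set b in x :: p] by rewrite in_setU1 eqxx.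
    have [||-> _] := path_side o sub yA (induced_path_path ip) => //.
    by apply/negP=> /andP[/(orientation_asym o)->]; rewrite // sub // mem_last.
  have [xA yA zA] := Hgraph_mem hA; have [xy xz yz nxy nyz] := Hgraph_indep hA.
  have tp := mem_last x' p; set B := A :|: _ in o *.
  have sub a : a \in x' :: p -> a \in B by move=> ap; rewrite in_setU in_set ap orbT.
  have AB : A \subset B by exact: subsetUl.
  have subA a : a \in A -> a \in B by apply: subsetP.
  have oA := orientation_sub AB o.
  have tx' : last x' p != x' by rewrite last_neq //; case: ip.
  have tA : last x' p \notin A by apply: pA.
  apply/negP=> /andP[x'z zy].
  have [xB yB zB] := And3 (subA _ xA) (subA _ yA) (subA _ zA).
  have x'p := mem_head x' p; have [tB x'B] := (sub _ tp, sub _ x'p).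
  have x'y : lt x' y by exact: orientation_tr o x'B zB yB x'z zy.
  have nx b : b \in x' :: p -> ~~ (x -- b).
    move=> bp; have [->|bt] := eqVneq b (last x' p); last exact: pa.
    by rewrite adj_sym ta // eqxx.
  have xp : x \notin x' :: p by apply/negP=> /pA; rewrite xA.
  have [e1 e2] := path_side o sub xB (induced_path_path ip) xp nx.
  have ty : last x' p -- y by rewrite ta // eq_sym.
  have x'x : x' != x by apply: contraNneq xp => <-.
  have := oriE o x'B xB; rewrite x'x [x' -- x]adj_sym nx //=.
  case/orP=> [x'_x|xx'].
    have := oriE oA xA yA; rewrite xy nxy /=; case/orP=> [xlty|yltx].
      have := oriE o tB yB; rewrite ty andbF.
      by rewrite (orientation_tr o tB xB yB _ xlty) // -e1.
    by have := IH _ (orientation_rev oA); rewrite zy yltx.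
  have : lt y x' || lt z x'.
    apply: (Hgraph_side hA o AB x'B (pA _ x'p) _ xx') => a aA.
    by rewrite adj_sym pa // eq_sym.
  by rewrite (orientation_asym o x'B yB x'y) (orientation_asym o x'B zB x'z).
move=> h lt o; rewrite (half h _ o) /=.
by have := half h _ (orientation_rev o); rewrite andbC.
Qed.


End Orientation.

(** * Autonomous sets versus H_k *)

Section Fat.
Variable G : sgraph.
Implicit Types (A B W : {set G}) (lt : rel G).

Lemma induced_path_nil (x : G) : induced_path x [::].
Proof. by split=> // -[|i] [|j] //= _ _; rewrite adj_irrefl. Qed.

Lemma induced_path_cons (x a : G) q : x -- a -> x \notin a :: q ->
  (forall b, b \in q -> ~~ (x -- b)) -> induced_path a q -> induced_path x (a :: q).
Proof.
move=> xa xn nx [u ip]; split; first by rewrite cons_uniq xn.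
have dflt i : i < size (a :: q) -> nth x (a :: q) i = nth a (a :: q) i.
  by move=> lti; apply: set_nth_default.
have x_nth i : i < size (a :: q) -> x -- nth x (a :: q) i = (i == 0).
  case: i => [|i] lti; first exact: xa.
  by apply/negbTE/nx; exact: mem_nth.
case=> [|i] [|j] lti ltj; first by rewrite /= adj_irrefl.
- by rewrite [nth _ _ 0]/= [nth _ _ _]/= x_nth // eqSS orbF.
- by rewrite adj_sym [nth _ _ 0]/= [nth _ _ _]/= x_nth // eqSS.
by rewrite [nth _ _ i.+1]/= [nth _ _ j.+1]/= !dflt // ip // !eqSS.
Qed.

Lemma induced_path_behead (a b : G) q : induced_path a (b :: q) -> induced_path b q.
Proof.
move=> [/=/andP[_ u] ip]; split=> // i j lti ltj.
have := ip i.+1 j.+1 lti ltj; rewrite !eqSS => <-.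
by rewrite -!(set_nth_default b a).
Qed.

(** Cut the path at the last vertex that equals [x] or is adjacent to it. *)
Lemma induced_path_head (x a : G) q : induced_path a q ->
  x \in a :: q \/ has (adj x) (a :: q) ->
  exists q', [/\ induced_path x q', last x q' = last a q & {subset q' <= a :: q}].
Proof.
elim: q a => [|b q IH] a ip xq.
  have [->|xa] := eqVneq x a; first by exists [::]; split=> //; exact: induced_path_nil.
  exists [:: a]; split=> //; case: xq; rewrite ?inE ?(negbTE xa) //= orbF => xa'.
  by apply: induced_path_cons => //; rewrite ?inE //; exact: induced_path_nil.
have [xbq|xbq] := boolP ((x \in b :: q) || has (adj x) (b :: q)).
  have [|q' [? ? sq]] := IH b (induced_path_behead ip); first exact/orP.
  by exists q'; split=> // c /sq cq; rewrite in_cons cq orbT.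
move: xbq; rewrite negb_or => /andP[xbq nxbq].
have [->|xa] := eqVneq x a.
  by exists (b :: q); split=> // c cq; rewrite in_cons cq orbT.
exists (a :: b :: q); split=> //; apply: induced_path_cons => //.
- by case: xq => /= [|/orP[//|h]]; [rewrite in_cons (negbTE xa) (negbTE xbq)|rewrite /= h in nxbq].
- by rewrite in_cons negb_or xa.
by move=> c cq; apply: contra nxbq => xc; apply/hasP; exists c.
Qed.

Lemma path_induced (x : G) p : path (@adj G) x p ->
  exists q, [/\ induced_path x q, last x q = last x p & {subset q <= p}].
Proof.
elim: p x => [|a p IH] x; first by exists [::]; split=> //; exact: induced_path_nil.
move=> /andP[xa /IH[q [iq lq sq]]].
have [|q' [? lq' sq']] := induced_path_head iq (x := x); first by right; rewrite /= xa.
exists q'; split=> //; first by rewrite lq' lq.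
by move=> c /sq'; rewrite !in_cons => /orP[->//|/sq->]; rewrite orbT.
Qed.

Lemma Hgraph_fat A lt x z y : orientation A lt -> x \in A -> z \in A -> y \in A ->
  lt x z -> lt z y ->
  (exists k B, B \subset A /\ Hgraph k B x y z) \/
  (exists W, [/\ W \subset A, y \in W, z \in W, x \notin W & autonomous A lt W]).
Proof.
have [n] := ubnP #|A|; elim: n => // n IHn in A lt x z y *.
rewrite ltnS => cA o xA zA yA xz zy.
have [L [H [LH ltE adjE]]] := orientation_nat o.
have adjN a b : a \in A -> b \in A -> a -- b -> L a <= H b /\ L b <= H a.
  by move=> aA bA ab; apply/andP; rewrite -adjE // adj_neq.
have adjP a b : a \in A -> b \in A -> a != b -> L a <= H b -> L b <= H a -> a -- b.
  by move=> aA bA ab h1 h2; rewrite adjE // h1.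
have lt_nadj a b : a \in A -> b \in A -> H a < L b -> ~~ (a -- b).
  by move=> aA bA ab; apply/negP=> /(adjN _ _ aA bA)[? ?]; nlia.
rewrite !ltE // in xz zy.
have [Lx Lz Ly] := And3 (LH x xA) (LH z zA) (LH y yA).
(* [C] is [A] without the closed neighbourhood of [y], and [X] the component of [x] in it. [T]
   collects the other vertices that meet [X]; all of them meet [y]. [B] is what lies right of all of
   [X]. *)
pose C := [set w in A | (w != y) && ~~ (y -- w)].
pose e : rel G := fun a b => [&& a -- b, a \in C & b \in C].
have eC p a : path e a p -> {subset p <= C}.
  elim: p a => //= b p IHp a /andP[/and3P[_ _ bC] /IHp pC] c.
  by rewrite in_cons => /orP[/eqP->//|/pC].
pose X := [set a in A | connect e x a].
pose T := [set t in A | (t \notin X) && [exists a in X, a -- t]].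
pose B := [set w in A | [forall a in X, lt a w]].
have neH a b : H a < L b -> a \in A -> a != b.
  by move=> ab aA; apply: contraTneq ab => <-; rewrite -leqNgt LH.
have Cmem w : w \in A -> w != y -> ~~ (y -- w) -> w \in C by move=> ? ? ?; rewrite inE; apply/and3P.
have xC : x \in C.
  by apply: Cmem => //; [apply: neH => //; nlia|rewrite adj_sym lt_nadj //; nlia].
have zC : z \in C.
  by apply: Cmem => //; [apply: neH => //; nlia|rewrite adj_sym lt_nadj //; nlia].
have CA w : w \in C -> w \in A by rewrite inE => /andP[].
have XA a : a \in X -> a \in A by rewrite inE => /andP[].
have eX p : path e x p -> {subset x :: p <= C} /\ {subset x :: p <= X}.
  move=> ep; have h : {subset x :: p <= C}.
    move=> a; rewrite in_cons => /orP[/eqP->//|]; exact: eC ep _.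
  split=> // a ap; rewrite inE CA ?h //=.
  by apply: path_connect ep _ ap.
have XP a : a \in X -> exists p, [/\ path e x p, a = last x p, {subset x :: p <= X} & {subset x :: p <= C}].
  by rewrite inE => /andP[_ /connectP[p ep ->]]; exists p; case: (eX p ep).
have XC a : a \in X -> a \in C by move=> /XP[p [_ -> _]]; apply; exact: mem_last.
have pe p : path e x p -> path (@adj G) x p by apply: sub_path => a b /and3P[].
have Xlt a w : a \in X -> w \in A -> lt a w = (H a < L w) by move=> aX wA; apply: ltE => //; exact: XA.
have xX : x \in X by rewrite inE xA connect0.
have Xstep a b : a \in X -> b \in C -> a -- b -> b \in X.
  move=> aX bC ab; rewrite inE CA //=; move: (aX); rewrite inE => /andP[_ xa].
  by apply: connect_trans xa (connect1 _); rewrite /e ab bC XC.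
have Xside w a : w \in A -> w \notin X -> w \notin T -> a \in X ->
    lt x w = lt a w /\ lt w x = lt w a.
  move=> wA wX wT /XP[p [ep -> pX _]].
  apply: (path_side o _ wA (pe _ ep)) => [b bp|| b bp]; first by apply: XA; apply: pX.
    by apply: contra wX; apply: pX.
  apply: contra wT => wb; rewrite inE wA wX /=; apply/existsP; exists b.
  by rewrite pX // adj_sym.
(* A path from [x] to [z] that avoids the neighbours of [y] is the P_1 of an H_1. *)
have [zX|zX] := boolP (z \in X).
  left; have [p [ep zp _ pC]] := XP _ zX; have [q [iq lq sq]] := path_induced (pe _ ep).
  have qC : {subset x :: q <= C}.
    by move=> b; rewrite in_cons => /orP[/eqP->//|/sq bp]; apply: pC; rewrite in_cons bp orbT.
  exists 1, (y |: [set a in x :: q]); split.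
    by apply/subsetP=> b; rewrite in_setU1 in_set => /orP[/eqP->//|/qC/CA].
  rewrite zp -lq; apply: Hgraph_1 => //.
  - by apply/eqP=> q0; move: (neH _ _ xz xA); rewrite zp -lq q0 eqxx.
  - by apply/negP=> /qC; rewrite inE eqxx andbF.
  - by move=> a /qC; rewrite inE => /and3P[].
have zT : z \notin T.
  rewrite inE zA zX /=; apply/existsP=> -[a /andP[aX az]].
  by rewrite (Xstep _ _ aX zC az) in zX.
have yX : y \notin X by apply/negP=> /XC; rewrite inE eqxx andbF.
have yT : y \notin T.
  rewrite inE yA yX /=; apply/existsP=> -[a /andP[/XC]].
  by rewrite inE adj_sym => /and3P[_ _ /negbTE->].
have BP w : w \in B -> w \in A /\ forall a, a \in X -> H a < L w.
  by rewrite inE => /andP[wA /forall_inP h]; split=> // a aX; rewrite -Xlt ?h.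
have Bmem w : w \in A -> (forall a, a \in X -> H a < L w) -> w \in B.
  by move=> wA h; rewrite inE wA /=; apply/forall_inP => a aX; rewrite Xlt ?h.
have zB : z \in B.
  by apply: Bmem => // a aX; rewrite -Xlt // -(Xside _ _ zA zX zT aX).1 Xlt.
have yB : y \in B.
  apply: Bmem => // a aX; rewrite -Xlt // -(Xside _ _ yA yX yT aX).1 Xlt //; nlia.
have BX w : w \in B -> w \notin X.
  by move=> /BP[wA h]; apply/negP=> /h; rewrite ltnNge LH.
have TP t : t \in T -> exists a, [/\ t \in A, a \in X, a \in A & (L a <= H t) && (L t <= H a)].
  rewrite inE => /and3P[tA _ /existsP[a /andP[aX /(adjN _ _ (XA _ aX) tA)[h1 h2]]]].
  by exists a; rewrite h1 h2; split=> //; exact: XA.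
have BT w : w \in B -> w \notin T.
  move=> wB; apply/negP=> /TP[a [_ aX _ /andP[h1 h2]]].
  by have := (BP _ wB).2 a aX; nlia.
have Ty t : t \in T -> L y <= H t.
  move=> tT; have [a [tA aX _ _]] := TP t tT.
  have : t \notin C.
    move: tT; rewrite inE tA /= => /andP[tX /existsP[b /andP[bX bt]]].
    by apply: contra tX => tC; exact: Xstep bX tC bt.
  rewrite inE tA /= negb_and negbK; case/orP; last by rewrite negbK => /(adjN _ _ yA tA)[].
  by move/eqP=> ty; rewrite ty (negbTE yT) in tT.
have TB t w : t \in T -> w \in B -> L t <= H w.
  by move=> /TP[a [_ aX _ /andP[_ h]]] /BP[wA /(_ a aX)]; have := LH w; rewrite wA => /(_ isT); nlia.
have rest v : v \in A -> v \notin X -> v \notin T -> v \notin B -> H v < L x.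
  move=> vA vX vT vB; rewrite -ltE //.
  have vx : v != x by apply: contraNneq vX => ->.
  have nvx : ~~ (v -- x).
    by apply: contra vT => vx'; rewrite inE vA vX; apply/existsP; exists x; rewrite xX adj_sym.
  have := oriE o vA xA; rewrite vx nvx; case/orP=> // xv.
  case/negP: vB; apply: Bmem => // a aX.
  by rewrite -Xlt // -(Xside _ _ vA vX vT aX).1.
have below v w : v \in A -> v \notin T -> v \notin B -> w \in B -> H v < L w.
  move=> vA vT vB wB; have [wA hw] := BP _ wB; have [vX|vX] := boolP (v \in X); first exact: hw.
  by have := rest v vA vX vT vB; have := hw x xX; nlia.
(* Vertices outside [T] and [B] lie left of all of [B] ([below]). If moreover every vertex of [T]
   reaches all of [B], then [B] is autonomous. *)
have [/existsP[t0 /andP[t0T /existsP[w0 /andP[w0B tw0]]]]|nTB] :=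
    boolP [exists t in T, exists w in B, H t < L w]; last first.
  right; exists B; split=> //; first by apply/subsetP=> w /BP[].
    by apply: contraL xX => /BX.
  move=> v w w' vA vB wB w'B; have [wA w'A] := ((BP _ wB).1, (BP _ w'B).1).
  have := LH v vA; have := LH w wA; have := LH w' w'A.
  rewrite !ltE //; have [vT|vT] := boolP (v \in T).
    have h u : u \in B -> H v < L u = false.
      move=> uB; apply: contraNF nTB => vu; apply/existsP; exists v; rewrite vT.
      by apply/existsP; exists u; rewrite uB.
    rewrite !h //; have := TB v w vT wB; have := TB v w' vT w'B.
    by move=> *; split=> //; rewrite !ltnNge; congr negb; apply/idP/idP => _; nlia.
  have := below v w vA vT vB wB; have := below v w' vA vT vB w'B.
  by move=> *; split; apply/idP/idP => *; nlia.
have [t tT tmin] : exists2 t, t \in T & forall t', t' \in T -> H t <= H t'.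
  by case: (arg_minnP H t0T) => t; exists t.
have [x1 x1P x1min] : exists2 x1, (x1 \in B) && (H t < L x1) &
    forall w, w \in B -> H t < L w -> L x1 <= L w.
  have h0 : (w0 \in B) && (H t < L w0) by rewrite w0B; have := tmin _ t0T; nlia.
  case: (@arg_minnP _ w0 (fun w => (w \in B) && (H t < L w)) L h0) => x1 h h'; exists x1 => //.
  by move=> w wB tw; apply: h'; rewrite wB.
case/andP: x1P => x1B tx1; have [x1A x1X] := BP _ x1B.
have [a0 [tA a0X a0A /andP[La0t Lta0]]] := TP t tT; have Ht := LH t tA.
have tX : t \notin X by move: tT; rewrite inE => /and3P[].
have yt := Ty t tT; have Hx1 := LH x1 x1A.
(* A' is the window between X and the right end of t, where x1 stands for
   everything beyond it; the minimality of t and x1 lets an autonomous set of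
   the window remain autonomous in A. *)
pose A' := x1 |: [set w in B | w -- t].
have A'P w : w \in A' -> w != x1 -> w \in B /\ w -- t.
  by rewrite in_setU1 inE => /orP[/eqP->|/andP[]//]; rewrite eqxx.
have A'B w : w \in A' -> w \in B.
  by have [->//|ne /A'P] := eqVneq w x1; case.
have A'A : A' \subset A by apply/subsetP=> w /A'B /BP[].
(* The path from [x] through [X] to [t] is the new path of the larger graph: [t] meets all of the
   window except [x1], and [X] misses the window. *)
have extend k (D : {set G}) : D \subset A' -> Hgraph k D x1 z y ->
    exists k B, B \subset A /\ Hgraph k B x y z.
  move=> /subsetP DA' hD; have [p [ep a0p pX _]] := XP _ a0X.
  have : path (@adj G) x (rcons p t).
    by rewrite rcons_path pe // -a0p adjP //; apply: contraNneq tX => <-.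
  move=> /path_induced[q [iq]]; rewrite last_rcons => lq sq.
  have qX b : b \in x :: q -> b != t -> b \in X.
    rewrite in_cons => /orP[/eqP->//|/sq]; rewrite mem_rcons in_cons.
    by case/orP=> [->//|bp _]; apply: pX; rewrite in_cons bp orbT.
  have tq : t \in x :: q by rewrite -lq mem_last.
  exists k.+1, (D :|: [set b in x :: q]); split.
    apply/subsetP=> b; rewrite in_setU in_set => /orP[/DA'/(subsetP A'A)//|bq].
    by have [->//|/(qX _ bq)/XA] := eqVneq b t.
  apply: (@Hgraph_S _ k D x1 z y x q) => //; rewrite ?lq.
  - by apply/eqP=> q0; move: tX; rewrite -lq q0 xX.
  - move=> b bq; apply/negP=> /DA'/A'B bB; have [bt|/(qX _ bq)] := eqVneq b t.
      by have := BT _ bB; rewrite bt tT.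
    by apply/negP; exact: BX.
  - move=> a /DA' aA'; have [->|ne] := eqVneq a x1; first exact/negbTE/lt_nadj.
    by have [_ ?] := A'P _ aA' ne; rewrite adj_sym.
  - move=> a b /DA'/A'B aB bq bt; have bX := qX _ bq bt.
    have [aA hB] := BP _ aB.
    by rewrite adj_sym; apply: lt_nadj; [exact: XA|exact: aA|exact: hB].
have zt : z -- t.
  by apply: adjP => //; [by apply: contraTneq tT => <-| |]; have := (BP _ zB).2 _ a0X; nlia.
have yt' : y -- t.
  by apply: adjP => //; [by apply: contraTneq tT => <-| ]; have := (BP _ yB).2 _ a0X; nlia.
have zA' : z \in A' by rewrite in_setU1 inE zB zt orbT.
have yA' : y \in A' by rewrite in_setU1 inE yB yt' orbT.
have x1A' : x1 \in A' by rewrite in_setU1 eqxx.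
(* If [x1] meets [y], the edge [x1 -- y] is already P_1 for the mirrored triple, with [z] as the
   vertex that misses it. *)
have [x1y|x1y] := leqP (L x1) (H y).
  left; apply: (extend 1 (z |: [set a in [:: x1; y]])).
    by apply/subsetP=> w; rewrite in_setU1 in_set !in_cons orbF => /or3P[]/eqP->.
  have x1z : H z < L x1 by nlia.
  have ne : x1 != y by apply: contraTneq yt => <-; rewrite -ltnNge.
  have nz a : a \in [:: x1; y] -> (z != a) && ~~ (z -- a).
    by rewrite !inE => /orP[]/eqP->; rewrite neH ?lt_nadj.
  apply: (@Hgraph_1 _ x1 z [:: y]) => //.
  - apply: induced_path_cons => //; [|by rewrite inE|exact: induced_path_nil].
    by apply: adjP => //; nlia.
  - by apply/negP=> /nz; rewrite eqxx.
  - by move=> a /nz/andP[].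
have cA' : #|A'| < n.
  apply: leq_trans cA; apply: proper_card; apply/properP; split=> //.
  by exists x => //; apply/negP=> /A'B/BX; rewrite xX.
have := IHn A' (fun a b => lt b a) x1 y z cA' (orientation_rev (orientation_sub A'A o)) x1A' yA' zA'.
rewrite !ltE // => /(_ x1y zy) [[k [D [DA hD]]]|]; first by left; exact: extend hD.
case=> W [/subsetP WA' zW yW x1W aW]; right; exists W; split=> //.
- by apply/subsetP=> w /WA'/(subsetP A'A).
- by apply/negP=> /WA'/A'B/BX; rewrite xX.
(* Every member of [W] meets [t] and, like [y], ends before [x1]. Hence a vertex of [T], ending no
   earlier than [t], meets all of [W], and a vertex of [B] beyond [t] begins no earlier than [x1],
   so right of [W]. *)
have Wt w : w \in W -> [/\ w \in A, w \in B, L w <= H t & H w < L x1].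
  move=> wW; have [wB wt] : w \in B /\ w -- t.
    by apply: A'P; [exact: WA'|apply: contraNneq x1W => <-].
  have [wA _] := BP _ wB; have [? ?] := adjN _ _ wA tA wt; split=> //.
  by rewrite -ltE // -(aW x1 y w x1A' x1W yW wW).1 ltE.
move=> v w w' vA vW wW w'W.
have [wA wB wt wx1] := Wt _ wW; have [w'A w'B w't w'x1] := Wt _ w'W.
have Hv := LH v vA; have Hw := LH w wA; have Hw' := LH w' w'A.
have [vA'|vA'] := boolP (v \in A').
  by have [] := aW v w w' vA' vW wW w'W.
rewrite !ltE //; have [vT|vT] := boolP (v \in T).
  have := TB v w vT wB; have := TB v w' vT w'B; have := tmin v vT => *.
  by split; apply/idP/idP => *; nlia.
have [vB|vB] := boolP (v \in B).
  have vt : v != t by apply: contraNneq vT => ->.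
  have nvt : ~~ (v -- t) by apply: contra vA' => vt'; rewrite in_setU1 inE vB vt' orbT.
  have : H t < L v.
    have := oriE o vA tA; rewrite vt nvt !ltE // => /orP[] // h.
    by have := TB t v tT vB; nlia.
  by move=> /(x1min _ vB) ?; split; apply/idP/idP => *; nlia.
have := below v w vA vT vB wB; have := below v w' vA vT vB w'B => *.
by split; apply/idP/idP => *; nlia.
Qed.

End Fat.

(** * Orientations extending a Ferrers relation *)

Section Extension.
Variable G : sgraph.
Implicit Types (A B W : {set G}) (lt F : rel G).

Definition nonadj (a b : G) := (a != b) && ~~ (a -- b).

(** Equivalently, the rows of [F] are nested. *)
Definition ferrers F := forall p q p' q', F p q -> F p' q' -> F p q' || F p' q.

Definition satisfies A F lt := {in A &, forall p q, nonadj p q -> F p q -> lt p q}.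

(** No orientation honours both pairs, since one holds exactly when the other is reversed. *)
Definition conflict A F := exists p q p' q',
  [/\ [&& p \in A, q \in A, p' \in A & q' \in A], nonadj p q && nonadj p' q',
      F p q && F p' q' & forall lt, orientation A lt -> lt p q = lt q' p'].

Lemma nonadjC a b : nonadj a b = nonadj b a.
Proof. by rewrite /nonadj eq_sym adj_sym. Qed.

Lemma orientation_nonadj A lt a b : orientation A lt -> a \in A -> b \in A ->
  lt a b -> nonadj a b.
Proof. by move=> o aA bA ab; rewrite /nonadj -(oriE o aA bA) ab. Qed.

Lemma orientation_neg A lt a b : orientation A lt -> a \in A -> b \in A ->
  nonadj a b -> lt b a = ~~ lt a b.
Proof.
move=> o aA bA nab; have := oriE o aA bA; rewrite -/(nonadj a b) nab.
have [ab _|_ /=] := boolP (lt a b); last by [].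
exact: orientation_asym o aA bA ab.
Qed.

(** Rows are nested, so the largest one, that of [m], contains all others. If [m] is related to
    every other vertex, it is the source because there are no 2-cycles; a vertex other than [m]
    outside its row lies in no row. *)
Lemma ferrers_source A F x0 : ferrers F -> x0 \in A ->
  {in A &, forall p q, p != q -> F p q -> ~~ F q p} ->
  exists2 f, f \in A & {in A, forall q, q != f -> ~~ F q f}.
Proof.
move=> fF x0A as2; pose Out p := [set q in A | F p q].
have [m mA mmax] : exists2 m, m \in A & forall p, p \in A -> #|Out p| <= #|Out m|.
  by case: (arg_maxnP (fun p => #|Out p|) x0A) => m; exists m.
have nested q : q \in A -> Out q \subset Out m.
  move=> qA; apply: contraT => /subsetPn[y]; rewrite !inE => /andP[yA qy].
  rewrite yA /= => nmy; have := mmax q qA; rewrite leqNgt proper_card //.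
  apply/properP; split; last by exists y; rewrite !inE yA.
  apply/subsetP=> z; rewrite !inE => /andP[zA mz]; rewrite zA /=.
  by have := fF _ _ _ _ mz qy; rewrite (negbTE nmy).
have [/forall_inP all_out|] := boolP [forall f in A, (f != m) ==> F m f].
  exists m => // q qA qm; apply: as2 => //; first by rewrite eq_sym.
  exact: implyP (all_out q qA) qm.
rewrite negb_forall => /existsP[f]; rewrite !negb_imply => /and3P[fA fm nmf].
exists f => // q qA qf; apply: contra nmf => Fqf.
by have /subsetP/(_ f) := nested q qA; rewrite !inE fA Fqf => /(_ isT).
Qed.

Lemma edgeless_rank A F : ferrers F ->
  {in A &, forall p q, p != q -> F p q -> ~~ F q p} ->
  exists f : G -> nat, {in A &, injective f} /\
    {in A &, forall p q, p != q -> F p q -> f p < f q}.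
Proof.
move=> fF; have [n] := ubnP #|A|; elim: n => // n IHn in A *; rewrite ltnS => cA as2.
have [->|[x0 x0A]] := set_0Vmem A.
  by exists (fun=> 0); split=> p q; rewrite inE.
have [s sA smin] := ferrers_source fF x0A as2.
have sub x : x \in A :\ s -> x \in A by rewrite in_setD1 => /andP[].
have cA' : #|A :\ s| < n by move: cA; rewrite (cardsD1 s A) sA.
have [|f [finj fmono]] := IHn (A :\ s) cA'.
  by move=> p q /sub pA /sub qA; apply: as2.
exists (fun x => if x == s then 0 else (f x).+1); split=> p q pA qA.
  have [->|ps] := eqVneq p s; have [->|qs] := eqVneq q s => //.
  by move=> [/finj->] //; rewrite in_setD1 ?ps ?qs.
move=> pq; have [eqs|qs] := eqVneq q s.
  by move=> Fpq; have := smin p pA; rewrite -eqs pq Fpq => /(_ isT).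
by have [//|ps] := eqVneq p s; move=> Fpq; rewrite ltnS fmono // in_setD1 ?ps ?qs.
Qed.

(** Without edges every linear order is an orientation, and peeling off sources can only be
    prevented by a 2-cycle. *)
Lemma edgeless_extends A F : ferrers F -> {in A &, forall a b, ~~ (a -- b)} ->
  (exists lt, orientation A lt /\ satisfies A F lt) \/ conflict A F.
Proof.
move=> fF noadj.
have [as2|] := boolP [forall p in A, forall q in A, (p != q) && F p q ==> ~~ F q p].
  left; have [p q pA qA pq Fpq|f [finj fmono]] := @edgeless_rank A F fF.
    by have := forall_inP (forall_inP as2 p pA) q qA; rewrite pq Fpq.
  exists (fun x y => f x < f y); split.
    split=> [x y xA yA|a b c d _ _ _ _]; last by lia.
    by rewrite noadj // andbT -neq_ltn; congr negb; apply/eqP/eqP => [/finj->|->].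
  by move=> p q pA qA /andP[pq _]; exact: fmono.
case/forall_inPn=> p pA /forall_inPn[q qA]; rewrite negb_imply negbK.
case/andP=> /andP[pq Fpq] Fqp.
have npq : nonadj p q by rewrite /nonadj pq noadj.
by right; exists p, q, q, p; split; rewrite ?pA ?qA ?Fpq ?Fqp ?[nonadj q p]nonadjC ?npq.
Qed.

(** Autonomy in a single orientation would not do for contraction: a conflict of the quotient lifts
    because every orientation treats [W] as one vertex. *)
Definition uniform A W := W \subset A /\
  forall lt, orientation A lt -> autonomous A lt W.

Lemma autonomous_adj A lt W v w w' : orientation A lt -> W \subset A ->
  autonomous A lt W -> v \in A -> v \notin W -> w \in W -> w' \in W ->
  nonadj v w = nonadj v w'.
Proof.
move=> o /subsetP WA aW vA vW wW w'W; rewrite /nonadj.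
have [wA w'A] := (WA _ wW, WA _ w'W).
by rewrite -(oriE o vA wA) -(oriE o vA w'A); have [-> ->] := aW v w w' vA vW wW w'W.
Qed.

(** In the quotient [A2] the vertex [w] stands for [W], and [F2] is the image of [F]. Solutions on
    [W] and on [A2] are glued by substitution, while a conflict on either of them gives one on
    [A]. *)
Lemma uniform_contract A W w F lt0 : orientation A lt0 -> uniform A W -> w \in W ->
  let A2 := w |: (A :\: W) in
  let cl p := if p == w then W else [set p] in
  let F2 := fun p q => [exists p1 in cl p, exists q1 in cl q, F p1 q1] in
  (exists lt, orientation W lt /\ satisfies W F lt) \/ conflict W F ->
  (exists lt, orientation A2 lt /\ satisfies A2 F2 lt) \/ conflict A2 F2 ->
  (exists lt, orientation A lt /\ satisfies A F lt) \/ conflict A F.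
Proof.
move=> o0 [WA uW] wW A2 cl F2; have sWA := subsetP WA; have wA := sWA w wW.
have A2A : A2 \subset A by apply/subsetP=> x; rewrite !inE => /orP[/eqP->|/andP[]].
have sA2A := subsetP A2A.
case=> [[lt1 [o1 s1]]|[p [q [p' [q' [/and4P[pW qW p'W q'W] n FF e]]]]]] => [|_]; last first.
  right; exists p, q, p', q'; split=> //; first by rewrite !sWA.
  by move=> lt o; apply: e; apply: orientation_sub o.
have inA2 x : x \in A -> (if x \in W then w else x) \in A2.
  by move=> xA; rewrite !inE; case: ifP => [|xW]; rewrite ?eqxx // xW xA orbT.
have aW lt v x : orientation A lt -> v \in A -> v \notin W -> x \in W ->
    lt v x = lt v w /\ lt x v = lt w v by move=> o ? ? ?; apply: (uW _ o).
case=> [[lt2 [o2 s2]]|[p [q [p' [q' [/and4P[pA qA p'A q'A] n FF e]]]]]]; last first.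
  have lift x y : x \in A2 -> y \in A2 -> nonadj x y -> F2 x y ->
    exists x1 y1, [/\ x1 \in A, y1 \in A, nonadj x1 y1, F x1 y1 &
      forall lt, orientation A lt -> lt x1 y1 = lt x y /\ lt y1 x1 = lt y x].
    move=> xA yA nxy /existsP[x1 /andP[x1x /existsP[y1 /andP[y1y Fxy]]]].
    have outW z : z \in A2 -> z != w -> z \in A /\ z \notin W.
      by rewrite !inE => /orP[->//|/andP[-> ->]].
    have rel : x1 \in A /\ y1 \in A /\ forall lt, orientation A lt -> lt x1 y1 = lt x y /\ lt y1 x1 = lt y x.
      move: x1x y1y; rewrite /cl; case: (eqVneq x w) => [xw|xw]; case: (eqVneq y w) => [yw|yw].
      - by move: nxy; rewrite xw yw /nonadj eqxx.
      - move=> x1W /set1P->; have [yA' yW] := outW _ yA yw; split; [exact: sWA|split=> // lt o].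
        by rewrite xw; have [-> ->] := aW lt y x1 o yA' yW x1W.
      - move=> /set1P-> y1W; have [xA' xW] := outW _ xA xw; split=> //; split; [exact: sWA|move=> lt o].
        by rewrite yw; have [-> ->] := aW lt x y1 o xA' xW y1W.
      - by move=> /set1P-> /set1P->; split; [exact: sA2A|split=> //; exact: sA2A].
    case: rel => x1A [y1A rel]; exists x1, y1; split=> //.
    rewrite /nonadj -(oriE o0) //; have [-> ->] := rel _ o0.
    by rewrite (oriE o0) ?sA2A.
  case/andP: n => n n'; case/andP: FF => FF FF'.
  have [p1 [q1 [p1A q1A n1 F1 e1]]] := lift p q pA qA n FF.
  have [p2 [q2 [p2A q2A n2 F2' e2]]] := lift p' q' p'A q'A n' FF'.
  right; exists p1, q1, p2, q2; split; rewrite ?p1A ?q1A ?p2A ?q2A ?n1 ?n2 ?F1 ?F2' //.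
  move=> lt o; have [-> _] := e1 _ o; have [_ ->] := e2 _ o; apply: e.
  exact: orientation_sub o.
(* [lt1] inside [W], and [lt2] through representatives elsewhere; the interval-order condition is
   inherited from [lt0] by [orientation_trans]. *)
left; pose pi x := if x \in W then w else x.
pose lt x y := if (x \in W) && (y \in W) then lt1 x y else lt2 (pi x) (pi y).
have pin x y : x \in A -> y \in A -> (x \in W) && (y \in W) = false ->
    nonadj (pi x) (pi y) = nonadj x y.
  move=> xA yA; rewrite /pi; have [xW|xW] := boolP (x \in W); have [yW|yW] := boolP (y \in W) => //= _.
    by rewrite nonadjC [RHS]nonadjC; apply: (autonomous_adj o0 WA (uW _ o0)).
  exact: (autonomous_adj o0 WA (uW _ o0)).
have ltE : {in A &, forall x y, lt x y || lt y x = (x != y) && ~~ (x -- y)}.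
  move=> x y xA yA; rewrite /lt [(y \in W) && _]andbC; case: ifP => [/andP[xW yW]|xy].
    exact: (oriE o1).
  by rewrite (oriE o2) ?inA2 // -/(nonadj _ _) pin.
exists lt; split; last first.
  move=> p q pA qA npq Fpq; rewrite /lt; case: ifP => [/andP[pW qW]|pqW]; first exact: s1.
  apply: s2; rewrite ?inA2 ?pin //; apply/existsP; exists p.
  have clpi z : z \in cl (pi z).
    rewrite /cl /pi; have [zW|zW] := boolP (z \in W); first by rewrite eqxx.
    by case: (eqVneq z w) => [e|_]; [rewrite e wW in zW|rewrite inE].
  by rewrite clpi; apply/existsP; exists q; rewrite clpi.
apply: (orientation_trans o0 ltE) => [x y xA yA|a b c aA bA cA].
  rewrite /lt [(y \in W) && _]andbC; case: ifP => [/andP[xW yW]|xy]; apply/negP=> /andP[h1 h2].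
    by rewrite (orientation_asym o1 xW yW h1) in h2.
  by rewrite (orientation_asym o2 (inA2 _ xA) (inA2 _ yA) h1) in h2.
have [paA pbA pcA] := And3 (inA2 _ aA) (inA2 _ bA) (inA2 _ cA).
rewrite /lt /pi; have [aW'|aW'] := boolP (a \in W); have [bW|bW] := boolP (b \in W);
  have [cW|cW] := boolP (c \in W) => //=; rewrite ?aW' ?bW ?cW ?(negbTE aW') ?(negbTE bW) ?(negbTE cW) /= in paA pbA pcA *.
all: move=> h1 h2; by first [exact: h1 | exact: h2
  | exact: (orientation_tr o1 aW' bW cW h1 h2)
  | exact: (orientation_tr o2 paA pbA pcA h1 h2)
  | rewrite (orientation_asym o2 paA pbA h1) in h2].
Qed.

Lemma autonomous_rev A lt W : autonomous A lt W -> autonomous A (fun x y => lt y x) W.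
Proof. by move=> aW v w w' vA vW wW w'W; have [] := aW v w w' vA vW wW w'W. Qed.

(** * Components, co-components and maximal autonomous sets *)

Definition component A (e : rel G) a :=
  [set u in A | connect [rel u v | [&& u \in A, v \in A & e u v]] a u].

Lemma component_self A (e : rel G) a : a \in A -> a \in component A e a.
Proof. by move=> aA; rewrite inE aA connect0. Qed.

Lemma component_sub A (e : rel G) a : component A e a \subset A.
Proof. by apply/subsetP=> u; rewrite inE => /andP[]. Qed.

Lemma component_step A (e : rel G) a u v : u \in component A e a -> v \in A -> e u v ->
  v \in component A e a.
Proof.
rewrite !inE => /andP[uA au] vA uv; rewrite vA /=; apply: connect_trans au _.
by apply: connect1; rewrite /= uA vA.
Qed.

Lemma component_ind A (e : rel G) a (P : G -> Prop) : P a ->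
  (forall u v, u \in component A e a -> v \in component A e a -> e u v -> P u -> P v) ->
  forall u, a \in A -> u \in component A e a -> P u.
Proof.
move=> Pa step u aA; rewrite inE => /andP[_ /connectP[p ep ->]].
suff walk : forall q c, c \in component A e a -> P c ->
    path [rel u v | [&& u \in A, v \in A & e u v]] c q -> P (last c q).
  by apply: walk ep => //; exact: component_self.
elim=> //= b q IHq c cK Pc /andP[/and3P[cA bA cb] bq].
have bK := component_step cK bA cb.
by apply: IHq => //; exact: step Pc.
Qed.

Lemma component_side A B lt a v u : orientation B lt -> A \subset B -> a \in A -> v \in B ->
  v \notin component A (@adj G) a -> (forall u, u \in component A (@adj G) a -> ~~ (v -- u)) ->
  u \in component A (@adj G) a -> lt v u = lt v a /\ lt u v = lt a v.
Proof.
move=> o /subsetP AB aA vB vK nv uK; pose P u := lt v u = lt v a /\ lt u v = lt a v.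
apply: (@component_ind A (@adj G) a P) uK => // b c bK cK bc; rewrite /P.
have sK w : w \in component A (@adj G) a -> w \in B by move/(subsetP (component_sub _ _ _))/AB.
have neq w : w \in component A (@adj G) a -> v != w by move=> wK; apply: contraNneq vK => ->.
by have [-> ->] := nonadj_side o (sK _ bK) (sK _ cK) vB bc (neq _ bK) (neq _ cK) (nv _ bK) (nv _ cK).
Qed.

(** An outside vertex misses the component and therefore lies on one side of it in each
    orientation. *)
Lemma component_uniform A a : a \in A -> uniform A (component A (@adj G) a).
Proof.
move=> aA; split; first exact: component_sub.
move=> lt o v w w' vA vK wK w'K.
have nv u : u \in component A (@adj G) a -> ~~ (v -- u).
  by move=> uK; apply: contra vK => vu; apply: component_step uK vA _; rewrite adj_sym.
have [-> ->] := component_side o (subxx A) aA vA vK nv wK.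
by have [-> ->] := component_side o (subxx A) aA vA vK nv w'K.
Qed.

(** An outside vertex is adjacent to the whole co-component and so comparable with none of it. *)
Lemma cocomp_uniform A a : a \in A -> uniform A (component A nonadj a).
Proof.
move=> aA; split; first exact: component_sub.
move=> lt o v w w' vA vK wK w'K.
have nv u : u \in component A nonadj a -> lt v u = false /\ lt u v = false.
  move=> uK; have uA := subsetP (component_sub _ _ _) _ uK.
  suff : lt v u || lt u v = false by case: (lt v u).
  rewrite (oriE o vA uA) -/(nonadj v u) nonadjC; apply: contraNF vK.
  exact: component_step.
by have [-> ->] := nv w wK; have [-> ->] := nv w' w'K.
Qed.

(* If v can be placed both inside and beyond W, then W can be enlarged. *)
Lemma maximal_autonomous_isolated A W lt0 lt v w1 w2 : orientation A lt0 -> W \subset A ->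
  autonomous A lt0 W -> (forall W', W' \subset A -> autonomous A lt0 W' ->
    #|W| < #|W'| -> W' = A) ->
  orientation A lt -> v \in A -> v \notin W -> w1 \in W -> w2 \in W ->
  lt w1 v -> lt v w2 -> lt0 w1 v ->
  forall t w, t \in A -> t \notin W -> w \in W -> ~~ (t -- w).
Proof.
move=> o0 /subsetP WA aW maxW o vA vW w1W w2W w1v vw2 w1v0.
have [w1A w2A] := (WA _ w1W, WA _ w2W).
have Wv w : w \in W -> lt0 w v by move=> wW; rewrite -(aW v w1 w vA vW w1W wW).2.
have adjW t w w' : t \in A -> t \notin W -> w \in W -> w' \in W -> t -- w -> t -- w'.
  move=> tA tW wW w'W; have tne u : u \in W -> t != u by move=> uW; apply: contraNneq tW => ->.
  have WA' : W \subset A by apply/subsetP.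
  have := autonomous_adj o0 WA' aW tA tW wW w'W.
  by rewrite /nonadj !tne //= => /negb_inj->.
(* [T] consists of the outside neighbours of [W] and is to be shown empty. [C] is the part that
   stays connected to [v] once [W] and [T] are removed; it sits on the same side of [W] as [v] in
   every orientation. *)
pose T := [set t in A | (t \notin W) && (t -- w1)].
pose D := A :\: (W :|: T).
have DA : D \subset A by exact: subsetDl.
have nWD u w : u \in D -> w \in W -> (u != w) && ~~ (u -- w).
  rewrite !inE negb_or => /andP[/andP[uW uT] uA] wW; apply/andP; split.
    by apply: contraNneq uW => ->.
  by apply: contra uT => uw; rewrite uA uW (adjW _ w).
have vD : v \in D.
  rewrite !inE vA (negbTE vW) /= andbT; have := orientation_nonadj o w1A vA w1v.
  by rewrite nonadjC => /andP[_ ->].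
pose C := component D (@adj G) v; have CD c : c \in C -> c \in D by apply/subsetP; exact: component_sub.
have CA c : c \in C -> c \in A by move/CD/(subsetP DA).
have Cside lt' w c : orientation A lt' -> w \in W -> c \in C ->
    lt' w c = lt' w v /\ lt' c w = lt' v w.
  move=> o' wW cC; apply: (component_side o' DA vD (WA _ wW) _ _ cC).
    by apply/negP=> /CD; rewrite !inE wW.
  by move=> u /CD uD; rewrite adj_sym; case/andP: (nWD _ _ uD wW).
have [L [H [LH ltE adjE]]] := orientation_nat o.
have [L0 [H0 [LH0 ltE0 adjE0]]] := orientation_nat o0.
have TP t : t \in T -> [/\ t \in A, t \notin W, t != w1 & t -- w1].
  rewrite inE => /and3P[tA tW tw]; split=> //; exact: adj_neq.
(* In [lt] all of [C] lies between [w1] and [w2]; since [t] meets both, it meets all of [C]. *)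
have TC t c : t \in T -> c \in C -> (t != c) && (t -- c).
  move=> tT cC; have [tA tW tw1 atw1] := TP t tT; have cA := CA _ cC.
  have tw2 : t != w2 by apply: contraNneq tW => ->.
  have atw2 := adjW _ _ _ tA tW w1W w2W atw1.
  have tc : t != c by apply: contraTneq (CD _ cC) => <-; rewrite in_setD in_setU tT orbT.
  rewrite tc /=; have : lt w1 c by rewrite (Cside lt w1 c o w1W cC).1.
  have : lt c w2 by rewrite (Cside lt w2 c o w2W cC).2.
  move: atw1 atw2; rewrite !adjE // !ltE //.
  have := LH c cA => ?.
  by move=> /andP[? ?] /andP[? ?] ? ?; apply/andP; split; nlia.
(* [M] fills the gap between [W] and [C] in [lt0]; with it the union becomes autonomous. *)
pose M := [set u in A | [forall w in W, lt0 w u] && [forall c in C, lt0 u c]].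
have vC : v \in C by exact: component_self.
have MP u : u \in M -> [/\ u \in A, forall w, w \in W -> lt0 w u & forall c, c \in C -> lt0 u c].
  by rewrite inE => /and3P[uA /forall_inP ? /forall_inP ?].
have WC w c : w \in W -> c \in C -> lt0 w c.
  by move=> wW cC; rewrite (Cside lt0 w c o0 wW cC).1 Wv.
pose W' := W :|: C :|: M.
have W'P u : u \in W' -> [\/ u \in W, u \in C | u \in M].
  by rewrite !in_setU -orbA => /or3P.
have W'A : W' \subset A.
  by apply/subsetP=> u /W'P[/WA|/CA|/MP[]].
have tri u : u \in A -> u \notin W' ->
    [\/ forall w, w \in W' -> lt0 u w = false /\ lt0 w u = false,
        forall w, w \in W' -> lt0 u w | forall w, w \in W' -> lt0 w u].
  move=> uA; rewrite !in_setU !negb_or -andbA => /and3P[uW uC uM].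
  have [uT|uT] := boolP (u \in T).
    have [_ _ uw1 auw1] := TP u uT; apply: Or31 => w /W'P wW'.
    have ncross b : b \in A -> u -- b -> lt0 u b = false /\ lt0 b u = false.
      move=> bA ub; suff : lt0 u b || lt0 b u = false by case: (lt0 u b).
      by rewrite (oriE o0) // ub andbF.
    case: wW' => [wW|wC|wM]; first by apply: ncross; [exact: WA|exact: (adjW _ w1)].
      by apply: ncross; [exact: CA|case/andP: (TC _ _ uT wC)].
    have [wA /(_ w1 w1W) h1 /(_ v vC) h2] := MP w wM.
    have [uv auv] := andP (TC _ _ uT vC).
    move: auw1 auv h1 h2; rewrite !adjE0 // !ltE0 //.
    move=> /andP[? ?] /andP[? ?] ? ?; have := LH0 u uA; have := LH0 w wA => ? ?.
    by split; apply/negP=> ?; nlia.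
  have uD : u \in D.
    by rewrite !inE uA (negbTE uW) /= andbT; move: uT; rewrite inE uA uW.
  have /andP[uw1 nuw1] := nWD u w1 uD w1W.
  have nuC c : c \in C -> ~~ (u -- c).
    by move=> cC; apply: contra uC => uc; apply: component_step cC uD _; rewrite adj_sym.
  have uCside c : c \in C -> lt0 u c = lt0 u v /\ lt0 c u = lt0 v u.
    exact: (component_side o0 DA vD uA uC nuC).
  have := oriE o0 uA w1A; rewrite uw1 nuw1; case/orP=> [uw|wu].
    apply: Or32 => w /W'P[wW|wC|/MP[wA /(_ w1 w1W) h _]].
    - by rewrite (aW u w w1 uA uW wW w1W).1.
    - exact: orientation_tr o0 uA w1A (CA _ wC) uw (WC _ _ w1W wC).
    - exact: orientation_tr o0 uA w1A wA uw h.
  have uv : u != v by apply: contraNneq uC => ->.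
  have := oriE o0 uA vA; rewrite uv nuC //; case/orP=> [uv'|vu].
    case/negP: uM; rewrite inE uA /=; apply/andP; split; apply/forall_inP => w wW.
      by rewrite -(aW u w1 w uA uW w1W wW).2.
    by rewrite (uCside w wW).1.
  apply: Or33 => w /W'P[wW|wC|/MP[wA _ /(_ v vC) h]].
  - by rewrite (aW u w w1 uA uW wW w1W).2.
  - by rewrite (uCside w wC).2.
  - exact: orientation_tr o0 wA vA uA h vu.
have autW' : autonomous A lt0 W'.
  move=> u w w' uA uW' wW' w'W'; have [wA w'A] := (subsetP W'A _ wW', subsetP W'A _ w'W').
  have [h|h|h] := tri u uA uW'.
  - by have [-> ->] := h w wW'; have [-> ->] := h w' w'W'.
  - have [h1 h2] := (h w wW', h w' w'W').
    by rewrite h1 h2 !(orientation_asym o0 uA _ _) //.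
  - have [h1 h2] := (h w wW', h w' w'W').
    by rewrite h1 h2 (orientation_asym o0 wA uA h1) (orientation_asym o0 w'A uA h2).
(* Maximality leaves nothing outside [W'], whereas a vertex of [T] can belong to none of its three
   parts. *)
have W'full : W' = A.
  apply: maxW => //; apply: proper_card; apply/properP; split.
    by apply/subsetP=> w wW; rewrite !in_setU wW.
  by exists v; rewrite // !in_setU vC orbT.
move=> t w tA tW wW; apply/negP=> tw.
have tT : t \in T by rewrite inE tA tW (adjW _ w).
have [_ _ tw1 atw1] := TP t tT.
move: tA; rewrite -W'full => /W'P[tW'|/(TC t t tT)|/MP[_ /(_ w1 w1W) h _]].
- by rewrite tW' in tW.
- by rewrite eqxx.
- have [tA _ _ _] := TP t tT; have := oriE o0 w1A tA.
  by rewrite h [w1 -- t]adj_sym atw1 andbF.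
Qed.

(** Some orientation splits [W]: an outside vertex [v] lies between two of its members. Up to
    reversing [lt0], this [v] lies right of [W] there. *)
Lemma isolated_of_not_uniform A W lt0 : orientation A lt0 -> W \subset A ->
  autonomous A lt0 W -> (forall W', W' \subset A -> autonomous A lt0 W' ->
    #|W| < #|W'| -> W' = A) -> ~ uniform A W ->
  forall t w, t \in A -> t \notin W -> w \in W -> ~~ (t -- w).
Proof.
move=> o0 WA aW maxW nu.
have [lt [o nlt]] : exists lt, orientation A lt /\ ~ autonomous A lt W.
  apply: contrapT => h; apply: nu; split=> // lt o; apply: contrapT => nlt.
  by apply: h; exists lt.
have [v [w1 [w2 [vA vW w1W w2W [w1v vw2]]]]] : exists v w1 w2,
    [/\ v \in A, v \notin W, w1 \in W, w2 \in W & lt w1 v /\ lt v w2].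
  apply: contrapT => h; apply: nlt => v w w' vA vW wW w'W.
  have [wA w'A] := (subsetP WA _ wW, subsetP WA _ w'W).
  have n2 w1 w2 : w1 \in W -> w2 \in W -> lt w1 v -> lt v w2 -> False.
    by move=> w1W w2W h1 h2; apply: h; exists v, w1, w2.
  have nn := autonomous_adj o0 WA aW vA vW wW w'W.
  have := oriE o vA wA; have := oriE o vA w'A; rewrite -!/(nonadj _ _) -nn.
  case: (nonadj v w); last by case: (lt v w) (lt w v) (lt v w') (lt w' v) => [] [] [] [].
  move=> h1 h2; case e1: (lt v w) h2 => /= h2.
    rewrite (orientation_asym o vA wA e1); case e2: (lt v w') h1 => /= h1.
      by rewrite (orientation_asym o vA w'A e2).
    by case: (n2 _ _ w'W wW h1 e1).
  rewrite h2; case e2: (lt v w') h1 => /= h1; last by rewrite h1.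
  by case: (n2 _ _ wW w'W h2 e2).
have [w1A w2A] := (subsetP WA _ w1W, subsetP WA _ w2W).
have := orientation_nonadj o w1A vA w1v; rewrite /nonadj -(oriE o0) //.
case/orP=> [w1v0|vw10].
  exact: (maximal_autonomous_isolated o0 WA aW maxW o vA vW w1W w2W).
apply: (maximal_autonomous_isolated (orientation_rev o0) WA (autonomous_rev aW) _ o vA vW w1W w2W) => //.
by move=> W' W'A aW'; apply: maxW => //; have := autonomous_rev aW'.
Qed.

(** * Prime orientations are unique up to reversal *)

Definition between_in lt (x z y : G) := lt x z && lt z y || lt y z && lt z x.

(** [Hgraph_fat] is applied to the chain from both ends. Primeness excludes the autonomous sets, and
    the two graphs H_k forbid the other two vertices to be the middle one. *)
Lemma prime_between A lt0 lt x z y : orientation A lt0 ->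
  (forall W, W \subset A -> autonomous A lt0 W -> 1 < #|W| -> W = A) ->
  orientation A lt -> x \in A -> y \in A -> z \in A ->
  nonadj x y -> nonadj x z -> nonadj y z ->
  between_in lt0 x z y -> between_in lt x z y.
Proof.
move=> o0 prime o xA yA zA nxy nxz nyz.
have nb lt1 a b c : orientation A lt1 -> (forall W, W \subset A -> autonomous A lt1 W -> 1 < #|W| -> W = A) ->
    a \in A -> b \in A -> c \in A -> nonadj b c -> lt1 a b -> lt1 b c ->
    ~~ (lt a c && lt c b) && ~~ (lt b c && lt c a).
  move=> o1 prime1 aA bA cA nbc ab bc.
  case: (Hgraph_fat o1 aA bA cA ab bc) => [[k [B [BA hB]]]|[W [WA cW bW aW aut]]].
    exact: (Hgraph_never_between hB (orientation_sub BA o)).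
  have W2 : 1 < #|W|.
    rewrite (cardD1 b) bW (cardD1 c) !inE cW ?andbT.
    by case/andP: nbc; rewrite eq_sym => ->.
  by move: aW; rewrite (prime1 W WA aut W2) aA.
have half lt1 : orientation A lt1 -> (forall W, W \subset A -> autonomous A lt1 W -> 1 < #|W| -> W = A) ->
    lt1 x z -> lt1 z y -> between_in lt x z y.
  move=> o1 pr xz zy; have h1 := nb lt1 x z y o1 pr xA zA yA; rewrite nonadjC in h1.
  have := h1 nyz xz zy.
  have pr' : forall W, W \subset A -> autonomous A (fun a b => lt1 b a) W -> 1 < #|W| -> W = A.
    by move=> W WA aW; apply: pr => //; have := autonomous_rev aW.
  have h2 := nb _ y z x (orientation_rev o1) pr' yA zA xA; rewrite [nonadj z x]nonadjC in h2.
  have := h2 nxz zy xz; rewrite /between_in.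
  rewrite (orientation_neg o xA yA nxy) (orientation_neg o xA zA nxz) (orientation_neg o yA zA nyz).
  by case: (lt x y) (lt x z) (lt y z) => [] [] [].
case/orP=> /andP[h1 h2]; first exact: (half lt0).
apply: (half (fun a b => lt0 b a)) => //; first exact: orientation_rev.
by move=> W WA aW; apply: prime => //; have := autonomous_rev aW.
Qed.

(** If [b -- c], then [a] sees both alike. Otherwise the triple is independent, and two linear
    orders of three elements with the same middle element are equal or reverse to each other. *)
Lemma prime_agree A lt0 lt a b c : orientation A lt0 ->
  (forall W, W \subset A -> autonomous A lt0 W -> 1 < #|W| -> W = A) ->
  orientation A lt -> a \in A -> b \in A -> c \in A -> nonadj a b -> nonadj a c ->
  (lt a b == lt0 a b) = (lt a c == lt0 a c).
Proof.
move=> o0 prime o aA bA cA nab nac; have [->//|bc] := eqVneq b c.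
have [abc|nbc] := boolP (b -- c).
  move: (nab) (nac) => /andP[? ?] /andP[? ?].
  have [||||_ ->] := nonadj_side o bA cA aA abc => //.
  by have [||||_ ->] := nonadj_side o0 bA cA aA abc => //.
have {}nbc : nonadj b c by rewrite /nonadj bc nbc.
have bet x z y := prime_between o0 prime o (x := x) (z := z) (y := y).
have := bet a b c aA cA bA; have := bet a c b aA bA cA; have := bet b a c bA cA aA.
rewrite ![nonadj b a]nonadjC ![nonadj c a]nonadjC ![nonadj c b]nonadjC nab nac nbc.
move=> /(_ isT isT isT) h1 /(_ isT isT isT) h2 /(_ isT isT isT) h3.
move: h1 h2 h3; rewrite /between_in.
rewrite (orientation_neg o aA bA nab) (orientation_neg o aA cA nac) (orientation_neg o bA cA nbc).
rewrite (orientation_neg o0 aA bA nab) (orientation_neg o0 aA cA nac) (orientation_neg o0 bA cA nbc).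
have := @orientation_tr _ A lt0 a b c o0 aA bA cA.
have := @orientation_tr _ A lt0 c b a o0 cA bA aA.
have := @orientation_tr _ A lt a b c o aA bA cA.
have := @orientation_tr _ A lt c b a o cA bA aA.
rewrite (orientation_neg o aA bA nab) (orientation_neg o aA cA nac) (orientation_neg o bA cA nbc).
rewrite (orientation_neg o0 aA bA nab) (orientation_neg o0 aA cA nac) (orientation_neg o0 bA cA nbc).
case: (lt a b) (lt a c) (lt b c) (lt0 a b) (lt0 a c) (lt0 b c) => [] [] [] [] [] [] //= t1 t2 t3 t4 h1 h2 h3;
  by first [done | have := t1 isT isT; done | have := t2 isT isT; done
    | have := t3 isT isT; done | have := t4 isT isT; done
    | have := h1 isT; done | have := h2 isT; done | have := h3 isT; done].
Qed.

(** Agreement with [lt0] propagates along non-edges, hence by co-connectedness to all of them: only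
    [lt0] and its reverse are possible. Two pairs of [F] violating one each form a conflict. *)
Lemma prime_extends A F lt0 : orientation A lt0 ->
  (forall W, W \subset A -> autonomous A lt0 W -> 1 < #|W| -> W = A) ->
  (forall a, a \in A -> 1 < #|component A nonadj a| -> component A nonadj a = A) ->
  (exists lt, orientation A lt /\ satisfies A F lt) \/ conflict A F.
Proof.
move=> o0 prime coconn.
have agree lt p q p' q' : orientation A lt -> p \in A -> q \in A -> p' \in A -> q' \in A ->
    nonadj p q -> nonadj p' q' -> (lt p q == lt0 p q) = (lt p' q' == lt0 p' q').
  move=> o pA qA p'A q'A npq np'q'.
  have comp2 : 1 < #|component A nonadj p|.
    apply/card_gt1P; exists p, q; rewrite component_self // (component_step (component_self _ pA) qA npq).
    by case/andP: npq.
  have p'K : p' \in component A nonadj p by rewrite (coconn p pA comp2).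
  pose P v := forall c, c \in A -> nonadj v c -> (lt p q == lt0 p q) = (lt v c == lt0 v c).
  apply: (@component_ind A nonadj p P _ _ p' pA p'K) => //.
    by move=> c cA npc; exact: prime_agree o0 prime o _ _ _ _ _.
  move=> u v /(subsetP (component_sub _ _ _)) uA /(subsetP (component_sub _ _ _)) vA nuv Pu c cA nvc.
  have nvu : nonadj v u by rewrite nonadjC.
  rewrite (Pu v vA nuv) -(prime_agree o0 prime o vA uA cA nvu nvc).
  rewrite (orientation_neg o uA vA nuv) (orientation_neg o0 uA vA nuv).
  by case: (lt u v) (lt0 u v) => [] [].
have [/forall_inP ok|] := boolP [forall p in A, forall q in A, nonadj p q && F p q ==> lt0 p q].
  left; exists lt0; split=> // p q pA qA npq Fpq.
  by have := forall_inP (ok p pA) q qA; rewrite npq Fpq.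
case/forall_inPn=> p' p'A /forall_inPn[q' q'A]; rewrite negb_imply => /andP[/andP[n' F'] nlt].
have [/forall_inP ok|] := boolP [forall p in A, forall q in A, nonadj p q && F p q ==> lt0 q p].
  left; exists (fun x y => lt0 y x); split; first exact: orientation_rev.
  move=> p q pA qA npq Fpq; by have := forall_inP (ok p pA) q qA; rewrite npq Fpq.
case/forall_inPn=> p pA /forall_inPn[q qA]; rewrite negb_imply => /andP[/andP[n FF] nlt'].
right; exists p, q, p', q'; split; rewrite ?pA ?qA ?p'A ?q'A ?n ?n' ?FF //.
move=> lt o; have := agree lt p q p' q' o pA qA p'A q'A n n'.
rewrite (orientation_neg o p'A q'A n') (negbTE nlt).
have := orientation_neg o0 pA qA n; rewrite (negbTE nlt') => /esym/negbFE->.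
by case: (lt p q) (lt p' q') => [] [].
Qed.

(** Induction on the size of [A]. A proper uniform set with at least two elements is contracted;
    without one, every component and co-component is a single vertex or [A]. If [lt0] is not prime,
    a maximal proper autonomous set is not uniform and has no edge to the outside, so [A] is
    disconnected and therefore edgeless. *)
Theorem orientation_extends A F : ferrers F -> (exists lt0, orientation A lt0) ->
  (exists lt, orientation A lt /\ satisfies A F lt) \/ conflict A F.
Proof.
have [n] := ubnP #|A|; elim: n => // n IHn in A F *; rewrite ltnS => cA fF [lt0 o0].
have [[W [uW W1 WA]]|nuW] := pselect (exists W, [/\ uniform A W, 1 < #|W| & #|W| < #|A|]).
  have [w wW] : exists w, w \in W by apply/card_gt0P; exact: ltnW.
  have wA := subsetP uW.1 w wW.
  apply: (uniform_contract o0 uW wW).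
    apply: IHn => //; first exact: leq_trans WA cA.
    by exists lt0; exact: orientation_sub uW.1 o0.
  apply: IHn.
  - apply: leq_trans cA; rewrite cardsU1 !inE wW /= cardsD (setIidPr uW.1).
    by have := subset_leq_card uW.1; lia.
  - move=> p q p' q' /existsP[p1 /andP[p1p /existsP[q1 /andP[q1q F1]]]].
    move=> /existsP[p2 /andP[p2p /existsP[q2 /andP[q2q F2]]]].
    case/orP: (fF _ _ _ _ F1 F2) => FF; apply/orP; [left|right].
      by apply/existsP; exists p1; rewrite p1p; apply/existsP; exists q2; rewrite q2q.
    by apply/existsP; exists p2; rewrite p2p; apply/existsP; exists q1; rewrite q1q.
  exists lt0; apply: orientation_sub o0; apply/subsetP=> x.
  by rewrite !inE => /orP[/eqP->|/andP[]].
have small W : uniform A W -> 1 < #|W| -> W = A.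
  move=> uW W1; apply/eqP; rewrite eqEcard uW.1 leqNgt; apply/negP=> WA.
  by apply: nuW; exists W.
have coconn a : a \in A -> 1 < #|component A nonadj a| -> component A nonadj a = A.
  by move=> aA; apply: small; exact: cocomp_uniform.
have [prime|np] := pselect (forall W, W \subset A -> autonomous A lt0 W -> 1 < #|W| -> W = A).
  exact: prime_extends o0 prime coconn.
pose good W := [/\ W \subset A, autonomous A lt0 W, 1 < #|W| & W != A].
have [W0 gW0] : exists W, good W.
  apply: contrapT => h; apply: np => W WA aW W1; apply/eqP/negPn/negP => WnA.
  by apply: h; exists W.
have [W gW Wmax] : exists2 W, good W & forall W', good W' -> #|W'| <= #|W|.
  case: (@arg_maxnP _ W0 (fun W => `[< good W >]) (fun W => #|W|)) => [|W /asboolP gW Wmax].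
    exact/asboolP.
  by exists W => // W' gW'; apply: Wmax; exact/asboolP.
have [WA aW W1 WnA] := gW.
have maxW W' : W' \subset A -> autonomous A lt0 W' -> #|W| < #|W'| -> W' = A.
  move=> W'A aW' ltW; apply/eqP/negPn/negP => W'nA.
  by have := Wmax W' (And4 W'A aW' (ltn_trans W1 ltW) W'nA); rewrite leqNgt ltW.
have nuni : ~ uniform A W by move=> /small/(_ W1) WeA; rewrite WeA eqxx in WnA.
have iso := isolated_of_not_uniform o0 WA aW maxW nuni.
apply: edgeless_extends => // a b aA bA; apply/negP=> ab.
have K1 : 1 < #|component A (@adj G) a|.
  apply/card_gt1P; exists a, b.
  by rewrite component_self // (component_step (component_self _ aA) bA ab) adj_neq.
have KA := small _ (component_uniform aA) K1.
have stay : forall u, u \in A -> (u \in W) = (a \in W).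
  move=> u uA; have uK : u \in component A (@adj G) a by rewrite KA.
  apply: (@component_ind A (@adj G) a (fun u => (u \in W) = (a \in W)) _ _ u aA uK) => //.
  move=> c d /(subsetP (component_sub _ _ _)) cA' /(subsetP (component_sub _ _ _)) dA cd <-.
  apply/idP/idP => [dW|cW]; apply: contraT => nW.
    by have := iso c d cA' nW dW; rewrite cd.
  by have := iso d c dA nW cW; rewrite adj_sym cd.
have [w wW] : exists w, w \in W by apply/card_gt0P; exact: ltnW.
have aW' : a \in W by rewrite -(stay w (subsetP WA w wW)).
case/negP: WnA; rewrite eqEsubset WA; apply/subsetP=> u uA; by rewrite stay.
Qed.

End Extension.

(** * Tied pairs *)

Section Tied.
Variable G : sgraph.
Local Notation ori := (orientation [set: G]).

Definition tied (x y x' y' : G) := forall lt, ori lt -> lt x y = lt x' y'.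

Lemma tied_sym x y x' y' : tied x y x' y' -> tied x' y' x y.
Proof. by move=> h lt o; rewrite (h lt o). Qed.

Lemma tied_trans x y x1 y1 x2 y2 : tied x y x1 y1 -> tied x1 y1 x2 y2 -> tied x y x2 y2.
Proof. by move=> h h' lt o; rewrite (h lt o) (h' lt o). Qed.

Lemma tied_rev x y x' y' : tied x y x' y' -> tied y x y' x'.
Proof. by move=> h lt o; apply: (h (fun a b => lt b a)); exact: orientation_rev. Qed.

Lemma tied_adj x x' y : x -- x' -> nonadj x y -> nonadj x' y -> tied x y x' y.
Proof.
move=> xx' /andP[xy nxy] /andP[x'y nx'y] lt o.
by have [||||-> _] := nonadj_side o (in_setT x) (in_setT x') (in_setT y) xx';
  rewrite 1?eq_sym 1?adj_sym.
Qed.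

Lemma untied x y x' y' : ~ tied x y x' y' -> exists2 lt, ori lt & lt x y != lt x' y'.
Proof.
move=> nt; apply: contrapT => h; apply: nt => lt o; apply/eqP/negPn/negP => ne.
by apply: h; exists lt.
Qed.

Lemma nat_model lt : ori lt -> exists L H : G -> nat,
  [/\ forall x, L x <= H x, forall x y, lt x y = (H x < L y),
      forall x y, x -- y -> L x <= H y /\ L y <= H x,
      forall x y, nonadj x y -> H x < L y \/ H y < L x
    & forall x y, x != y -> L x <= H y -> L y <= H x -> x -- y].
Proof.
move=> o; have [L [H [LH ltE adjE]]] := orientation_nat o.
exists L, H; split.
- by move=> x; apply: LH.
- by move=> x y; apply: ltE.
- by move=> x y xy; apply/andP; rewrite -adjE ?inE // adj_neq.
- by move=> x y /andP[xy]; rewrite adjE ?inE // negb_and -!ltnNge => /orP[]; tauto.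
- by move=> x y xy h1 h2; rewrite adjE ?inE // h1.
Qed.

Lemma tied_cases lt (L H : G -> nat) x y x' y' : ori lt ->
  (forall x y, lt x y = (H x < L y)) ->
  (forall x y, nonadj x y -> H x < L y \/ H y < L x) ->
  tied x y x' y' -> nonadj x y -> nonadj x' y' ->
  (H x < L y /\ H x' < L y') \/ (H y < L x /\ H y' < L x').
Proof.
move=> o ltE nadjN t n n'; have := t _ o; have := tied_rev t o; rewrite !ltE => e1 e2.
by case: (nadjN _ _ n) => h; [left; rewrite -e2 h|right; rewrite -e1 h].
Qed.

Lemma nonadj_neg lt x y : ori lt -> nonadj x y -> lt y x = ~~ lt x y.
Proof. by move=> o; apply: orientation_neg o _ _; rewrite inE. Qed.

(** Flipping [W] reverses the pair [b c], so it must reverse the tied pair too. *)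
Lemma tied_flip lt b c b' c' W : ori lt -> autonomous [set: G] lt W ->
  tied b c b' c' -> nonadj b c -> b \in W -> c \in W -> (b' \in W) && (c' \in W).
Proof.
move=> o aW t nbc bW cW; apply: contraT => nW.
have := t _ (orientation_flip o aW); rewrite /flip bW cW (negbTE nW) /=.
by rewrite -(t _ o) (nonadj_neg o nbc); case: (lt b c).
Qed.

(** The chain [a], [b], [c] gives an H_k or an autonomous set; the H_k would keep [c] from ever
    lying between [a] and [b], as it does in [lt2]. *)
Lemma between_separates lt1 lt2 a b c : ori lt1 -> ori lt2 ->
  between_in lt1 a b c -> between_in lt2 a c b ->
  exists lt W, [/\ ori lt, autonomous [set: G] lt W, b \in W, c \in W & a \notin W /\ lt a b].
Proof.
move=> o1 o2 h1 h2.
have half lt : ori lt -> lt a b -> lt b c ->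
    exists lt W, [/\ ori lt, autonomous [set: G] lt W, b \in W, c \in W & a \notin W /\ lt a b].
  move=> o ab bc.
  case: (Hgraph_fat o (in_setT a) (in_setT b) (in_setT c) ab bc) => [[k [B [_ hB]]]|[W [_ cW bW aW aut]]].
    have /andP[/negbTE n1 /negbTE n2] := Hgraph_never_between hB (orientation_sub (subsetT B) o2).
    by move: h2; rewrite /between_in n1 n2.
  by exists lt, W.
case/orP: h1 => /andP[h h']; first exact: half o1 h h'.
exact: half (orientation_rev o1) h' h.
Qed.

(** By [tied_flip] the autonomous set of [between_separates] would contain the pair tied to [b c],
    and thus [a]. *)
Lemma tied_not_both lt1 lt2 a b c b' c' : ori lt1 -> ori lt2 -> tied b c b' c' ->
  nonadj b c -> a = b' \/ a = c' -> between_in lt1 a b c -> between_in lt2 a c b -> False.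
Proof.
move=> o1 o2 t nbc e h1 h2.
have [lt [W [o aut bW cW [aW _]]]] := between_separates o1 o2 h1 h2.
have /andP[b'W c'W] := tied_flip o aut t nbc bW cW.
by case: e => e; rewrite e ?b'W ?c'W in aW.
Qed.

(** Meeting [a], the vertex [w] is outside the autonomous set around [b] and [c]; as it is not
    comparable with [b], it is not comparable with [c]. *)
Lemma between_adj lt1 lt2 a b c w : ori lt1 -> ori lt2 ->
  between_in lt1 a b c -> between_in lt2 a c b -> w -- a -> w -- b -> w != c -> w -- c.
Proof.
move=> o1 o2 h1 h2 wa wb wc.
have [lt [W [o aut bW cW [aW ab]]]] := between_separates o1 o2 h1 h2.
have [L [H [LH ltE adjN _ adjP]]] := nat_model o.
have wW : w \notin W.
  apply/negP=> wW; have [e _] := aut a w b (in_setT a) aW wW bW.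
  have wa' : H a < L w by rewrite -ltE e.
  by have [? _] := adjN _ _ wa; nlia.
have [e1 e2] := aut w b c (in_setT w) wW bW cW.
have [h3 h4] := adjN _ _ wb.
apply: adjP => //; rewrite leqNgt; rewrite !ltE in e1 e2.
  by rewrite -e2 -leqNgt.
by rewrite -e1 -leqNgt.
Qed.

Lemma Hgraph_of_adj (x y z : G) : x -- z -> nonadj x y -> nonadj z y -> exists A : {set G}, Hgraph 1 A x y z.
Proof.
move=> xz /andP[xy nxy] /andP[zy nzy]; exists (y |: [set a in [:: x; z]]).
apply: (@Hgraph_1 _ x y [:: z]) => //.
- by apply: induced_path_cons => //; [rewrite inE adj_neq|exact: induced_path_nil].
- by rewrite !inE negb_or ![y == _]eq_sym xy zy.
by move=> a; rewrite !inE => /orP[]/eqP->; rewrite adj_sym.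
Qed.

(** The alternative to an H_k is an autonomous set containing [y] and [z] but not [x]; flipping it
    would reverse [z y] alone and untie the pairs. *)
Lemma Hgraph_of_order lt (x y z : G) : ori lt -> tied x y z y -> between_in lt x z y ->
  exists k (A : {set G}), Hgraph k A x y z.
Proof.
have half lt1 : ori lt1 -> tied x y z y -> lt1 x z -> lt1 z y -> exists k (A : {set G}), Hgraph k A x y z.
  move=> o t xz zy.
  case: (Hgraph_fat o (in_setT x) (in_setT z) (in_setT y) xz zy) => [[k [B [_ hB]]]|[W [_ yW zW xW aut]]].
    by exists k, B.
  have nzy := orientation_nonadj o (in_setT z) (in_setT y) zy.
  have := tied_flip o aut (tied_sym t) nzy zW yW; by rewrite (negbTE xW).
move=> o t /orP[/andP[h h']|/andP[h h']]; first exact: half o t h h'.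
exact: half (orientation_rev o) t h' h.
Qed.

Variables (lt0 : rel G) (o0 : ori lt0).

(** The tie keeps [y] from lying between [x] and [z]; if these are not adjacent, the one nearer to
    [y] becomes z_k. *)
Lemma Hgraph_of_tied x y z : tied x y z y -> nonadj x y -> nonadj z y -> x != z ->
  (exists k (A : {set G}), Hgraph k A x y z) \/ (exists k (A : {set G}), Hgraph k A z y x).
Proof.
move=> t nxy nzy xz; have [L [H [LH ltE _ nadjN _]]] := nat_model o0.
have [axz|naxz] := boolP (x -- z).
  by left; have [A hA] := Hgraph_of_adj axz nxy nzy; exists 1, A.
have nxz : nonadj x z by rewrite /nonadj xz.
have [b|b] : between_in lt0 x z y \/ between_in lt0 z x y.
  rewrite /between_in !ltE; have ? := LH x; have ? := LH y; have ? := LH z.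
  case: (tied_cases o0 ltE nadjN t nxy nzy) => -[? ?]; case: (nadjN _ _ nxz) => ?;
    first [by left; nlia | by right; nlia].
  by left; exact: Hgraph_of_order o0 t b.
by right; exact: Hgraph_of_order o0 (tied_sym t) b.
Qed.

(** Since [u] meets [y] and [z] but misses [x], the middle vertex cannot be [x]; this selects the
    first case of [Hgraph_of_tied]. *)
Lemma Hgraph_of_cover x y z u : tied x y z y -> nonadj x y -> nonadj z y ->
  u -- y -> u -- z -> u != x -> ~~ (u -- x) -> exists k (A : {set G}), Hgraph k A x y z.
Proof.
move=> t nxy nzy uy uz ux nux; have [L [H [LH ltE adjN nadjN _]]] := nat_model o0.
have xz : x != z by apply: contraNneq nux => ->.
have [axz|naxz] := boolP (x -- z).
  by have [A hA] := Hgraph_of_adj axz nxy nzy; exists 1, A.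
have nxz : nonadj x z by rewrite /nonadj xz.
apply: (Hgraph_of_order o0 t).
rewrite /between_in !ltE; have ? := LH x; have ? := LH y; have ? := LH z.
have [? ?] := adjN _ _ uy; have [? ?] := adjN _ _ uz; have ? := LH u.
have nu : nonadj u x by apply/andP.
by case: (tied_cases o0 ltE nadjN t nxy nzy) => -[? ?]; case: (nadjN _ _ nxz) => ?;
  case: (nadjN _ _ nu) => ?; nlia.
Qed.

End Tied.

Import Order.TTheory GRing.Theory Num.Theory.
Local Open Scope ring_scope.

(** * Extensions as orientations *)

Lemma repr_adj (R : realType) (G : sgraph) (A : {set G}) (l r : G -> R) x y :
  is_repr A l r -> x \in A -> y \in A -> x != y ->
  x -- y = (l x <= r y) && (l y <= r x).
Proof.
move=> [lr lrP] xA yA xy; have := lr x xA; have := lr y yA => ly lx.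
apply/idP/andP => [/(lrP x y xA yA xy)[p []]|[h1 h2]].
  by rewrite !in_itv /= => /andP[? ?] /andP[? ?]; split; lra.
apply/(lrP x y xA yA xy); case: (leP (l x) (l y)) => h.
  by exists (l y); rewrite !in_itv /= lexx h h2 ly.
by exists (l x); rewrite !in_itv /= lexx lx h1 ltW.
Qed.

Lemma repr_intro (R : realType) (G : sgraph) (A : {set G}) (l r : G -> R) :
  (forall x, x \in A -> l x <= r x) ->
  (forall x y, x \in A -> y \in A -> x != y -> x -- y = (l x <= r y) && (l y <= r x)) ->
  is_repr A l r.
Proof.
move=> lr adjE; split=> // x y xA yA xy; rewrite adjE //.
have := lr x xA; have := lr y yA => ly lx.
split=> [[p []]|/andP[h1 h2]].
  by rewrite !in_itv /= => /andP[? ?] /andP[? ?]; apply/andP; split; lra.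
case: (leP (l x) (l y)) => h.
  by exists (l y); rewrite !in_itv /= lexx h h2 ly.
by exists (l x); rewrite !in_itv /= lexx lx h1 ltW.
Qed.

Lemma orientation_of_repr (R : realType) (G : sgraph) (A : {set G}) (l r : G -> R) :
  is_repr A l r -> orientation A (fun x y => r x < l y).
Proof.
move=> h; have [lr _] := h; split=> [x y xA yA|a b c d aA bA cA dA ab cd].
  have [->|xy] := eqVneq x y.
    by rewrite orbb; apply/negbTE; rewrite -leNgt lr.
  by rewrite (repr_adj h) //= negb_and -!ltNge orbC.
by case: (leP (l d) (r a)) => //= da; apply: lt_le_trans cd _; apply: le_trans da (ltW ab).
Qed.

Lemma gap_exists (R : realType) (s : seq R) :
  exists2 d, 0 < d & {in s &, forall a b, a < b -> a + d <= b}.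
Proof.
have [d d0 hd] : exists2 d : R, 0 < d &
    forall p, p \in [seq (a, b) | a <- s, b <- s] -> p.1 < p.2 -> p.1 + d <= p.2.
  elim: [seq (a, b) | a <- s, b <- s] => [|p t [d d0 hd]]; first by exists 1.
  have [lt12|le21] := ltP p.1 p.2.
    exists (Num.min d (p.2 - p.1)) => [|q].
      by rewrite lt_min d0 subr_gt0.
    rewrite in_cons => /orP[/eqP-> _|/hd h /h].
      have : Num.min d (p.2 - p.1) <= p.2 - p.1 by rewrite ge_min lexx orbT.
      by move: (Num.min _ _) => m; lra.
    have : Num.min d (p.2 - p.1) <= d by rewrite ge_min lexx.
    by move: (Num.min _ _) => m; lra.
  exists d => // q; rewrite in_cons => /orP[/eqP->|/hd//].
  by rewrite ltNge le21.
exists d => // a b aS bS; apply: (hd (a, b)); exact: allpairs_f.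
Qed.

Section Forced.
Variables (R : realType) (G : sgraph) (S : partial_repr R G).
Local Notation D := (predrawn S).
Local Notation l := (lft S).
Local Notation r := (rgt S).

(* In every extension, l x <= a whenever [left_bound x a], and b <= r x whenever
   [right_bound x b]. *)
Definition left_bound (x : G) (a : R) :=
  (x \in D /\ a = l x) \/ exists2 v, (v \in D) && (v -- x) & a = r v.

Definition right_bound (x : G) (b : R) :=
  (x \in D /\ b = r x) \/ exists2 u, (u \in D) && (u -- x) & b = l u.

(** Then [l x <= r y] in every extension, so a non-adjacent [x] has to lie left of [y]. *)
Definition forced : rel G :=
  fun x y => `[< exists a b, [/\ left_bound x a, right_bound y b & a <= b] >].

Lemma forcedI x y a b : left_bound x a -> right_bound y b -> a <= b -> forced x y.
Proof. by move=> xa yb ab; apply/asboolP; exists a, b. Qed.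

(** The smaller of the two left bounds is below both right bounds. *)
Lemma ferrers_forced : ferrers forced.
Proof.
move=> p q p' q' /asboolP[a [b [pa qb ab]]] /asboolP[a' [b' [pa' qb' ab']]].
case: (leP a a') => h; apply/orP; [left|right].
  by apply: forcedI pa qb' _; exact: le_trans h ab'.
by apply: forcedI pa' qb _; exact: le_trans (ltW h) ab.
Qed.

Lemma extendible_orientation : extendible S ->
  exists lt, orientation [set: G] lt /\ satisfies [set: G] forced lt.
Proof.
move=> [l' [r' [rep ext]]]; exists (fun x y => r' x < l' y).
have o := orientation_of_repr rep; split=> // p q pA qA npq.
have lr x : l' x <= r' x by case: rep => + _; apply; rewrite inE.
have adjb u x : u -- x -> (l' u <= r' x) && (l' x <= r' u).
  by move=> ux; rewrite -(repr_adj rep) ?inE // adj_neq.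
case/asboolP=> a [b [pa qb ab]]; apply: contraT => nlt.
have : r' q < l' p.
  by have := orientation_neg o pA qA npq; rewrite (negbTE nlt).
have : l' p <= a.
  case: pa => [[pD ->]|[v /andP[vD vp] ->]]; first by rewrite (ext _ pD).1.
  by rewrite -(ext _ vD).2; case/andP: (adjb _ _ vp).
have : b <= r' q.
  case: qb => [[qD ->]|[u /andP[uD uq] ->]]; first by rewrite (ext _ qD).2.
  by rewrite -(ext _ uD).1; case/andP: (adjb _ _ uq).
lra.
Qed.

(** Free endpoints get the least values compatible with the drawn ones, slightly perturbed. A lower
    bound reaching a drawn endpoint that it has to stay below would exhibit a forced pair against
    [lt]. *)
Lemma orientation_extendible lt : orientation [set: G] lt ->
  satisfies [set: G] forced lt -> extendible S.
Proof.
move=> o sat; have [L [H [LH ltE adjE]]] := orientation_nat o.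
have inT (x : G) : x \in [set: G] by rewrite inE.
have satT p q : nonadj p q -> forced p q -> lt p q by apply: sat; rewrite inE.
have lrD x : x \in D -> l x <= r x by case: (partial_reprP S) => + _; apply.
have adjD x y : x \in D -> y \in D -> x != y -> x -- y = (l x <= r y) && (l y <= r x).
  by move=> *; apply: (repr_adj (partial_reprP S)).
pose K0 := [seq l u | u <- enum D] ++ [seq r u | u <- enum D].
have lK u : u \in D -> l u \in K0 by move=> uD; rewrite mem_cat map_f // mem_enum.
have rK u : u \in D -> r u \in K0 by move=> uD; rewrite mem_cat (map_f r) ?orbT // mem_enum.
(* [b] lies below all drawn endpoints and is the default value of the maxima; [d] bounds from below
   the distance of distinct values among [b] and the drawn endpoints. *)
have [b bK] : exists b, {in K0, forall c, b < c}.
  elim: K0 {lK rK} => [|c s [b hb]]; first by exists 0.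
  exists (Num.min b (c - 1)) => c'; rewrite in_cons => /orP[/eqP->|/hb h].
    have : Num.min b (c - 1) <= c - 1 by rewrite ge_min lexx orbT.
    by move: (Num.min _ _) => m; lra.
  by apply: le_lt_trans h; rewrite ge_min lexx.
have [d d0 dgap] := gap_exists (b :: K0).
have gap a c : a \in K0 -> c \in K0 -> a < c -> a <= c - d.
  by move=> aK cK ac; have := dgap a c; rewrite !in_cons aK cK !orbT => /(_ isT isT ac); lra.
have gapb c : c \in K0 -> b <= c - d.
  move=> cK; have := dgap b c; rewrite !in_cons cK eqxx orbT => /(_ isT isT (bK c cK)); lra.
pose touch (x y : G) := (x == y) || (x -- y).
have touchC x y : touch x y = touch y x by rewrite /touch eq_sym adj_sym.
have touchE x y : touch x y = (L x <= H y)%N && (L y <= H x)%N.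
  rewrite /touch; have [->|xy] := eqVneq x y; first by rewrite LH.
  by rewrite adjE.
have nonadjE x y : nonadj x y = ~~ touch x y by rewrite /nonadj negb_or.
(* Lower bounds imposed by drawn intervals. A left endpoint lies beyond [r u] for drawn [u] before
   it, and beyond [l u] if a vertex before it touches [u]. A right endpoint is at least the left
   endpoint of each vertex touched. *)
pose LBl x := Num.max (\big[Num.max/b]_(u in D | lt u x) r u)
  (\big[Num.max/b]_(u in D | [exists y, touch y u && lt y x]) l u).
pose LBr x := Num.max (\big[Num.max/b]_(y | touch y x) LBl y)
  (\big[Num.max/b]_(u in D | touch u x) l u).
have LBl_le x m : b <= m -> (forall u, u \in D -> lt u x -> r u <= m) ->
    (forall u y, u \in D -> touch y u -> lt y x -> l u <= m) -> LBl x <= m.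
  move=> bm h1 h2; rewrite ge_max; apply/andP; split; apply: bigmax_le => // u /andP[uD].
    exact: h1.
  by case/existsP=> y /andP[]; exact: h2.
have LBr_le x m : b <= m -> (forall y, touch y x -> LBl y <= m) ->
    (forall u, u \in D -> touch u x -> l u <= m) -> LBr x <= m.
  move=> bm h1 h2; rewrite ge_max; apply/andP; split; apply: bigmax_le => //.
  by move=> u /andP[uD]; exact: h2.
have b_LBl x : b <= LBl x by rewrite le_max bigmax_ge_id.
have rLBl u x : u \in D -> lt u x -> r u <= LBl x.
  by move=> uD ux; rewrite le_max; apply/orP; left; apply: le_bigmax_cond; rewrite uD.
have lLBl u y x : u \in D -> touch y u -> lt y x -> l u <= LBl x.
  move=> uD yu yx; rewrite le_max; apply/orP; right; apply: le_bigmax_cond.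
  by rewrite uD; apply/existsP; exists y; rewrite yu.
have LBlr x y : touch x y -> LBl x <= LBr y.
  by move=> xy; rewrite le_max; apply/orP; left; apply: le_bigmax_cond.
have lLBr u x : u \in D -> touch u x -> l u <= LBr x.
  by move=> uD ux; rewrite le_max; apply/orP; right; apply: le_bigmax_cond; rewrite uD.
have LBrl x z : lt x z -> LBr x <= LBl z.
  move=> xz; apply: LBr_le => // [y yx|u uD ux]; last by apply: (lLBl u x z uD _ xz); rewrite touchC.
  have tr w : lt w y -> lt w z.
    move: xz yx; rewrite touchE !ltE // => ? /andP[? ?] ?.
    by have := LH w (inT w); have := LH y (inT y); lia.
  apply: LBl_le => // [u uD uy|u w uD wu wy]; first by apply: rLBl => //; exact: tr.
  by apply: lLBl wu _ => //; exact: tr.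
(* The multipliers [(L x).+1] and [(H x).+1] are positive and below [N], so no perturbation reaches
   [d]. *)
pose N := (\max_x H x).+2; pose e := d / N%:R.
have N0 : 0 < N%:R :> R by rewrite ltr0n.
have e0 : 0 < e by rewrite divr_gt0.
have eN k : (k < N)%N -> e * k%:R < d.
  by move=> kN; rewrite /e mulrAC ltr_pdivrMr // ltr_pM2l // ltr_nat.
have HN x : ((H x).+1 < N)%N by rewrite /N !ltnS; exact: leq_bigmax.
have LN x : ((L x).+1 < N)%N by apply: leq_ltn_trans (HN x); rewrite ltnS LH.
(* Adding the small multiple of the rank makes the strict inequalities strict
   without overtaking the next pre-drawn endpoint. *)
pose l' x := if x \in D then l x else LBl x + e * (L x).+1%:R.
pose r' x := if x \in D then r x else LBr x + e * (H x).+1%:R.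
have epos k : 0 < e * k.+1%:R by rewrite mulr_gt0.
have lr_touch x y : touch x y -> l' x <= r' y.
  move=> xy; rewrite /l' /r'; have [xD|xD] := boolP (x \in D); have [yD|yD] := boolP (y \in D).
  - move: xy; rewrite /touch; have [-> _|nxy /= xy] := eqVneq x y; first exact: lrD.
    by move: xy; rewrite adjD // => /andP[].
  - by have := lLBr x y xD xy; have := epos (H y); lra.
  - have xy' : x -- y.
      by case/orP: xy => // /eqP xy; rewrite xy yD in xD.
    (* A contribution at or beyond [r y] would, with [r y] as a left bound of [x], force [x] before
       a vertex that precedes it. *)
    suff : LBl x <= r y - d by have := eN _ (LN x); lra.
    apply: LBl_le => [|u uD ux|u w uD wu wx].
    + exact: gapb (rK _ yD).
    + apply: gap; rewrite ?rK // ltNge; apply/negP=> yu.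
      have nxu : nonadj x u by rewrite nonadjC; exact: orientation_nonadj o _ _ ux.
      have : lt x u.
        apply: satT => //; apply: forcedI yu; last by left.
        by right; exists y; rewrite // yD adj_sym.
      by rewrite (orientation_asym o _ _ ux).
    + apply: gap; rewrite ?rK ?lK // ltNge; apply/negP=> yu.
      have nxw : nonadj x w by rewrite nonadjC; exact: orientation_nonadj o _ _ wx.
      have : forced x w.
        have xb : left_bound x (r y) by right; exists y; rewrite // yD adj_sym.
        case/orP: wu => [/eqP->|wu].
          by apply: (forcedI xb (b := r u)); [left|exact: le_trans yu (lrD _ uD)].
        by apply: (forcedI xb (b := l u)) => //; right; exists u; rewrite // uD adj_sym.
      by move/(satT _ _ nxw); rewrite (orientation_asym o _ _ wx).
  - have := LBlr x y xy; have Lxy : (L x <= H y)%N by move: xy; rewrite touchE => /andP[].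
    have : e * (L x).+1%:R <= e * (H y).+1%:R by rewrite ler_pM2l // ler_nat ltnS.
    lra.
have lt_lt x y : lt x y -> r' x < l' y.
  move=> xy; have nxy := orientation_nonadj o (inT x) (inT y) xy.
  have nyx := orientation_asym o (inT x) (inT y) xy.
  rewrite /l' /r'; have [xD|xD] := boolP (x \in D); have [yD|yD] := boolP (y \in D).
  - case/andP: (nxy) => ne; rewrite adjD // negb_and -!ltNge => /orP[yx|//].
    have : lt y x.
      apply: satT; first by rewrite nonadjC.
      apply: (@forcedI _ _ (l y) (r x)); [by left|by left|].
      by have := lrD _ xD; have := lrD _ yD; lra.
    by rewrite nyx.
  - by have := rLBl x y xD xy; have := epos (L y); lra.
  - suff : LBr x <= l y - d by have := eN _ (HN x); lra.
    have nlty u : lt u y -> lt y u -> False by move=> /(orientation_asym o (inT _) (inT _))->.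
    have tr z u : touch z x -> lt u z -> lt u y.
      move: xy; rewrite touchE !ltE // => ? /andP[? ?] ?.
      by have := LH z (inT z); have := LH x (inT x); lia.
    have yb : left_bound y (l y) by left.
    apply: LBr_le => [|z zx|u uD ux]; first exact: gapb (lK _ yD).
      apply: LBl_le => [|u uD uz|u w uD wu wz]; first exact: gapb (lK _ yD).
        have uy := tr _ _ zx uz; apply: gap; rewrite ?rK ?lK // ltNge; apply/negP=> yu.
        apply: (nlty u uy); apply: satT; first by rewrite nonadjC; exact: orientation_nonadj o _ _ uy.
        by apply: (forcedI yb) yu; left.
      have wy := tr _ _ zx wz; apply: gap; rewrite ?lK // ltNge; apply/negP=> yu.
      apply: (nlty w wy); apply: satT; first by rewrite nonadjC; exact: orientation_nonadj o _ _ wy.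
      case/orP: wu => [/eqP->|wu].
        by apply: (forcedI yb (b := r u)); [left|exact: le_trans yu (lrD _ uD)].
      by apply: (forcedI yb (b := l u)) => //; right; exists u; rewrite // uD adj_sym.
    apply: gap; rewrite ?lK // ltNge; apply/negP=> yu.
    apply: (nlty x xy); apply: satT; first by rewrite nonadjC.
    case/orP: ux => [/eqP<-|ux].
      by apply: (forcedI yb (b := r u)); [left|exact: le_trans yu (lrD _ uD)].
    by apply: (forcedI yb (b := l u)) => //; right; exists u; rewrite // uD.
  - have := LBrl x y xy; have : (H x < L y)%N by rewrite -ltE.
    move=> h ?; have : e * (H x).+1%:R < e * (L y).+1%:R by rewrite ltr_pM2l // ltr_nat.
    lra.
exists l', r'; split; last by move=> x xD; rewrite /l' /r' xD.
apply: repr_intro => [x _|x y _ _ xy]; first by apply: lr_touch; rewrite /touch eqxx.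
have [axy|nxy] := boolP (x -- y).
  by rewrite !lr_touch // /touch ?[y -- x]adj_sym axy orbT.
have := oriE o (inT x) (inT y); rewrite xy nxy /= => /orP[]/lt_lt h.
  by rewrite [l' y <= _]leNgt h andbF.
by rewrite leNgt h.
Qed.

End Forced.

(** * Containment of obstructions *)

Lemma reflectionK (R : realType) (G : sgraph) (S : partial_repr R G) :
  reflection (reflection S) = S.
Proof.
case: S => D l r P; rewrite /reflection /=.
have e (f : G -> R) : (fun x => - - f x) = f by apply/funext => x; rewrite opprK.
move: (is_repr_opp _); rewrite !e => Q; congr PartialRepr; exact: Prop_irrelevance.
Qed.

Lemma extendible_reflection (R : realType) (G : sgraph) (S : partial_repr R G) :
  extendible S -> extendible (reflection S).
Proof.
move=> [l [r [rep ext]]]; exists (fun x => - r x), (fun x => - l x).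
by split=> [|x /ext[-> ->]]; first exact: is_repr_opp.
Qed.

Lemma contained_reflection (R : realType) (G H : sgraph) (S : partial_repr R G)
  (SH : partial_repr R H) : contained SH S -> contained (reflection SH) (reflection S).
Proof.
case=> f [finj fadj fD fle]; exists f; split=> // x y s t xD yD.
have := fle y x (~~ t) (~~ s) yD xD; rewrite /endpoint.
by case: s t => [] [] /=; rewrite !lerN2.
Qed.

Lemma contains_reflection (R : realType) (G : sgraph) (S : partial_repr R G) C :
  contains (reflection S) C -> contains S C.
Proof.
case=> H [SH [ne cl /contained_reflection]]; rewrite reflectionK => co.
exists H, (reflection SH); split=> //; last by rewrite reflectionK; tauto.
by move/extendible_reflection; rewrite reflectionK.
Qed.

(** The coordinates of the two representations may differ, so an extension is not restricted
    directly: its orientation is pulled back along [f], and forced pairs, which depend only on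
    comparisons of endpoints, are carried forward. *)
Lemma contained_extendible (R : realType) (G H : sgraph) (S : partial_repr R G)
  (SH : partial_repr R H) : contained SH S -> extendible S -> extendible SH.
Proof.
case=> f [finj fadj fD fle] /extendible_orientation[lt [o sat]].
apply: (@orientation_extendible _ _ _ (fun x y => lt (f x) (f y))).
  split=> [x y _ _|a b c d _ _ _ _]; last by apply: (oriI o); rewrite inE.
  by rewrite (oriE o) ?inE // fadj (inj_eq finj).
move=> p q _ _ npq /asboolP[a [b [pa qb ab]]].
apply: sat; rewrite ?inE //; first by rewrite /nonadj (inj_eq finj) fadj.
have [s [v [vD ea la]]] : exists s v, [/\ v \in predrawn SH, a = endpoint SH s v &
    left_bound S (f p) (endpoint S s (f v))].
  case: pa => [[pD ->]|[v /andP[vD vp] ->]].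
    by exists false, p; split=> //; left; rewrite fD.
  by exists true, v; split=> //; right; exists (f v); rewrite // fD // fadj.
have [t [u [uD eb rb]]] : exists t u, [/\ u \in predrawn SH, b = endpoint SH t u &
    right_bound S (f q) (endpoint S t (f u))].
  case: qb => [[qD ->]|[u /andP[uD uq] ->]].
    by exists true, q; split=> //; left; rewrite fD.
  by exists false, u; split=> //; right; exists (f u); rewrite // fD // fadj.
by apply: forcedI la rb _; rewrite fle // -ea -eb.
Qed.

Lemma is_repr_sub (R : realType) (G : sgraph) (A B : {set G}) (l r : G -> R) :
  B \subset A -> is_repr A l r -> is_repr B l r.
Proof.
by move=> /subsetP BA [h1 h2]; split=> [x /BA/h1//|x y /BA xA /BA yA]; exact: h2.
Qed.

Section Induced.
Variables (R : realType) (G : sgraph).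

Definition induced (B : {set G}) : sgraph :=
  @SGraph {x : G | x \in B} (fun x y => val x -- val y)
    (fun x y => adj_sym (val x) (val y)) (fun x => adj_irrefl (val x)).

Variable S : partial_repr R G.
Local Notation D := (predrawn S).
Local Notation l := (lft S).
Local Notation r := (rgt S).

Lemma restrict_repr (B E : {set G}) :
  is_repr [set v : induced B | val v \in E :&: D] (fun v => l (val v)) (fun v => r (val v)).
Proof.
have [lr lrP] := partial_reprP S; split=> [x|x y]; rewrite !inE => /andP[_ xD].
  exact: lr.
by move=> /andP[_ yD] xy; apply: lrP => //; rewrite (inj_eq val_inj).
Qed.

(** [E] selects the vertices of the copy that stay drawn, because a vertex that is free in the
    obstruction may be drawn in [S]. *)
Definition restrict (B E : {set G}) : partial_repr R (induced B) :=
  PartialRepr (restrict_repr B E).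

Lemma repr_of_induced (B : {set G}) (l' r' : induced B -> R) :
  is_repr [set: induced B] l' r' -> exists l1 r1 : G -> R,
    is_repr B l1 r1 /\ forall v, l1 (val v) = l' v /\ r1 (val v) = r' v.
Proof.
move=> [lr lrP]; pose ext (f : induced B -> R) (x : G) :=
  if insub x is Some v then f v else 0.
have extE f (v : induced B) : ext f (val v) = f v by rewrite /ext valK.
exists (ext l'), (ext r'); split=> [|v]; last by rewrite !extE.
split=> [x xB|x y xB yB xy].
  by rewrite -[x]/(val (exist _ x xB : induced B)) !extE lr ?inE.
rewrite -[x]/(val (exist _ x xB : induced B)) -[y]/(val (exist _ y yB : induced B)) !extE.
by apply: lrP; rewrite ?inE.
Qed.

(** Non-extendibility is asked for representations of [B] inside [G], which spares the instances any
    reasoning in the subtype. *)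
Lemma contains_restrict (C : obstruction_class R) (B E : {set G}) :
  (forall l' r', is_repr B l' r' ->
    (forall x, x \in B -> x \in E -> x \in D -> l' x = l x /\ r' x = r x) -> False) ->
  C (induced B) (restrict B E) -> contains S C.
Proof.
move=> ne CB; exists (induced B), (restrict B E); split; [|by left|].
  move=> [l' [r' [/repr_of_induced[l1 [r1 [rep e]]] ext]]]; apply: (ne l1 r1) => //.
  move=> x xB xE xD; have := ext (exist _ x xB); rewrite !inE /= xE xD => /(_ isT).
  by rewrite -!(e (exist _ x xB)).1 -!(e (exist _ x xB)).2.
exists val; split=> //; first exact: val_inj.
by move=> x; rewrite !inE => /andP[].
Qed.

Lemma induced_seq (B : {set G}) (p : seq G) : {subset p <= B} ->
  exists p' : seq (induced B), map val p' = p.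
Proof.
elim: p => [|x p IH] sp; first by exists [::].
have [|p' <-] := IH; first by move=> y yp; apply: sp; rewrite in_cons yp orbT.
have xB := sp x (mem_head _ _).
by exists ((exist _ x xB : induced B) :: p').
Qed.

Lemma induced_path_lift (B : {set G}) (x : induced B) p :
  induced_path (val x) (map val p) -> induced_path x p.
Proof.
rewrite /induced_path -map_cons (map_inj_uniq val_inj) => -[u h]; split=> // i j li lj.
have := h i j; rewrite size_map => /(_ li lj) <-.
by rewrite -[nth x _ i -- _]/(val _ -- val _) !(nth_map x).
Qed.

Lemma Hgraph_induced k (A B : {set G}) x y z : Hgraph k A x y z -> A \subset B ->
  forall x' y' z' : induced B, val x' = x -> val y' = y -> val z' = z ->
  Hgraph k [set v : induced B | val v \in A] x' y' z'.
Proof.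
elim=> [{}x {}y p pn ip yp np|{}k {}A {}x {}y {}z w p hA IH pn ip pA ta pa] /subsetP AB x' y' z' ex ey ez.
  have sp : {subset p <= B}.
    by move=> a ap; apply: AB; rewrite !inE ap !orbT.
  have [p' ep] := induced_seq sp; move: ez pn ip yp np; rewrite -ep -ex -ey last_map.
  move=> /val_inj-> pn ip yp np.
  have -> : [set v : induced B | val v \in val y' |: [set a in val x' :: map val p']]
      = y' |: [set a in x' :: p'].
    by apply/setP=> v; rewrite !inE !(inj_eq val_inj) (mem_map val_inj).
  apply: Hgraph_1.
  - by apply: contraNneq pn => ->.
  - exact: induced_path_lift.
  - by move: yp; rewrite -map_cons (mem_map val_inj).
  - by move=> a ap; apply: np; rewrite -map_cons (mem_map val_inj).
have sp : {subset p <= B}.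
  by move=> a ap; apply: AB; rewrite !inE ap !orbT.
have [p' ep] := induced_seq sp; rewrite -ep -ex in pn ip pA ta pa *.
have [xA yA zA] := Hgraph_mem hA.
have [AB1 AB2] : A \subset B /\ x \in B.
  by split; [apply/subsetP=> a aA|]; apply: AB; rewrite in_setU ?aA ?xA.
have hA' := IH AB1 (exist _ x AB2) z' y' erefl ez ey.
have -> : [set v : induced B | val v \in A :|: [set b in val x' :: map val p']]
    = [set v | val v \in A] :|: [set b in x' :: p'].
  by apply/setP=> v; rewrite !inE (inj_eq val_inj) (mem_map val_inj).
have mem b : (b \in x' :: p') = (val b \in val x' :: map val p').
  by rewrite -map_cons (mem_map val_inj).
apply: Hgraph_S hA' _ _ _ _ _.
- by apply: contraNneq pn => ->.
- exact: induced_path_lift.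
- by move=> b; rewrite mem => /pA; rewrite in_set.
- move=> a; rewrite inE => /ta; rewrite last_map => h.
  by rewrite -(inj_eq val_inj); exact: h.
move=> a b; rewrite in_set mem => aA bp bt; apply: pa => //.
by rewrite last_map (inj_eq val_inj).
Qed.

Lemma attached_induced (B : {set G}) (x y z u : induced B) (N : {set G}) :
  attached (val x) (val y) (val z) N (val u) ->
  attached x y z [set v | val v \in N] u.
Proof.
rewrite /attached !inE !(inj_eq val_inj) => -[un h]; split=> // a.
by rewrite !inE => ha; have := h (val a); rewrite !inE !(inj_eq val_inj) => /(_ ha).
Qed.

Lemma induced_elt (B : {set G}) x : x \in B -> exists x' : induced B, val x' = x.
Proof. by move=> xB; exists (exist _ x xB). Qed.

Lemma attached2 x y z (u : G) : u != x -> ~~ (u -- x) -> u -- y -> u -- z ->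
  x != y -> x != z -> attached x y z [set y; z] u.
Proof.
move=> ux nux uy uz xy xz; split.
  by rewrite !inE !negb_or ux !adj_neq.
move=> a; rewrite !inE -orbA => /or3P[]/eqP->.
- by rewrite (negbTE nux) (negbTE xy) (negbTE xz).
- by rewrite uy eqxx.
by rewrite uz eqxx orbT.
Qed.

Lemma attached3 x y z (u : G) : u -- x -> u -- y -> u -- z ->
  attached x y z [set x; y; z] u.
Proof.
move=> ux uy uz; split; first by rewrite !inE !negb_or !adj_neq.
by move=> a; rewrite !inE -orbA => /or3P[]/eqP->; rewrite ?ux ?uy ?uz eqxx ?orbT.
Qed.

Lemma repr_facts (B : {set G}) (l' r' : G -> R) : is_repr B l' r' ->
  [/\ forall a, a \in B -> l' a <= r' a,
      forall a b, a \in B -> b \in B -> a -- b -> l' a <= r' b /\ l' b <= r' a,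
      forall a b, a \in B -> b \in B -> a != b -> ~~ (a -- b) -> r' a < l' b \/ r' b < l' a
    & forall k A x y z, Hgraph k A x y z -> A \subset B ->
        ~ (r' x < l' y /\ r' y < l' z) /\ ~ (r' z < l' y /\ r' y < l' x)].
Proof.
move=> rep; split.
- by case: rep.
- by move=> a b aB bB ab; apply/andP; rewrite -(repr_adj rep) // adj_neq.
- move=> a b aB bB ab; rewrite (repr_adj rep) // negb_and -!ltNge => /orP[]; tauto.
move=> k A x y z hA AB.
have := Hgraph_never_between hA (orientation_of_repr (is_repr_sub AB rep)).
by move=> /andP[/negP h1 /negP h2]; split=> -[a b]; [apply: h1|apply: h2]; rewrite a b.
Qed.

End Induced.

Ltac rlra :=
  repeat match goal with
  | H : is_true (@Order.le _ _ _ _) |- _ => revert H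
  | H : is_true (@Order.lt _ _ _ _) |- _ => revert H
  | H : @eq ?T (?f ?x) (lft _ ?x) |- _ => revert H
  | H : @eq ?T (?f ?x) (rgt _ ?x) |- _ => revert H
  end; clear; intros; lra.

Ltac val_ext e := apply/setP=> v0; rewrite !inE -!val_eqE /= !e.

(** * Copies of the obstruction classes in a partial representation *)

Section Instances.
Variables (R : realType) (G : sgraph) (S : partial_repr R G).
Local Notation D := (predrawn S).
Local Notation l := (lft S).
Local Notation r := (rgt S).

Lemma drawn_le x : x \in D -> l x <= r x.
Proof. by case: (partial_reprP S) => + _; apply. Qed.

Lemma drawn_adj x y : x \in D -> y \in D -> x != y ->
  x -- y = (l x <= r y) && (l y <= r x).
Proof. exact: repr_adj (partial_reprP S). Qed.

Lemma drawn_nadj x y : x \in D -> y \in D -> r x < l y -> (y != x) && ~~ (y -- x).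
Proof.
move=> xD yD xy; have := drawn_le xD; have := drawn_le yD => ly lx.
have ne : y != x by apply: contraTneq xy => ->; rewrite -leNgt.
by rewrite ne drawn_adj // negb_and -!ltNge xy.
Qed.

Lemma attached_lift (B : {set G}) (x y z u : G) (N : {set G})
    (x' y' z' u' : induced B) (N' : {set induced B}) :
  attached x y z N u -> val x' = x -> val y' = y -> val z' = z -> val u' = u ->
  N' = [set v | val v \in N] -> attached x' y' z' N' u'.
Proof.
by move=> h ex ey ez eu ->; rewrite -ex -ey -ez -eu in h; exact: attached_induced.
Qed.

(** The pattern of the instances up to [FNS_in]: an extension would have [x] left of [y] and [y]
    left of [z], against H_k. Here the drawn intervals say so directly. *)
Lemma FAT_in k A x y z : Hgraph k A x y z -> x \in D -> y \in D -> z \in D ->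
  r x < l y -> r y < l z -> contains S (@FAT R k).
Proof.
move=> hA xD yD zD h1 h2.
have [xy xz yz nxy nyz] := Hgraph_indep hA; have [xA yA zA] := Hgraph_mem hA.
set B := A; have AB : A \subset B by exact: subxx.
have sub a : a \in A -> a \in B by apply/subsetP.
have [xB yB zB] := And3 (sub _ xA) (sub _ yA) (sub _ zA).
apply: (@contains_restrict _ _ _ _ B [set x; y; z]).
  move=> l' r' rep ext; have [lr adj nadj nb] := repr_facts rep.
  have [ex1 ex2] := ext x xB ltac:(by rewrite !inE eqxx ?orbT) xD.
  have [ey1 ey2] := ext y yB ltac:(by rewrite !inE eqxx ?orbT) yD.
  have [ez1 ez2] := ext z zB ltac:(by rewrite !inE eqxx ?orbT) zD.
  have [nb1 _] := nb _ _ _ _ _ hA AB; apply: nb1.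
  have [? [? ?]] := (lr x xB, (lr y yB, lr z zB)).
  move=> *; rlra.
have [x' ex] := induced_elt xB; have [y' ey] := induced_elt yB.
have [z' ez] := induced_elt zB.
have e := (ex, ey, ez).
exists x', y', z'; split.
- rewrite (_ : [set: induced B] = [set v : induced B | val v \in A]).
    exact: Hgraph_induced hA AB _ _ _ ex ey ez.
  by apply/setP=> a; rewrite !inE; have := valP a.
- val_ext e.
  by apply: andb_idr; case/orP=> [/orP[]|] /eqP->.
- by rewrite /between /left_of /= !e h1 h2.
Qed.

(** [z] meets [u], which begins inside [y], and misses [y]; so it lies right of [y]. *)
Lemma FS_in k A x y z u : Hgraph k A x y z -> x \in D -> y \in D -> u \in D ->
  u -- y -> u -- z -> l y <= l u -> l u <= r y -> r y < r u -> r x < l y ->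
  contains S (@FS R k).
Proof.
move=> hA xD yD uD uy uz h1 h2 h3 h4.
have [xy xz yz nxy nyz] := Hgraph_indep hA; have [xA yA zA] := Hgraph_mem hA.
have /andP[ux nux] := drawn_nadj xD uD (lt_le_trans h4 h1).
have atu := attached2 ux nux uy uz xy xz.
set B := A :|: [set u]; have AB : A \subset B by exact: subsetUl.
have sub a : a \in A -> a \in B by apply/subsetP.
have [xB yB zB] := And3 (sub _ xA) (sub _ yA) (sub _ zA).
have uB : u \in B by rewrite !inE eqxx ?orbT.
apply: (@contains_restrict _ _ _ _ B [set x; y; u]).
  move=> l' r' rep ext; have [lr adj nadj nb] := repr_facts rep.
  have [ex1 ex2] := ext x xB ltac:(by rewrite !inE eqxx ?orbT) xD.
  have [ey1 ey2] := ext y yB ltac:(by rewrite !inE eqxx ?orbT) yD.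
  have [eu1 eu2] := ext u uB ltac:(by rewrite !inE eqxx ?orbT) uD.
  have [nb1 _] := nb _ _ _ _ _ hA AB; apply: nb1.
  have [? [? ?]] := (lr x xB, (lr y yB, lr z zB)).
  have ? := lr u uB.
  case: (adj u z uB zB uz) => ? ?;
  case: (nadj y z yB zB yz nyz) => ?; rlra.
have [x' ex] := induced_elt xB; have [y' ey] := induced_elt yB.
have [z' ez] := induced_elt zB; have [u' eu] := induced_elt uB.
have e := (ex, ey, ez, eu).
exists [set v : induced B | val v \in A], x', y', z', u'; split.
- exact: Hgraph_induced hA AB _ _ _ ex ey ez.
- split; val_ext e; first by have := valP v0; rewrite !inE.
  by apply: andb_idr; case/orP=> [/orP[]|] /eqP->.
- by apply: (attached_lift atu ex ey ez eu); val_ext e.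
- by rewrite /= !e.
- by rewrite /left_of /= !e.
Qed.

(** [y] meets [u], which begins after [x] and ends inside [z]; so it lies between them. *)
Lemma FB_in k A x y z u : Hgraph k A x y z -> x \in D -> z \in D -> u \in D ->
  u -- y -> u -- z -> l u < l z -> l z <= r u -> r u <= r z -> r x < l u ->
  contains S (@FB R k).
Proof.
move=> hA xD zD uD uy uz h1 h2 h3 h4.
have [xy xz yz nxy nyz] := Hgraph_indep hA; have [xA yA zA] := Hgraph_mem hA.
have /andP[ux nux] := drawn_nadj xD uD h4.
have atu := attached2 ux nux uy uz xy xz.
set B := A :|: [set u]; have AB : A \subset B by exact: subsetUl.
have sub a : a \in A -> a \in B by apply/subsetP.
have [xB yB zB] := And3 (sub _ xA) (sub _ yA) (sub _ zA).
have uB : u \in B by rewrite !inE eqxx ?orbT.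
apply: (@contains_restrict _ _ _ _ B [set x; z; u]).
  move=> l' r' rep ext; have [lr adj nadj nb] := repr_facts rep.
  have [ex1 ex2] := ext x xB ltac:(by rewrite !inE eqxx ?orbT) xD.
  have [ez1 ez2] := ext z zB ltac:(by rewrite !inE eqxx ?orbT) zD.
  have [eu1 eu2] := ext u uB ltac:(by rewrite !inE eqxx ?orbT) uD.
  have [nb1 _] := nb _ _ _ _ _ hA AB; apply: nb1.
  have [? [? ?]] := (lr x xB, (lr y yB, lr z zB)).
  have ? := lr u uB.
  case: (adj u y uB yB uy) => ? ?;
  case: (nadj x y xB yB xy nxy) => ?;
  case: (nadj y z yB zB yz nyz) => ?; rlra.
have [x' ex] := induced_elt xB; have [y' ey] := induced_elt yB.
have [z' ez] := induced_elt zB; have [u' eu] := induced_elt uB.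
have e := (ex, ey, ez, eu).
exists [set v : induced B | val v \in A], x', y', z', u'; split.
- exact: Hgraph_induced hA AB _ _ _ ex ey ez.
- split; val_ext e; first by have := valP v0; rewrite !inE.
  by apply: andb_idr; case/orP=> [/orP[]|] /eqP->.
- by apply: (attached_lift atu ex ey ez eu); val_ext e.
- by rewrite /= !e.
- by rewrite /left_of /= !e.
Qed.

(** [x] meets [u] but not [v], and [u] exceeds [v] only on the left; so [x] lies left of [v], hence
    of [y]. *)
Lemma EFS_in k A x y z u v : Hgraph k A x y z -> y \in D -> z \in D ->
  u \in D -> v \in D -> u -- x -> u -- y -> u -- z -> v != x -> ~~ (v -- x) ->
  v -- y -> v -- z -> l u < l v -> l v < l y -> r y < l z -> r z < r u ->
  r u <= r v -> contains S (@EFS R k).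
Proof.
move=> hA yD zD uD vD ux uy uz vx nvx vy vz h1 h2 h3 h4 h5.
have [xy xz yz nxy nyz] := Hgraph_indep hA; have [xA yA zA] := Hgraph_mem hA.
have atu := attached3 ux uy uz.
have atv := attached2 vx nvx vy vz xy xz.
have ly := drawn_le yD; have lz := drawn_le zD.
set B := A :|: [set u; v]; have AB : A \subset B by exact: subsetUl.
have sub a : a \in A -> a \in B by apply/subsetP.
have [xB yB zB] := And3 (sub _ xA) (sub _ yA) (sub _ zA).
have uB : u \in B by rewrite !inE eqxx ?orbT.
have vB : v \in B by rewrite !inE eqxx ?orbT.
apply: (@contains_restrict _ _ _ _ B [set y; z; u; v]).
  move=> l' r' rep ext; have [lr adj nadj nb] := repr_facts rep.
  have [ey1 ey2] := ext y yB ltac:(by rewrite !inE eqxx ?orbT) yD.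
  have [ez1 ez2] := ext z zB ltac:(by rewrite !inE eqxx ?orbT) zD.
  have [eu1 eu2] := ext u uB ltac:(by rewrite !inE eqxx ?orbT) uD.
  have [ev1 ev2] := ext v vB ltac:(by rewrite !inE eqxx ?orbT) vD.
  have [nb1 _] := nb _ _ _ _ _ hA AB; apply: nb1.
  have [? [? ?]] := (lr x xB, (lr y yB, lr z zB)).
  have ? := lr u uB; have ? := lr v vB.
  case: (adj u x uB xB ux) => ? ?;
  case: (nadj v x vB xB vx nvx) => ?; rlra.
have [x' ex] := induced_elt xB; have [y' ey] := induced_elt yB.
have [z' ez] := induced_elt zB; have [u' eu] := induced_elt uB.
have [v' ev] := induced_elt vB.
have e := (ex, ey, ez, eu, ev).
exists [set v : induced B | val v \in A], x', y', z', u', v'; split.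
- exact: Hgraph_induced hA AB _ _ _ ex ey ez.
- split; val_ext e; first by have := valP v0; rewrite !inE.
  by apply: andb_idr; case/orP=> [/orP[/orP[]|]|] /eqP->.
- split; [by apply: (attached_lift atu ex ey ez eu); val_ext e
  |by apply: (attached_lift atv ex ey ez ev); val_ext e].
- by rewrite /= !e.
- by rewrite /= !e.
Qed.

(** [y] meets [v], which begins after [x], and [u], which ends inside [z]. *)
Lemma EFB_in k A x y z u v : Hgraph k A x y z -> x \in D -> z \in D ->
  u \in D -> v \in D -> u -- x -> u -- y -> u -- z -> v -- y -> v -- z ->
  l u < l x -> r x < l v -> l v < l z -> l z <= r u -> r u <= r z ->
  r z < r v -> contains S (@EFB R k).
Proof.
move=> hA xD zD uD vD ux uy uz vy vz h1 h2 h3 h4 h5 h6.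
have [xy xz yz nxy nyz] := Hgraph_indep hA; have [xA yA zA] := Hgraph_mem hA.
have /andP[vx nvx] := drawn_nadj xD vD h2.
have atu := attached3 ux uy uz.
have atv := attached2 vx nvx vy vz xy xz.
have lx := drawn_le xD.
set B := A :|: [set u; v]; have AB : A \subset B by exact: subsetUl.
have sub a : a \in A -> a \in B by apply/subsetP.
have [xB yB zB] := And3 (sub _ xA) (sub _ yA) (sub _ zA).
have uB : u \in B by rewrite !inE eqxx ?orbT.
have vB : v \in B by rewrite !inE eqxx ?orbT.
apply: (@contains_restrict _ _ _ _ B [set x; z; u; v]).
  move=> l' r' rep ext; have [lr adj nadj nb] := repr_facts rep.
  have [ex1 ex2] := ext x xB ltac:(by rewrite !inE eqxx ?orbT) xD.
  have [ez1 ez2] := ext z zB ltac:(by rewrite !inE eqxx ?orbT) zD.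
  have [eu1 eu2] := ext u uB ltac:(by rewrite !inE eqxx ?orbT) uD.
  have [ev1 ev2] := ext v vB ltac:(by rewrite !inE eqxx ?orbT) vD.
  have [nb1 _] := nb _ _ _ _ _ hA AB; apply: nb1.
  have [? [? ?]] := (lr x xB, (lr y yB, lr z zB)).
  have ? := lr u uB; have ? := lr v vB.
  case: (adj u y uB yB uy) => ? ?;
  case: (adj v y vB yB vy) => ? ?;
  case: (nadj y z yB zB yz nyz) => ?;
  case: (nadj x y xB yB xy nxy) => ?; rlra.
have [x' ex] := induced_elt xB; have [y' ey] := induced_elt yB.
have [z' ez] := induced_elt zB; have [u' eu] := induced_elt uB.
have [v' ev] := induced_elt vB.
have e := (ex, ey, ez, eu, ev).
exists [set v : induced B | val v \in A], x', y', z', u', v'; split.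
- exact: Hgraph_induced hA AB _ _ _ ex ey ez.
- split; val_ext e; first by have := valP v0; rewrite !inE.
  by apply: andb_idr; case/orP=> [/orP[/orP[]|]|] /eqP->.
- split; [by apply: (attached_lift atu ex ey ez eu); val_ext e
  |by apply: (attached_lift atv ex ey ez ev); val_ext e].
- by rewrite /= !e.
- by rewrite /= !e.
Qed.

(** [u] exceeds [v] only on the left, so [x] lies left of [v]. As [v] begins inside [y], this puts
    [x] left of [y] and the neighbour [z] of [v] right of it. *)
Lemma FDS_in k A x y z u v : Hgraph k A x y z -> y \in D -> u \in D ->
  v \in D -> u -- x -> u -- y -> u -- z -> v != x -> ~~ (v -- x) -> v -- y ->
  v -- z -> l u < l y -> l y <= l v -> l v <= r y -> r y < r u ->
  r u <= r v -> contains S (@FDS R k).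
Proof.
move=> hA yD uD vD ux uy uz vx nvx vy vz h1 h2 h3 h4 h5.
have [xy xz yz nxy nyz] := Hgraph_indep hA; have [xA yA zA] := Hgraph_mem hA.
have atu := attached3 ux uy uz.
have atv := attached2 vx nvx vy vz xy xz.
set B := A :|: [set u; v]; have AB : A \subset B by exact: subsetUl.
have sub a : a \in A -> a \in B by apply/subsetP.
have [xB yB zB] := And3 (sub _ xA) (sub _ yA) (sub _ zA).
have uB : u \in B by rewrite !inE eqxx ?orbT.
have vB : v \in B by rewrite !inE eqxx ?orbT.
apply: (@contains_restrict _ _ _ _ B [set y; u; v]).
  move=> l' r' rep ext; have [lr adj nadj nb] := repr_facts rep.
  have [ey1 ey2] := ext y yB ltac:(by rewrite !inE eqxx ?orbT) yD.
  have [eu1 eu2] := ext u uB ltac:(by rewrite !inE eqxx ?orbT) uD.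
  have [ev1 ev2] := ext v vB ltac:(by rewrite !inE eqxx ?orbT) vD.
  have [nb1 _] := nb _ _ _ _ _ hA AB; apply: nb1.
  have [? [? ?]] := (lr x xB, (lr y yB, lr z zB)).
  have ? := lr u uB; have ? := lr v vB.
  case: (adj u x uB xB ux) => ? ?;
  case: (nadj v x vB xB vx nvx) => ?;
  case: (adj v z vB zB vz) => ? ?;
  case: (nadj y z yB zB yz nyz) => ?;
  case: (nadj x y xB yB xy nxy) => ?; rlra.
have [x' ex] := induced_elt xB; have [y' ey] := induced_elt yB.
have [z' ez] := induced_elt zB; have [u' eu] := induced_elt uB.
have [v' ev] := induced_elt vB.
have e := (ex, ey, ez, eu, ev).
exists [set v : induced B | val v \in A], x', y', z', u', v'; split.
- exact: Hgraph_induced hA AB _ _ _ ex ey ez.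
- split; val_ext e; first by have := valP v0; rewrite !inE.
  by apply: andb_idr; case/orP=> [/orP[]|] /eqP->.
- split; [by apply: (attached_lift atu ex ey ez eu); val_ext e
  |by apply: (attached_lift atv ex ey ez ev); val_ext e].
- by rewrite /= !e.
Qed.

(** The two tasks of [v] in FDS are shared: [v] keeps [x] left of [y], and [w], beginning inside
    [y], keeps [z] right of it. *)
Lemma EFDS_in k A x y z u v w : Hgraph k A x y z -> y \in D -> u \in D ->
  v \in D -> w \in D -> u -- x -> u -- y -> u -- z -> v != x -> ~~ (v -- x) ->
  v -- y -> v -- z -> w != x -> ~~ (w -- x) -> w -- y -> w -- z ->
  l u < l v -> l v < l y -> l y <= l w -> l w <= r y -> r y < r w ->
  r w < r u -> r u <= r v -> contains S (@EFDS R k).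
Proof.
move=> hA yD uD vD wD ux uy uz vx nvx vy vz wx nwx wy wz h1 h2 h3 h4 h5 h6 h7.
have [xy xz yz nxy nyz] := Hgraph_indep hA; have [xA yA zA] := Hgraph_mem hA.
have atu := attached3 ux uy uz.
have atv := attached2 vx nvx vy vz xy xz.
have atw := attached2 wx nwx wy wz xy xz.
set B := A :|: [set u; v; w]; have AB : A \subset B by exact: subsetUl.
have sub a : a \in A -> a \in B by apply/subsetP.
have [xB yB zB] := And3 (sub _ xA) (sub _ yA) (sub _ zA).
have uB : u \in B by rewrite !inE eqxx ?orbT.
have vB : v \in B by rewrite !inE eqxx ?orbT.
have wB : w \in B by rewrite !inE eqxx ?orbT.
apply: (@contains_restrict _ _ _ _ B [set y; u; v; w]).
  move=> l' r' rep ext; have [lr adj nadj nb] := repr_facts rep.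
  have [ey1 ey2] := ext y yB ltac:(by rewrite !inE eqxx ?orbT) yD.
  have [eu1 eu2] := ext u uB ltac:(by rewrite !inE eqxx ?orbT) uD.
  have [ev1 ev2] := ext v vB ltac:(by rewrite !inE eqxx ?orbT) vD.
  have [ew1 ew2] := ext w wB ltac:(by rewrite !inE eqxx ?orbT) wD.
  have [nb1 _] := nb _ _ _ _ _ hA AB; apply: nb1.
  have [? [? ?]] := (lr x xB, (lr y yB, lr z zB)).
  have ? := lr u uB; have ? := lr v vB; have ? := lr w wB.
  case: (adj u x uB xB ux) => ? ?;
  case: (nadj v x vB xB vx nvx) => ?;
  case: (adj w z wB zB wz) => ? ?;
  case: (nadj y z yB zB yz nyz) => ?;
  case: (nadj x y xB yB xy nxy) => ?; rlra.
have [x' ex] := induced_elt xB; have [y' ey] := induced_elt yB.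
have [z' ez] := induced_elt zB; have [u' eu] := induced_elt uB.
have [v' ev] := induced_elt vB; have [w' ew] := induced_elt wB.
have e := (ex, ey, ez, eu, ev, ew).
exists [set v : induced B | val v \in A], x', y', z', u', v', w'; split.
- exact: Hgraph_induced hA AB _ _ _ ex ey ez.
- split; val_ext e; first by have := valP v0; rewrite !inE.
  by apply: andb_idr; case/orP=> [/orP[/orP[]|]|] /eqP->.
- split; [by apply: (attached_lift atu ex ey ez eu); val_ext e
  |by apply: (attached_lift atv ex ey ez ev); val_ext e
  |by apply: (attached_lift atw ex ey ez ew); val_ext e].
- by rewrite /= !e.
- by rewrite /= !e.
Qed.

(** [x] lies left of [v], so [y], which meets [v], lies right of [x]. By [r w <= r z], which the
    shape of the class does not include, [y] lies left of [z], since it meets [w]. *)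
Lemma FNS_in k A x y z u v w : Hgraph k A x y z -> z \in D -> u \in D ->
  v \in D -> w \in D -> u -- x -> u -- y -> u -- z -> v != x -> ~~ (v -- x) ->
  v -- y -> v -- z -> w != x -> ~~ (w -- x) -> w -- y -> w -- z ->
  l u < l v -> l v <= l z -> l u < l w -> l w <= l z -> l z <= r w ->
  r w < r u -> r u <= r v -> r w <= r z -> contains S (@FNS R k).
Proof.
move=> hA zD uD vD wD ux uy uz vx nvx vy vz wx nwx wy wz h1 h2 h3 h4 h5 h6 h7 h8.
have [xy xz yz nxy nyz] := Hgraph_indep hA; have [xA yA zA] := Hgraph_mem hA.
have atu := attached3 ux uy uz.
have atv := attached2 vx nvx vy vz xy xz.
have atw := attached2 wx nwx wy wz xy xz.
set B := A :|: [set u; v; w]; have AB : A \subset B by exact: subsetUl.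
have sub a : a \in A -> a \in B by apply/subsetP.
have [xB yB zB] := And3 (sub _ xA) (sub _ yA) (sub _ zA).
have uB : u \in B by rewrite !inE eqxx ?orbT.
have vB : v \in B by rewrite !inE eqxx ?orbT.
have wB : w \in B by rewrite !inE eqxx ?orbT.
apply: (@contains_restrict _ _ _ _ B [set z; u; v; w]).
  move=> l' r' rep ext; have [lr adj nadj nb] := repr_facts rep.
  have [ez1 ez2] := ext z zB ltac:(by rewrite !inE eqxx ?orbT) zD.
  have [eu1 eu2] := ext u uB ltac:(by rewrite !inE eqxx ?orbT) uD.
  have [ev1 ev2] := ext v vB ltac:(by rewrite !inE eqxx ?orbT) vD.
  have [ew1 ew2] := ext w wB ltac:(by rewrite !inE eqxx ?orbT) wD.
  have [nb1 _] := nb _ _ _ _ _ hA AB; apply: nb1.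
  have [? [? ?]] := (lr x xB, (lr y yB, lr z zB)).
  have ? := lr u uB; have ? := lr v vB; have ? := lr w wB.
  case: (adj u x uB xB ux) => ? ?;
  case: (nadj v x vB xB vx nvx) => ?;
  case: (adj w y wB yB wy) => ? ?;
  case: (adj v y vB yB vy) => ? ?;
  case: (nadj y z yB zB yz nyz) => ?;
  case: (nadj x y xB yB xy nxy) => ?; rlra.
have [x' ex] := induced_elt xB; have [y' ey] := induced_elt yB.
have [z' ez] := induced_elt zB; have [u' eu] := induced_elt uB.
have [v' ev] := induced_elt vB; have [w' ew] := induced_elt wB.
have e := (ex, ey, ez, eu, ev, ew).
exists [set v : induced B | val v \in A], x', y', z', u', v', w'; split.
- exact: Hgraph_induced hA AB _ _ _ ex ey ez.
- split; val_ext e; first by have := valP v0; rewrite !inE.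
  by apply: andb_idr; case/orP=> [/orP[/orP[]|]|] /eqP->.
- split; [by apply: (attached_lift atu ex ey ez eu); val_ext e
  |by apply: (attached_lift atv ex ey ez ev); val_ext e
  |by apply: (attached_lift atw ex ey ez ew); val_ext e].
- by rewrite /= !e.
- by rewrite /= !e.
Qed.

End Instances.

Lemma Hgraph_xz_nadj (G : sgraph) k A (x y z : G) : Hgraph k A x y z ->
  (1 < k)%N -> ~~ (x -- z).
Proof.
case=> // {}k {}A {}x {}y {}z x' p hA pn [u _] pA ta pa _.
have [_ yA _] := Hgraph_mem hA.
by rewrite adj_sym pa ?mem_head // eq_sym last_neq.
Qed.

(* For k >= 3 the vertex t_{k-1} joins y_k and z_k while avoiding x_k. *)
Lemma Hgraph_shortcut (G : sgraph) k A (x y z : G) : Hgraph k A x y z -> (2 < k)%N ->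
  exists A', Hgraph 1 A' y x z.
Proof.
case=> // k1 A1 x1 y1 z1 x' p hA pn [u _] pA ta pa.
case: hA pA ta pa => // k2 A2 x2 y2 z2 x1' q hA qn [v _] qA tq qa pA ta pa _.
have [x2A y2A z2A] := Hgraph_mem hA; have [x2y2 x2z2 y2z2 _ ny2z2] := Hgraph_indep hA.
set t := last x1' q in tq qa.
have tA1 : t \in A2 :|: [set b in x1' :: q] by rewrite in_setU in_set mem_last orbT.
have inA1 a : a \in A2 -> a \in A2 :|: [set b in x1' :: q] by move=> ?; rewrite in_setU; apply/orP; left.
have x'n a : a \in A2 :|: [set b in x1' :: q] -> (x' != a) && ~~ (x' -- a).
  move=> aA; rewrite adj_sym pa ?mem_head //; last by rewrite eq_sym last_neq.
  by rewrite andbT; apply: contraNneq (pA x' (mem_head _ _)) => ->.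
have ty : t -- y2 by rewrite tq // eq_sym.
have tz : t -- z2 by rewrite tq // eq_sym.
exists (x' |: [set a in [:: y2; t; z2]]).
apply: (@Hgraph_1 _ y2 x' [:: t; z2]) => //.
- apply: induced_path_cons.
  + by rewrite adj_sym.
  + by rewrite !inE negb_or eq_sym adj_neq //= y2z2.
  + by move=> b; rewrite inE => /eqP->.
  apply: induced_path_cons => //; last exact: induced_path_nil.
  by rewrite inE adj_neq.
- rewrite !inE !negb_or; have /andP[-> _] := x'n _ (inA1 _ y2A).
  by have /andP[-> _] := x'n _ tA1; have /andP[-> _] := x'n _ (inA1 _ z2A).
move=> a; rewrite !inE => /or3P[]/eqP->.
- by case/andP: (x'n _ (inA1 _ y2A)).
- by case/andP: (x'n _ tA1).
- by case/andP: (x'n _ (inA1 _ z2A)).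
Qed.

Section Instances2.
Variables (R : realType) (G : sgraph) (S : partial_repr R G).
Local Notation D := (predrawn S).
Local Notation l := (lft S).
Local Notation r := (rgt S).

Lemma LB_in : ~ has_repr R [set: G] -> contains S (@LB R).
Proof.
move=> nG; pose bad (B : {set G}) := `[< ~ has_repr R B >].
have bT : bad [set: G] by exact/asboolP.
case: (@arg_minnP _ [set: G] bad (fun B => #|B|) bT) => B /asboolP nB Bmin.
apply: (@contains_restrict _ _ _ _ B set0).
  by move=> l' r' rep _; apply: nB; exists l', r'.
split.
- by apply/setP=> v; rewrite !inE.
- by move=> [l' [r' /repr_of_induced[l1 [r1 [rep _]]]]]; apply: nB; exists l1, r1.
move=> A /properP[_ [v0 _ v0A]]; have : has_repr R (val @: A).
  apply: contrapT => nA; have := Bmin (val @: A); rewrite leqNgt proper_card //.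
    by move=> h; have : false by apply: h; apply/asboolP.
  apply/properP; split; first by apply/subsetP=> _ /imsetP[v _ ->]; exact: valP.
  by exists (val v0); [exact: valP|rewrite (mem_imset _ _ val_inj)].
move=> [l' [r' [h1 h2]]]; exists (fun v => l' (val v)), (fun v => r' (val v)).
split=> [v vA|v w vA wA vw]; first by apply: h1; exact: imset_f.
by apply: h2; rewrite ?(inj_eq val_inj) //; exact: imset_f.
Qed.

(** [x] and [y] would both contain the point [r u = l v]. *)
Lemma SE_in u v x y : u \in D -> v \in D -> x -- u -> x -- v -> y -- u -> y -- v ->
  x != y -> ~~ (x -- y) -> r u = l v -> (u != v -> l u < l v /\ r u < r v) ->
  contains S (@SE R).
Proof.
move=> uD vD xu xv yu yv xy nxy h1 h2.
set B := [set u; v; x; y].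
have [uB vB xB yB] : [/\ u \in B, v \in B, x \in B & y \in B].
  by rewrite !inE !eqxx !orbT.
apply: (@contains_restrict _ _ _ _ B [set u; v]).
  move=> l' r' rep ext; have [lr adj nadj nb] := repr_facts rep.
  have [eu1 eu2] := ext u uB ltac:(by rewrite !inE eqxx ?orbT) uD.
  have [ev1 ev2] := ext v vB ltac:(by rewrite !inE eqxx ?orbT) vD.
  have [? ?] := adj x u xB uB xu; have [? ?] := adj y u yB uB yu.
  have [? ?] := adj x v xB vB xv; have [? ?] := adj y v yB vB yv.
  case: (nadj x y xB yB xy nxy) => ?; move: h1 => ?; lra.
have [x' ex] := induced_elt xB; have [y' ey] := induced_elt yB.
have [u' eu] := induced_elt uB; have [v' ev] := induced_elt vB.
have e := (ex, ey, eu, ev).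
exists u', v', x', y'; split.
- by val_ext e; have := valP v0; rewrite !inE.
- rewrite !inE !negb_or -!val_eqE /= !e !adj_neq //; split=> //.
  by val_ext e; apply: andb_idr; case/orP=> /eqP->.
- by rewrite -!val_eqE /= !e.
- by rewrite /= !e.
- by rewrite /= -val_eqE /= !e.
Qed.

(** Meeting [u] and [v], the vertex [y] cannot lie left of [x], which covers [l v], nor right of
    [z], which covers [r u]; it would lie between them. *)
Lemma BI_in k A x y z u v : Hgraph k A x y z -> k = 1%N \/ k = 2%N ->
  x \in D -> z \in D -> u \in D -> v \in D -> u -- y -> v -- y ->
  l u <= l v -> l v < r u -> r u <= r v -> l x <= l v -> l v <= r x ->
  l z <= r u -> r u <= r z -> contains S (@BI R k).
Proof.
move=> hA k12 xD zD uD vD uy vy h1 h2 h3 h4 h5 h6 h7.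
have [xy xz yz nxy nyz] := Hgraph_indep hA; have [xA yA zA] := Hgraph_mem hA.
have neq a b : a -- y -> ~~ (b -- y) -> a != b by move=> ay; apply: contraNneq => <-.
have nzy : ~~ (z -- y) by rewrite adj_sym.
have [lu lv] := (drawn_le uD, drawn_le vD).
have ux : u -- x by rewrite (@drawn_adj R G S) ?neq //; apply/andP; split; rlra.
have uz : u -- z by rewrite (@drawn_adj R G S) ?neq //; apply/andP; split; rlra.
have vx : v -- x by rewrite (@drawn_adj R G S) ?neq //; apply/andP; split; rlra.
have vz : v -- z by rewrite (@drawn_adj R G S) ?neq //; apply/andP; split; rlra.
have k2 : k = 2%N -> r x < l z.
  move=> ek; have nxz : ~~ (x -- z) by apply: Hgraph_xz_nadj hA _; rewrite ek.
  move: nxz; rewrite (@drawn_adj R G S) // negb_and -!ltNge => /orP[?|//]; rlra.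
have atu := attached3 ux uy uz; have atv := attached3 vx vy vz.
set B := A :|: [set u; v]; have AB : A \subset B by exact: subsetUl.
have sub a : a \in A -> a \in B by apply/subsetP.
have [xB yB zB] := And3 (sub _ xA) (sub _ yA) (sub _ zA).
have uB : u \in B by rewrite !inE eqxx ?orbT.
have vB : v \in B by rewrite !inE eqxx ?orbT.
apply: (@contains_restrict _ _ _ _ B [set x; z; u; v]).
  move=> l' r' rep ext; have [lr adj nadj nb] := repr_facts rep.
  have [ex1 ex2] := ext x xB ltac:(by rewrite !inE eqxx ?orbT) xD.
  have [ez1 ez2] := ext z zB ltac:(by rewrite !inE eqxx ?orbT) zD.
  have [eu1 eu2] := ext u uB ltac:(by rewrite !inE eqxx ?orbT) uD.
  have [ev1 ev2] := ext v vB ltac:(by rewrite !inE eqxx ?orbT) vD.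
  have [nb1 _] := nb _ _ _ _ _ hA AB; apply: nb1.
  have [? ?] := adj u y uB yB uy; have [? ?] := adj v y vB yB vy.
  case: (nadj x y xB yB xy nxy) => ?; case: (nadj y z yB zB yz nyz) => ?; rlra.
have [x' ex] := induced_elt xB; have [y' ey] := induced_elt yB; have [z' ez] := induced_elt zB.
have [u' eu] := induced_elt uB; have [v' ev] := induced_elt vB.
have e := (ex, ey, ez, eu, ev).
exists [set a : induced B | val a \in A], x', y', z', u', v'; split.
- left; exact: Hgraph_induced hA AB _ _ _ ex ey ez.
- split; val_ext e; first by have := valP v0; rewrite !inE.
  by apply: andb_idr; case/orP=> [/orP[/orP[]|]|] /eqP->.
- split; [by apply: (attached_lift atu ex ey ez eu); val_ext e
         |by apply: (attached_lift atv ex ey ez ev); val_ext e].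
- by rewrite /= !e.
- by rewrite /covers /left_of /= !e !in_itv /= h4 h5 h6 h7.
Qed.

(** The case [x = z]: as [x] covers both [l v] and [r u], neither side of it is left for [y]. *)
Lemma BI1_in x y u v : x \in D -> u \in D -> v \in D -> x != y -> ~~ (x -- y) ->
  u -- y -> v -- y -> l u <= l v -> l v < r u -> r u <= r v -> l x <= l v ->
  l v <= r x -> l x <= r u -> r u <= r x -> contains S (@BI R 1).
Proof.
move=> xD uD vD xy nxy uy vy h1 h2 h3 h4 h5 h6 h7.
have neq a b : a -- y -> ~~ (b -- y) -> a != b by move=> ay; apply: contraNneq => <-.
have [lu lv] := (drawn_le uD, drawn_le vD).
have ux : u -- x by rewrite (@drawn_adj R G S) ?neq //; apply/andP; split; rlra.
have vx : v -- x by rewrite (@drawn_adj R G S) ?neq //; apply/andP; split; rlra.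
have atu := attached3 ux uy ux; have atv := attached3 vx vy vx.
set B := [set x; y] :|: [set u; v].
have [xB yB uB vB] : [/\ x \in B, y \in B, u \in B & v \in B].
  by rewrite !inE !eqxx !orbT.
apply: (@contains_restrict _ _ _ _ B [set x; x; u; v]).
  move=> l' r' rep ext; have [lr adj nadj nb] := repr_facts rep.
  have [ex1 ex2] := ext x xB ltac:(by rewrite !inE eqxx ?orbT) xD.
  have [eu1 eu2] := ext u uB ltac:(by rewrite !inE eqxx ?orbT) uD.
  have [ev1 ev2] := ext v vB ltac:(by rewrite !inE eqxx ?orbT) vD.
  have [? ?] := adj u y uB yB uy; have [? ?] := adj v y vB yB vy.
  case: (nadj x y xB yB xy nxy) => ?; rlra.
have [x' ex] := induced_elt xB; have [y' ey] := induced_elt yB.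
have [u' eu] := induced_elt uB; have [v' ev] := induced_elt vB.
have e := (ex, ey, eu, ev).
exists [set x'; y'], x', y', x', u', v'; split.
- by right; rewrite -val_eqE /= !e.
- split; val_ext e; first by have := valP v0; rewrite !inE.
  by apply: andb_idr; case/orP=> [/orP[/orP[]|]|] /eqP->.
- split; [by apply: (attached_lift atu ex ey ex eu); val_ext e
         |by apply: (attached_lift atv ex ey ex ev); val_ext e].
- by rewrite /= !e.
- by rewrite /covers /= !e !in_itv /= h4 h5 h6 h7.
Qed.

(** [u] ends inside [z], so [x] and [y] lie left of [z]; one of the two graphs forbids [x] before
    [y], the other [y] before [x]. *)
Lemma CE_in k m A A' x y z u : Hgraph k A x y z -> Hgraph m A' y x z ->
  z \in D -> u \in D -> u -- x -> u -- y -> u -- z ->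
  l u < l z -> l z <= r u -> r u <= r z -> contains S (@CE R k m).
Proof.
move=> hA hA' zD uD ux uy uz h1 h2 h3.
have [xy xz yz nxy nyz] := Hgraph_indep hA; have [xA yA zA] := Hgraph_mem hA.
have [_ _ _ _ nxz] := Hgraph_indep hA'.
have atu := attached3 ux uy uz.
set B := A :|: A' :|: [set u].
have AB : A \subset B by rewrite /B -setUA subsetUl.
have AB' : A' \subset B by rewrite /B [A :|: A']setUC -setUA subsetUl.
have sub a : a \in A -> a \in B by apply/subsetP.
have [xB yB zB] := And3 (sub _ xA) (sub _ yA) (sub _ zA).
have uB : u \in B by rewrite !inE eqxx ?orbT.
apply: (@contains_restrict _ _ _ _ B [set z; u]).
  move=> l' r' rep ext; have [lr adj nadj nb] := repr_facts rep.
  have [ez1 ez2] := ext z zB ltac:(by rewrite !inE eqxx ?orbT) zD.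
  have [eu1 eu2] := ext u uB ltac:(by rewrite !inE eqxx ?orbT) uD.
  have [nb1 _] := nb _ _ _ _ _ hA AB; have [nb2 _] := nb _ _ _ _ _ hA' AB'.
  have [? ?] := adj u x uB xB ux; have [? ?] := adj u y uB yB uy.
  case: (nadj x z xB zB xz nxz) => ?; case: (nadj y z yB zB yz nyz) => ?; [|rlra..].
  by case: (nadj x y xB yB xy nxy) => ?; [apply: nb1; split|apply: nb2; split].
have [x' ex] := induced_elt xB; have [y' ey] := induced_elt yB; have [z' ez] := induced_elt zB.
have [u' eu] := induced_elt uB; have e := (ex, ey, ez, eu).
exists [set a : induced B | val a \in A], [set a | val a \in A'], x', y', z', u'; split.
- by split; [exact: Hgraph_induced hA AB _ _ _ ex ey ez|exact: Hgraph_induced hA' AB' _ _ _ ey ex ez].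
- by val_ext e; have := valP v0; rewrite !inE.
- val_ext e.
  by apply: andb_idr; case/orP=> /eqP->.
- by apply: (attached_lift atu ex ey ez eu); val_ext e.
- by rewrite /= !e.
Qed.

End Instances2.

Inductive obstructed (R : realType) (G : sgraph) (S : partial_repr R G) : Prop :=
| obs_LB of contains S (@LB R)
| obs_SE of contains S (@SE R)
| obs_FAT k of (0 < k)%N & contains S (@FAT R k)
| obs_FS k of (0 < k)%N & contains S (@FS R k)
| obs_EFS k of (0 < k)%N & contains S (@EFS R k)
| obs_FB k of (0 < k)%N & contains S (@FB R k)
| obs_EFB k of (0 < k)%N & contains S (@EFB R k)
| obs_FDS k of (0 < k)%N & contains S (@FDS R k)
| obs_EFDS k of (0 < k)%N & contains S (@EFDS R k)
| obs_FNS k of (0 < k)%N & contains S (@FNS R k)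
| obs_BI k of k = 1%N \/ k = 2%N & contains S (@BI R k)
| obs_CE k m of (0 < m)%N & (m <= k)%N & m = 1%N \/ k = 2%N /\ m = 2%N &
    contains S (@CE R k m).

Lemma obstructed_reflection (R : realType) (G : sgraph) (S : partial_repr R G) :
  obstructed (reflection S) -> obstructed S.
Proof.
case=> [/contains_reflection|/contains_reflection|k k0 /contains_reflection
  |k k0 /contains_reflection|k k0 /contains_reflection|k k0 /contains_reflection
  |k k0 /contains_reflection|k k0 /contains_reflection|k k0 /contains_reflection
  |k k0 /contains_reflection|k k0 /contains_reflection|k m k0 mk km /contains_reflection].
- exact: obs_LB.
- exact: obs_SE.
- exact: obs_FAT.
- exact: obs_FS.
- exact: obs_EFS.
- exact: obs_FB.
- exact: obs_EFB.
- exact: obs_FDS.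
- exact: obs_EFDS.
- exact: obs_FNS.
- exact: obs_BI.
- exact: obs_CE.
Qed.

(** * From conflicts to obstructions *)

Section Basic.
Variables (R : realType) (G : sgraph) (lt0 : rel G).
Hypothesis o0 : orientation [set: G] lt0.
Variable S : partial_repr R G.
Local Notation D := (predrawn S).
Local Notation l := (lft S).
Local Notation r := (rgt S).

Lemma drawn_cases x y : x \in D -> y \in D -> nonadj x y -> r x < l y \/ r y < l x.
Proof.
move=> xD yD /andP[xy]; rewrite (drawn_adj xD yD xy) negb_and -!ltNge.
by case/orP; tauto.
Qed.

Lemma drawn_adjI x y : x \in D -> y \in D -> x != y -> l x <= r y -> l y <= r x -> x -- y.
Proof. by move=> xD yD xy h1 h2; rewrite (drawn_adj xD yD xy) h1. Qed.

Lemma drawn_adjE x y : x \in D -> y \in D -> x -- y -> l x <= r y /\ l y <= r x.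
Proof. by move=> xD yD xy; apply/andP; rewrite -drawn_adj // adj_neq. Qed.

Lemma drawn_nonadj x y : x \in D -> y \in D -> r x < l y -> nonadj x y.
Proof. by move=> xD yD xy; rewrite nonadjC; exact: drawn_nadj xD yD xy. Qed.

(** If [r u < l v], then [u], [a], [v], [b] form an induced 4-cycle, excluded by [lt0]. If
    [r u = l v] and the intervals share a left or a right end, one of them is a point and serves as
    both drawn vertices. *)
Lemma SE_core u v a b : u \in D -> v \in D -> a -- u -> a -- v -> b -- u -> b -- v ->
  nonadj a b -> l u <= l v -> r u <= r v -> r u <= l v -> obstructed S.
Proof.
move=> uD vD au av bu bv /andP[ab nab] h1 h2; rewrite le_eqVlt => /orP[/eqP e|lt_uv].
  have [e1|ne1] := eqVneq (l u) (l v).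
    by apply: obs_SE; apply: (SE_in uD uD au au bu bu ab nab); rewrite ?e // eqxx.
  have [e2|ne2] := eqVneq (r u) (r v).
    by apply: obs_SE; apply: (SE_in vD vD av av bv bv ab nab); rewrite ?eqxx // -e2.
  apply: obs_SE; apply: (SE_in uD vD au av bu bv ab nab e) => _.
  by rewrite !lt_neqAle ne1 ne2 h1.
have nuv := drawn_nonadj uD vD lt_uv; have [L [H [LH _ adjN nadjN _]]] := nat_model o0.
have nab' : nonadj a b by apply/andP.
have [? ?] := adjN _ _ au; have [? ?] := adjN _ _ av.
have [? ?] := adjN _ _ bu; have [? ?] := adjN _ _ bv.
by exfalso; case: (nadjN _ _ nuv) => ?; case: (nadjN _ _ nab') => ?; nlia.
Qed.

(** A 1-BI with x_1 = z_1 = [v], or an SE if [u] is a point. *)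
Lemma nested_obstructed v y u : v \in D -> u \in D -> u -- y -> nonadj v y ->
  l v <= l u -> r u <= r v -> obstructed S.
Proof.
move=> vD uD uy nvy h1 h2; have /andP[vy nvy'] := nvy; have lu := drawn_le uD.
have uv : u != v by apply: contraNneq nvy' => <-.
have auv : u -- v by apply: drawn_adjI => //; rlra.
have [lt_u|ge_u] := ltP (l u) (r u).
  by apply: (@obs_BI _ _ _ 1%N); [by left|apply: (BI1_in vD uD uD vy nvy' uy uy) => //; rlra].
by apply: (@SE_core u u v y) => //; rewrite 1?adj_sym // lexx.
Qed.

Lemma FS_small x v y u : x \in D -> v \in D -> u \in D -> r x < l v -> x -- y ->
  u -- v -> u -- y -> nonadj v y -> l v <= l u -> obstructed S.
Proof.
move=> xD vD uD xv xy uv uy nvy h; have [ru|ru] := leP (r u) (r v).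
  exact: nested_obstructed uy nvy h ru.
have nxv := drawn_nonadj xD vD xv; have nyv : nonadj y v by rewrite nonadjC.
have [A hA] := Hgraph_of_adj xy nxv nyv.
have [? _] := drawn_adjE uD vD uv.
by apply: (@obs_FS _ _ _ 1%N) => //; exact: (FS_in hA xD vD uD uv uy h).
Qed.

End Basic.

(** * Opposite forcing of one pair, and cases settled by one H_k *)

Section TwoConflict.
Variables (R : realType) (G : sgraph) (lt0 : rel G).
Hypothesis o0 : orientation [set: G] lt0.
Variable S : partial_repr R G.
Local Notation D := (predrawn S).
Local Notation l := (lft S).
Local Notation r := (rgt S).

(* The interval a forces v to lie left of y while b forces it to lie right of y. *)
Lemma two_conflict v y a b : v \in D -> a \in D -> b \in D -> a -- y -> b -- y ->
  nonadj v y -> l v <= l a -> r b <= r v -> obstructed S.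
Proof.
move=> vD aD bD ay by_ nvy h1 h2; have /andP[vy nvy'] := nvy.
have [lv [la lb]] := (drawn_le vD, (drawn_le aD, drawn_le bD)).
have av : a != v by apply: contraNneq nvy' => <-.
have bv : b != v by apply: contraNneq nvy' => <-.
(* If [a] and [b] both miss [v], the path [b], [y], [a] gives a 1-FAT; if one of them does,
   [FS_small] applies; if none does, a 1-BI or an SE appears. *)
have [va|av'] := ltP (r v) (l a); have [bv'|vb] := ltP (r b) (l v).
- have nba : ~~ (b -- a).
    by have /andP[_] := drawn_nonadj bD aD (lt_le_trans (lt_le_trans bv' lv) (ltW va)).
  have /andP[bv1 bv2] := drawn_nonadj bD vD bv'; have /andP[va1 va2] := drawn_nonadj vD aD va.
  have hA : Hgraph 1 (v |: [set c in [:: b; y; a]]) b v a.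
    apply: (@Hgraph_1 _ b v [:: y; a]) => //.
    + apply: induced_path_cons => //.
      * rewrite !inE negb_or (adj_neq by_) /=; apply: contraTneq bv' => ->; rewrite -leNgt; rlra.
      * by move=> c; rewrite inE => /eqP->.
      apply: induced_path_cons; rewrite 1?adj_sym // ?inE; last exact: induced_path_nil.
      by rewrite eq_sym adj_neq.
    + by rewrite !inE !negb_or [v == b]eq_sym bv1 vy va1.
    by move=> c; rewrite !inE => /or3P[]/eqP-> //; rewrite adj_sym.
  by apply: (@obs_FAT _ _ _ 1%N) => //; exact: (FAT_in hA bD vD aD bv' va).
- apply: obstructed_reflection.
  apply: (@FS_small _ _ lt0 o0 (reflection S) a v y b) => //=; rewrite ?ltrN2 ?lerN2 //.
  by apply: (drawn_adjI bD vD) => //; rlra.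
- apply: (@FS_small _ _ lt0 o0 S b v y a) => //.
  by apply: (drawn_adjI aD vD) => //; rlra.
have aav : a -- v by apply: (drawn_adjI aD vD) => //; rlra.
have abv : b -- v by apply: (drawn_adjI bD vD) => //; rlra.
(* Of [a] and [b], [c] is to be the one with the larger left end and [d] the one with the smaller
   right end; they may coincide. *)
have core c d : c \in D -> d \in D -> c -- y -> d -- y -> c -- v -> d -- v ->
    l v <= l c -> r d <= r v -> l d <= l c -> r d <= r c -> obstructed S.
  move=> cD dD cy dy cv dv g1 g2 g3 g4; have [lt_c|ge_c] := ltP (l c) (r d).
    apply: (@obs_BI _ _ _ 1%N); first by left.
    have [? ?] := drawn_adjE cD vD cv; have [? ?] := drawn_adjE dD vD dv.
    by apply: (BI1_in vD dD cD vy nvy' dy cy); rlra.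
  by apply: (@SE_core _ _ _ o0 S d c v y) => //; rewrite adj_sym.
have [ba|ab] := leP (l b) (l a); have [rba|rab] := leP (r b) (r a).
- exact: (core a b).
- by apply: (core a a) => //; rlra.
- by apply: (core b b) => //; rlra.
- by apply: (core b a) => //; rlra.
Qed.

Lemma FS_case x y z w : x \in D -> y \in D -> w \in D -> r x < l y -> w -- y -> w -- z ->
  l y <= l w -> tied x y z y -> nonadj z y -> obstructed S.
Proof.
move=> xD yD wD xy wy wz h t nzy; have nxy := drawn_nonadj xD yD xy.
have [rw|rw] := leP (r w) (r y).
  by apply: (@two_conflict y z w w) => //; rewrite nonadjC.
have [? ?] := drawn_adjE wD yD wy.
have /andP[wx nwx] := drawn_nadj xD wD (lt_le_trans xy h).
have [k [A hA]] := Hgraph_of_cover o0 t nxy nzy wy wz wx nwx.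
by apply: (obs_FS (Hgraph_gt0 hA)); exact: (FS_in hA xD yD wD wy wz h).
Qed.

Lemma FAT_half k A x y z : Hgraph k A x y z -> x \in D -> y \in D -> z \in D ->
  r x < l y -> r y < l z -> obstructed S.
Proof. by move=> hA *; apply: (obs_FAT (Hgraph_gt0 hA)); exact: FAT_in hA _ _ _ _ _. Qed.

Lemma FB_case x y z w : x \in D -> z \in D -> w \in D -> r x < l w -> w -- y -> w -- z ->
  r w <= r z -> tied x y z y -> nonadj x y -> nonadj z y -> obstructed S.
Proof.
move=> xD zD wD xw wy wz h t nxy nzy; have [lw|lw] := leP (l z) (l w).
  exact: (@two_conflict z y w w).
have [? ?] := drawn_adjE wD zD wz.
have /andP[wx nwx] := drawn_nadj xD wD xw.
have [k [A hA]] := Hgraph_of_cover o0 t nxy nzy wy wz wx nwx.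
by apply: (obs_FB (Hgraph_gt0 hA)); exact: (FB_in hA xD zD wD wy wz lw).
Qed.

(** For k >= 3 the shortcut H_1 turns the configuration into a (k,1)-CE with only [z] and [u] drawn,
    unless [u] lies inside [z]. *)
Lemma BI_half k A x y z u v : Hgraph k A x y z -> x \in D -> z \in D -> u \in D -> v \in D ->
  u -- y -> v -- y -> l u <= l v -> l v < r u -> r u <= r v -> l x <= l v -> l v <= r x ->
  l z <= r u -> r u <= r z -> obstructed S.
Proof.
move=> hA xD zD uD vD uy vy h1 h2 h3 h4 h5 h6 h7.
have k0 := Hgraph_gt0 hA; have [k2|k2] := leqP k 2.
  apply: (@obs_BI _ _ _ k); first by case: k hA k0 k2 => [|[|[|]]] //; [left|right].
  by apply: (BI_in hA _ xD zD uD vD uy vy); first by case: k hA k0 k2 => [|[|[|]]] //; [left|right].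
have [A' hA'] := Hgraph_shortcut hA k2.
have [xy xz yz nxy nyz] := Hgraph_indep hA.
have nzy : nonadj z y by rewrite nonadjC; apply/andP.
have uz : u -- z.
  have uz : u != z by apply: contraTneq nzy => <-; rewrite /nonadj uy andbF.
  by apply: (drawn_adjI uD zD uz) => //; have := drawn_le uD; rlra.
have ux : u -- x.
  have ux : u != x by apply: contraNneq nxy => <-.
  by apply: (drawn_adjI uD xD ux); have := drawn_le uD; rlra.
have [luz|luz] := leP (l z) (l u); first exact: (@two_conflict z y u u).
apply: (@obs_CE _ _ _ k 1%N) => //; first by left.
exact: (CE_in hA hA' zD uD ux uy uz).
Qed.

End TwoConflict.

(** * Conflicts forcing y between x and z, which lie on one side of y *)

Section TypeI.
Variables (R : realType) (G : sgraph) (lt0 : rel G).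
Hypothesis o0 : orientation [set: G] lt0.

Section Half.
Variable S : partial_repr R G.
Local Notation D := (predrawn S).
Local Notation l := (lft S).
Local Notation r := (rgt S).

Lemma FAT_case x y z : x \in D -> y \in D -> z \in D -> r x < l y -> r y < l z ->
  tied x y z y -> obstructed S.
Proof.
move=> xD yD zD xy yz t; have nxy := drawn_nonadj xD yD xy.
have nzy : nonadj z y by rewrite nonadjC; exact: drawn_nonadj yD zD yz.
have xz : x != z.
  apply: contraTneq xy => ->; rewrite -leNgt; have := drawn_le yD; have := drawn_le zD; rlra.
case: (Hgraph_of_tied o0 t nxy nzy xz) => [[k [A hA]]|[k [A hA]]].
  exact: FAT_half hA xD yD zD xy yz.
apply: obstructed_reflection; apply: (@FAT_half _ _ (reflection S) _ _ _ _ _ hA) => //=.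
  by rewrite ltrN2.
by rewrite ltrN2.
Qed.

Lemma BI_case x y z u w : x \in D -> z \in D -> u \in D -> w \in D -> u -- y -> w -- y ->
  nonadj x y -> nonadj z y -> x != z -> tied x y z y -> l x <= l u -> l u <= r x ->
  l z <= r w -> r w <= r z -> l w <= r x -> l z <= r u -> obstructed S.
Proof.
move=> xD zD uD wD uy wy nxy nzy xz t h1 h2 h3 h4 h5 h6.
have [lu lw] := (drawn_le uD, drawn_le wD).
(* Of [u] and [w], [a] is to be the one with the smaller right end and [b] the one with the larger
   left end, possibly the same; [x] covers [l b] and [z] covers [r a]. *)
have core a b : a \in D -> b \in D -> a -- y -> b -- y -> l a <= l b -> r a <= r b ->
    l x <= l b -> l b <= r x -> l z <= r a -> r a <= r z -> obstructed S.
  move=> aD bD ay by_ g1 g2 g3 g4 g5 g6; have [lt_b|ge_b] := ltP (l b) (r a).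
    case: (Hgraph_of_tied o0 t nxy nzy xz) => [[k [A hA]]|[k [A hA]]].
      exact: (BI_half o0 hA xD zD aD bD).
    apply: obstructed_reflection.
    by apply: (@BI_half _ _ _ o0 (reflection S) _ _ _ _ _ b a hA) => //=; rewrite ?ltrN2 ?lerN2.
  have [la lb] := (drawn_le aD, drawn_le bD).
  have ax c : c \in D -> c -- y -> l c <= r x -> l x <= r c -> x -- c.
    move=> cD cy ? ?; apply: (drawn_adjI xD cD) => //; apply: contraTneq nxy => ->.
    by rewrite /nonadj cy andbF.
  have [xa|xa] := leP (l x) (r a); last first.
    apply: (@two_conflict _ _ _ o0 S x y b a) => //; have := drawn_le xD; rlra.
  apply: (@SE_core _ _ _ o0 S a b x y) => //; rewrite 1?adj_sym //.
    by rewrite adj_sym; apply: ax => //; rlra.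
  by rewrite adj_sym; apply: ax => //; rlra.
have [uw|wu] := leP (l u) (l w); have [ruw|rwu] := leP (r u) (r w).
- by apply: (core u w) => //; rlra.
- by apply: (core w w) => //; rlra.
- by apply: (core u u) => //; rlra.
- by apply: (core w u) => //; rlra.
Qed.

End Half.

(** Here [y] is drawn. If [u] misses [y] it replaces [x], and likewise [w] replaces [z]. No
    replacement leads to [two_conflict], one to [FS_case], two to [FAT_case]. *)
Lemma typei_mid (S : partial_repr R G) x y z u w :
  y \in predrawn S -> u \in predrawn S -> w \in predrawn S ->
  u = x \/ u -- x -> rgt S u <= rgt S y -> w = z \/ w -- z -> lft S y <= lft S w ->
  tied x y z y -> nonadj x y -> nonadj z y -> obstructed S.
Proof.
move=> yD uD wD ux ruy wz lyw t nxy nzy.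
have left_half (S' : partial_repr R G) a v c : y \in predrawn S' -> v \in predrawn S' -> v = a \/ v -- a -> nonadj a y ->
    rgt S' v <= rgt S' y -> tied a y c y ->
    (v -- y /\ v -- a) \/ [/\ rgt S' v < lft S' y, nonadj v y & tied v y c y].
  move=> yD' vD va nay rv ta.
  have vy : v != y.
    by case: va => [->|va]; [case/andP: nay|apply: contraTneq nay => <-; rewrite nonadjC /nonadj va andbF].
  have [avy|navy] := boolP (v -- y).
    left; split=> //; case: va => // e; move: nay; rewrite -e /nonadj avy andbF //.
  have nvy : nonadj v y by apply/andP.
  right; split=> //.
    case: (drawn_cases vD yD' nvy) => // h.
    have := drawn_le vD; have := drawn_le yD'; move: h rv => *; exfalso; rlra.
  case: va => [->//|va]; apply: tied_trans ta; exact: tied_adj.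
have := left_half S x u z yD uD ux nxy ruy t.
have := left_half (reflection S) z w x yD wD wz nzy.
rewrite /= lerN2 => /(_ lyw (tied_sym t)).
case=> [[wy wz']|[wy nwy twy]]; case=> [[uy ux']|[uy nuy tuy]].
- have [L [H [LH ltE adjN nadjN adjP]]] := nat_model o0.
  have [? ?] := adjN _ _ wy; have [? ?] := adjN _ _ wz'.
  have [? ?] := adjN _ _ uy; have [? ?] := adjN _ _ ux'.
  have [? [? ?]] := (LH x, (LH y, LH z)); have [? ?] := (LH u, LH w).
  have wx : w != x by apply: contraTneq nxy => <-; rewrite /nonadj wy andbF.
  have uz : u != z by apply: contraTneq nzy => <-; rewrite /nonadj uy andbF.
  (* Of [x] and [z], on the same side of [y], the one nearer to [y] is met by both [u] and [w]. *)
  have [auz|awx] : u -- z \/ w -- x.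
    have [uz1|uz1] := leqP (L u) (H z); have [uz2|uz2] := leqP (L z) (H u);
      [left|right..]; apply: adjP => //;
      case: (tied_cases o0 ltE nadjN t nxy nzy) => -[? ?]; nlia.
  + by apply: (@two_conflict _ _ _ o0 S y z w u) => //; rewrite nonadjC.
  + by apply: (@two_conflict _ _ _ o0 S y x w u) => //; rewrite nonadjC.
- exact: (@FS_case _ _ _ o0 S u y z w).
- rewrite ltrN2 in wy; apply: obstructed_reflection.
  apply: (@FS_case _ _ _ o0 (reflection S) w y x u) => //=; rewrite ?ltrN2 ?lerN2 //.
rewrite ltrN2 in wy; apply: (@FAT_case S u y w) => //.
exact: tied_trans tuy (tied_trans (tied_sym t) (tied_sym twy)).
Qed.

End TypeI.

Lemma tied_adjr (G : sgraph) (x y y' : G) : y -- y' -> nonadj x y -> nonadj x y' ->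
  tied x y x y'.
Proof.
by move=> yy' n n'; apply: tied_rev; apply: tied_adj => //; rewrite nonadjC.
Qed.

(** * The same conflicts with x and z drawn *)

Section TypeIOut.
Variables (R : realType) (G : sgraph) (lt0 : rel G).
Hypothesis o0 : orientation [set: G] lt0.

Section Half.
Variable S : partial_repr R G.
Local Notation D := (predrawn S).
Local Notation l := (lft S).
Local Notation r := (rgt S).

Lemma nonadj_ne_adj (a b c : G) : nonadj a b -> c -- b -> c != a.
Proof. by move=> nab cb; apply: contraTneq nab => <-; rewrite /nonadj cb andbF. Qed.

Lemma FAT_through x y z u : x \in D -> z \in D -> u \in D -> u -- y ->
  r x < l u -> r u < l z -> tied x y z y -> nonadj x y -> nonadj z y -> obstructed S.
Proof.
move=> xD zD uD uy xu uz t nxy nzy.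
have nxu := drawn_nonadj xD uD xu.
have nzu : nonadj z u by rewrite nonadjC; exact: drawn_nonadj uD zD uz.
apply: (@FAT_case _ _ _ o0 S x u z) => //.
exact: tied_trans (tied_adjr uy nxu nxy) (tied_trans t (tied_sym (tied_adjr uy nzu nzy))).
Qed.

(** [u] lies right of [x] and [w] ends inside [z]. Smaller configurations settle everything except
    that [w] begins before [x] and [u] extends beyond both ends of [z], which is EFB. *)
Lemma EFB_case x y z u w : x \in D -> z \in D -> u \in D -> w \in D -> u -- y -> w -- y ->
  nonadj x y -> nonadj z y -> x != z -> tied x y z y ->
  r x < l u -> l z <= r w -> r w <= r z -> l x <= r w -> l u <= r z -> obstructed S.
Proof.
move=> xD zD uD wD uy wy nxy nzy xz t h1 h2 h3 h4 h5.
have [lw [lu [lx lz]]] := (drawn_le wD, (drawn_le uD, (drawn_le xD, drawn_le zD))).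
have wz : w -- z.
  by apply: (drawn_adjI wD zD) => //; [exact: nonadj_ne_adj nzy wy|rlra].
have [xw|wx] := ltP (r x) (l w); first exact: (@FB_case _ _ _ o0 S x y z w).
have awx : w -- x by apply: (drawn_adjI wD xD) => //; exact: nonadj_ne_adj nxy wy.
have [uz|zu] := ltP (r u) (l z); first exact: (@FAT_through x y z u).
have auz : u -- z by apply: (drawn_adjI uD zD) => //; exact: nonadj_ne_adj nzy uy.
have [lwx|lxw] := leP (l x) (l w).
  by apply: (@BI_case _ _ _ o0 S x y z w w).
have [lzu|luz] := leP (l z) (l u); first exact: (@two_conflict _ _ _ o0 S z y u w).
have [ruz|rzu] := leP (r u) (r z); first exact: (@FB_case _ _ _ o0 S x y z u).
have /andP[ux nux] := drawn_nadj xD uD h1.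
have [k [A hA]] := Hgraph_of_cover o0 t nxy nzy uy auz ux nux.
by apply: (obs_EFB (Hgraph_gt0 hA)); exact: (EFB_in hA xD zD wD uD awx wy wz uy auz).
Qed.

End Half.

(** If [y] is free, [u] and [w] both meet it. The main distinction is whether [u] begins within or
    after [x] and whether [w] ends within or before [z]. *)
Lemma typei_out (S : partial_repr R G) x y z u w :
  x \in predrawn S -> z \in predrawn S -> u \in predrawn S -> w \in predrawn S ->
  u = y \/ u -- y -> lft S x <= lft S u -> w = y \/ w -- y -> rgt S w <= rgt S z ->
  tied x y z y -> nonadj x y -> nonadj z y -> obstructed S.
Proof.
move=> xD zD uD wD ey hxu ew hwz t nxy nzy.
have [lw [lu [lx lz]]] := (drawn_le wD, (drawn_le uD, (drawn_le xD, drawn_le zD))).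
have [yD|yD] := boolP (y \in predrawn S).
  have ly := drawn_le yD.
  have xy : rgt S x < lft S y.
    case: (drawn_cases xD yD nxy) => // h; exfalso; case: ey => [e|uy].
      by rewrite e in lu hxu; rlra.
    by have [? ?] := drawn_adjE uD yD uy; rlra.
  have nyz : nonadj y z by rewrite nonadjC.
  have yz : rgt S y < lft S z.
    case: (drawn_cases yD zD nyz) => // h; exfalso; case: ew => [e|wy].
      by rewrite e in lw hwz; rlra.
    by have [? ?] := drawn_adjE wD yD wy; rlra.
  exact: (@FAT_case _ _ _ o0 S x y z).
have uy : u -- y by case: ey => // e; rewrite -e uD in yD.
have wy : w -- y by case: ew => // e; rewrite -e wD in yD.
have [exz|xz] := eqVneq x z.
  by apply: (@two_conflict _ _ _ o0 S x y u w) => //; rewrite exz.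
have [wx|xw] := ltP (rgt S w) (lft S x).
  by apply: (@two_conflict _ _ _ o0 S x y u w) => //; rlra.
have [zu|uz] := ltP (rgt S z) (lft S u).
  by apply: (@two_conflict _ _ _ o0 S z y u w) => //; rlra.
have wx := nonadj_ne_adj nxy wy; have ux := nonadj_ne_adj nxy uy.
have wz := nonadj_ne_adj nzy wy; have uz' := nonadj_ne_adj nzy uy.
have [xu|ux'] := ltP (rgt S x) (lft S u); have [wz'|zw] := ltP (rgt S w) (lft S z).
- have [xw'|wx'] := ltP (rgt S x) (lft S w); first exact: (@FAT_through S x y z w).
  have awx : w -- x by apply: (drawn_adjI wD xD).
  have [uz1|zu1] := ltP (rgt S u) (lft S z); first exact: (@FAT_through S x y z u).
  have auz : u -- z by apply: (drawn_adjI uD zD).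
  (* Of [x] and [z], the one nearer to [y] would be met by both [u] and [w]; but [u] misses [x] and
     [w] misses [z]. *)
  have [L [H [LH ltE adjN nadjN _]]] := nat_model o0.
  have nxu := drawn_nonadj xD uD xu; have nwz := drawn_nonadj wD zD wz'.
  have [? ?] := adjN _ _ wy; have [? ?] := adjN _ _ uy.
  have [? ?] := adjN _ _ awx; have [? ?] := adjN _ _ auz.
  have [? [? ?]] := (LH x, (LH y, LH z)); have [? ?] := (LH u, LH w).
  exfalso; case: (tied_cases o0 ltE nadjN t nxy nzy) => -[? ?];
    case: (nadjN _ _ nxu) => ?; case: (nadjN _ _ nwz) => ?; nlia.
- exact: (@EFB_case S x y z u w).
- apply: obstructed_reflection.
  apply: (@EFB_case (reflection S) z y x w u) => //=; rewrite ?ltrN2 ?lerN2 //.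
    by rewrite eq_sym.
  exact: tied_sym.
have [xw'|wx'] := ltP (rgt S x) (lft S w).
  have awz : w -- z by apply: (drawn_adjI wD zD) => //; rlra.
  exact: (@FB_case _ _ _ o0 S x y z w).
have [uz1|zu1] := ltP (rgt S u) (lft S z).
  have aux : u -- x by apply: (drawn_adjI uD xD) => //; rlra.
  apply: obstructed_reflection.
  apply: (@FB_case _ _ _ o0 (reflection S) z y x u) => //=; rewrite ?ltrN2 ?lerN2 //.
  exact: tied_sym.
exact: (@BI_case _ _ _ o0 S x y z u w).
Qed.

End TypeIOut.

(** * Conflicts forcing x and y left of z, which lies between them *)

Section TypeII.
Variables (R : realType) (G : sgraph) (lt0 : rel G).
Hypothesis o0 : orientation [set: G] lt0.
Variable S : partial_repr R G.
Local Notation D := (predrawn S).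
Local Notation l := (lft S).
Local Notation r := (rgt S).

(** The tie says that [z] lies between [x] and [y] in every orientation. *)
Lemma tied_middle (x y z : G) : tied x z z y -> nonadj x z -> nonadj y z ->
  [/\ nonadj x y, tied x y z y & tied y x z x].
Proof.
move=> t nxz nyz; have nzy : nonadj z y by rewrite nonadjC.
have trans lt (o : orientation [set: G] lt) a b c : lt a b -> lt b c -> lt a c.
  by apply: (orientation_tr o); rewrite inE.
split.
- have := nonadj_neg o0 nxz; have := t _ o0; have := nonadj_neg o0 nyz.
  case e: (lt0 x z) => e1 e2 e3.
    by apply: (orientation_nonadj o0 (in_setT _) (in_setT _)); apply: trans o0 _ _ _ e _; rewrite -e2.
  rewrite nonadjC; apply: (orientation_nonadj o0 (in_setT _) (in_setT _)).
  by apply: (trans _ o0 y z x); [move: e1; rewrite -e2; case: (lt0 y z)|rewrite e3].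
- move=> lt o; have := t _ o; have n1 := nonadj_neg o nxz; have n2 := nonadj_neg o nyz.
  case e: (lt x z) => e2.
    by rewrite -e2; apply: (trans _ o x z y) => //.
  rewrite -e2; apply/negbTE/negP => xy; have yz : lt y z by move: n2; rewrite -e2; case: (lt y z).
  by rewrite (trans _ o x y z) in e.
move=> lt o; have := t _ o; have n1 := nonadj_neg o nxz; have n2 := nonadj_neg o nyz.
case e: (lt x z) n1 => n1 e2; rewrite n1.
  apply/negbTE/negP => yx; move: n2; rewrite -e2.
  by rewrite (trans _ o y x z).
apply: (trans _ o y z x) => //; by move: n2; rewrite -e2; case: (lt y z).
Qed.

(** As [z] is always the middle one, there are an H_k for [x, y, z] and an H_m for [y, x, z]. If one
    of the indices exceeds 2, the shortcut in that graph replaces the other graph by an H_1. *)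
Lemma CE_case x y z u : z \in D -> u \in D -> u -- x -> u -- y -> u -- z ->
  l z <= r u -> r u <= r z -> tied x z z y -> nonadj x z -> nonadj y z -> obstructed S.
Proof.
move=> zD uD ux uy uz h2 h3 t nxz nyz.
have [h1|h1] := leP (l z) (l u).
  by apply: (@two_conflict _ _ _ o0 S z y u u) => //; rewrite nonadjC.
have [nxy t1 t2] := tied_middle t nxz nyz.
have b : between_in lt0 x z y.
  have n1 := nonadj_neg o0 nxz; have n2 := nonadj_neg o0 nyz; have e := t _ o0.
  by rewrite /between_in; move: n1 n2; rewrite -e; case: (lt0 x z) (lt0 y z) => [] [] // ->.
have b' : between_in lt0 y z x by move: b; rewrite /between_in orbC.
have [k [A hA]] := Hgraph_of_order o0 t1 b.
have [m [A' hA']] := Hgraph_of_order o0 t2 b'.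
have [k0 m0] := (Hgraph_gt0 hA, Hgraph_gt0 hA').
have [k3|k3] := ltnP 2 k.
  have [A'' hA''] := Hgraph_shortcut hA k3.
  by apply: (@obs_CE _ _ _ k 1%N) => //; [by left|exact: (CE_in hA hA'' zD uD ux uy uz)].
have [m3|m3] := ltnP 2 m.
  have [A'' hA''] := Hgraph_shortcut hA' m3.
  by apply: (@obs_CE _ _ _ m 1%N) => //; [by left|exact: (CE_in hA' hA'' zD uD uy ux uz)].
have [mk|km] := leqP m k.
  apply: (@obs_CE _ _ _ k m) => //; last exact: (CE_in hA hA' zD uD ux uy uz).
  case: m m0 m3 mk {hA'} => [|[|[|]]] //; [by left|move=> _ _ k2; right].
  by split=> //; apply/eqP; rewrite eqn_leq k3 k2.
apply: (@obs_CE _ _ _ m k) => //; [exact: ltnW| |exact: (CE_in hA' hA zD uD uy ux uz)].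
by left; apply/eqP; rewrite eqn_leq k0 andbT -ltnS (leq_trans km).
Qed.

(** [norm] replaces a vertex by its drawn witness if the latter ends before [z]; otherwise the
    witness is a neighbour that also meets [z]. Two replacements lead to FAT, one to FB or CE, none
    to CE or to a 1-BI whose path is an edge at [z]. *)
Lemma type2 x y z u u' : z \in D -> u \in D -> u' \in D ->
  u = x \/ u -- x -> r u <= r z -> u' = y \/ u' -- y -> r u' <= r z ->
  tied x z z y -> nonadj x z -> nonadj y z -> obstructed S.
Proof.
move=> zD uD u'D.
have lz := drawn_le zD.
have norm a v : v \in D -> v = a \/ v -- a -> r v <= r z -> nonadj a z ->
    [/\ r v < l z, nonadj v z & tied v z a z] \/ [/\ v -- a, v -- z & l z <= r v].
  move=> vD va rv naz; have lv := drawn_le vD.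
  have vz : v != z by case: va => [->|va]; [case/andP: naz|apply: nonadj_ne_adj va; rewrite nonadjC].
  have [vz'|zv] := ltP (r v) (l z).
    have nvz := drawn_nonadj vD zD vz'; left; split=> //.
    by case: va => [->//|va]; exact: tied_adj.
  have avz : v -- z by apply: (drawn_adjI vD zD) => //; rlra.
  right; split=> //; case: va => // e; move: naz; by rewrite -e /nonadj avz andbF.
have drawn_free a b v : a \in D -> r a < l z -> v \in D -> v -- b -> v -- z -> l z <= r v ->
    r v <= r z -> tied a z z b -> nonadj a z -> nonadj b z -> obstructed S.
  move=> aD az vD vb vz h1 h2 t naz nbz.
  have [nab t1 t2] := tied_middle t naz nbz.
  have [ava|nva] := boolP (v -- a); first exact: (@CE_case a b z v).
  have va : v != a.
    by apply: contraTneq vz => ->; case/andP: naz.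
  have nav : nonadj a v by rewrite nonadjC; apply/andP.
  case: (drawn_cases aD vD nav) => h.
    apply: (@FB_case _ _ _ o0 S a b z v) => //; by rewrite nonadjC.
  by have ? := drawn_le aD; have [? ?] := drawn_adjE vD zD vz; exfalso; rlra.
move=> hu ru hu' ru' t nxz nyz.
have nzx : nonadj z x by rewrite nonadjC.
have nzy : nonadj z y by rewrite nonadjC.
case: (norm x u uD hu ru nxz) => [[uz nuz tu]|[ux uz zu]];
  case: (norm y u' u'D hu' ru' nyz) => [[u'z nu'z tu']|[u'y u'z zu']].
- have t' : tied u z z u' by exact: tied_trans tu (tied_trans t (tied_rev (tied_sym tu'))).
  have [nuu t1 t2] := tied_middle t' nuz nu'z.
  case: (drawn_cases uD u'D nuu) => h; first exact: (@FAT_case _ _ _ o0 S u u' z).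
  exact: (@FAT_case _ _ _ o0 S u' u z).
- apply: (@drawn_free u y u') => //; exact: tied_trans tu t.
- apply: (@drawn_free u' x u) => //; apply: tied_trans tu' _.
  by apply: tied_rev; exact: tied_sym.
have [auy|nuy] := boolP (u -- y); first exact: (@CE_case x y z u).
have [au'x|nu'x] := boolP (u' -- x); first exact: (@CE_case x y z u').
have final a b v w : v \in D -> w \in D -> v -- a -> v -- z -> w -- b -> w -- z ->
    l z <= r v -> r v <= r z -> l z <= r w -> r w <= r z -> ~~ (v -- b) ->
    nonadj b z -> l v <= l w -> obstructed S.
  move=> vD wD va vz wb wz h1 h2 h3 h4 nvb nbz h5.
  have nzb : nonadj z b by rewrite nonadjC.
  have [lw|lw] := leP (l z) (l w); first exact: (@two_conflict _ _ _ o0 S z b w w).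
  have nvb' : nonadj v b.
    by rewrite /nonadj nvb andbT; apply: contraTneq vz => ->; case/andP: nbz.
  have [A hA] := Hgraph_of_adj vz nvb' nzb.
  by apply: (@obs_BI _ _ _ 1%N); [by left|apply: (BI_in hA _ vD zD wD wD wb wb) => //; [by left|rlra..]].
have [luu|luu] := leP (l u) (l u').
  exact: (@final x y u u').
by apply: (@final y x u' u) => //; exact: ltW.
Qed.

End TypeII.

(** * Conflicts of two comparisons of right endpoints *)

Section Kind22.
Variables (R : realType) (G : sgraph) (lt0 : rel G).
Hypothesis o0 : orientation [set: G] lt0.
Variable S : partial_repr R G.
Local Notation D := (predrawn S).
Local Notation l := (lft S).
Local Notation r := (rgt S).

(** [u] forces [x] before [v] and [w] forces [y] before [z], while [v] meets [y] and [z]. Once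
    smaller configurations are removed, [u] meets [x], [y], [z] and exceeds [v] on the left. A drawn
    [y] then leads to EFS, BI or FDS, a neighbour [w] of [y] and [z] to BI or FNS. *)
Lemma EFS_FNS_case x v u y z w : v \in D -> z \in D -> u \in D -> w \in D ->
  u = x \/ u -- x -> r u <= r v -> w = y \/ w -- y /\ w -- z -> r w <= r z -> r z <= r v ->
  v -- y -> v -- z -> nonadj x v -> nonadj y z -> tied x v z y -> obstructed S.
Proof.
move=> vD zD uD wD ux ruv wyz rwz rzv vy vz nxv nyz t.
have [lv [lz [lu lw]]] := (drawn_le vD, (drawn_le zD, (drawn_le uD, drawn_le wD))).
have [L [H [LH ltE adjN nadjN _]]] := nat_model o0.
have nvx : nonadj v x by rewrite nonadjC.
have nzy : nonadj z y by rewrite nonadjC.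
have nxy : nonadj x y.
  have xy : y != x by apply: nonadj_ne_adj nxv _; rewrite adj_sym.
  rewrite /nonadj eq_sym xy; apply/negP=> axy.
  have [? ?] := adjN _ _ axy; have [? ?] := adjN _ _ vy; have [? ?] := adjN _ _ vz.
  by case: (tied_cases o0 ltE nadjN t nxv nzy) => -[? ?]; nlia.
have nyx : nonadj y x by rewrite nonadjC.
have yv : y -- v by rewrite adj_sym.
have zv : z -- v by rewrite adj_sym.
have t1 : tied x y z y by exact: tied_trans (tied_adjr yv nxy nxv) t.
have [lvz rvz] := drawn_adjE vD zD vz.
have xz : z != x by exact: nonadj_ne_adj nxv zv.
have wy_or : w = y \/ w -- y by case: wyz => [->|[]]; [left|right].
have yleft : y \in D -> r w <= r z -> w = y -> r y < l z.
  move=> yD rw ewy; rewrite ewy in rw lw; case: (drawn_cases yD zD nyz) => // h; exfalso; rlra.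
have [axz|naxz] := boolP (x -- z).
  have [lvz1|lzv1] := leP (l v) (l z).
    have aux : u -- x.
      case: ux => // e; exfalso; have xD : x \in D by rewrite -e.
      rewrite e in ruv lu; have [? ?] := drawn_adjE xD zD axz.
      case: (drawn_cases xD vD nxv) => h; rlra.
    by apply: (@two_conflict _ _ _ o0 S v x z u) => //; rewrite adj_sym.
  have awy : w -- y.
    case: wy_or => // e; exfalso; have yD : y \in D by rewrite -e.
    have ? := yleft yD rwz e; have [? ?] := drawn_adjE vD yD vy; rlra.
  by apply: (@two_conflict _ _ _ o0 S z y v w) => //; exact: ltW.
have nxz : nonadj x z by rewrite /nonadj eq_sym xz.
have t2 : tied x z z y by exact: tied_trans (tied_adjr zv nxz nxv) t.
have [ruz|rzu] := leP (r u) (r z); first exact: (@type2 _ _ _ o0 S x y z u w).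
have aux : u -- x.
  case: ux => // e; exfalso; have xD : x \in D by rewrite -e.
  rewrite e in ruv rzu lu; case: (drawn_cases xD vD nxv) => h; rlra.
have [lvu|luv] := leP (l v) (l u); first exact: (@two_conflict _ _ _ o0 S v x u u).
have nzx : nonadj z x by rewrite nonadjC.
have auz : u -- z.
  by apply: (drawn_adjI uD zD); [exact: nonadj_ne_adj nzx aux|rlra|rlra].
have uy : u != y by exact: nonadj_ne_adj nyx aux.
have [auy|nauy] := boolP (u -- y); last first.
  have nuy : nonadj u y by rewrite /nonadj uy.
  case: wyz => [e|[wy _]]; last first.
    by apply: (@two_conflict _ _ _ o0 S u y v w) => //; rlra.
  exfalso; have yD : y \in D by rewrite -e.
  have ? := yleft yD rwz e; have [? ?] := drawn_adjE vD yD vy; have ? := drawn_le yD.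
  by case/negP: nauy; apply: (drawn_adjI uD yD uy); rlra.
have [vx nvx'] := andP nvx.
case: wyz => [e|[wy wz]].
  have yD : y \in D by rewrite -e.
  have yz := yleft yD rwz e; have [? ?] := drawn_adjE vD yD vy; have ? := drawn_le yD.
  have [k [A hA]] := Hgraph_of_cover o0 t1 nxy nzy vy vz vx nvx'.
  have [lyv|lvy] := leP (l y) (l v); last first.
    apply: (obs_EFS (Hgraph_gt0 hA)).
    by apply: (EFS_in hA yD zD uD vD aux auy auz vx nvx' vy vz).
  have [lyu|luy] := leP (l y) (l u).
    apply: (@BI_case _ _ _ o0 S y x v u u) => //; try rlra.
      by apply: adj_neq.
    exact: tied_adj.
  apply: (obs_FDS (Hgraph_gt0 hA)).
  by apply: (FDS_in hA yD uD vD aux auy auz vx nvx' vy vz) => //; rlra.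
have [lzw|lwz] := leP (l z) (l w); first exact: (@two_conflict _ _ _ o0 S z y w w).
have [awx|nawx] := boolP (w -- x).
  by apply: (@type2 _ _ _ o0 S x y z w w) => //; right.
have [lvz1|lzv1] := leP (l v) (l z); last first.
  by apply: (@two_conflict _ _ _ o0 S z y v w) => //; exact: ltW.
have [? ?] := drawn_adjE wD zD wz.
have wx : w != x by exact: nonadj_ne_adj nxy wy.
have [lwu|luw] := leP (l w) (l u).
  have wv : w != v.
    apply/eqP=> e; have rv : r v <= r z by rewrite -e.
    rlra.

  have awv : w -- v by apply: (drawn_adjI wD vD wv); rlra.
  apply: (@BI_case _ _ _ o0 S w x v u u) => //; try rlra.
    by rewrite /nonadj wx.
  by apply: tied_adj => //; rewrite /nonadj wx.
have [k [A hA]] := Hgraph_of_cover o0 t1 nxy nzy vy vz vx nvx'.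
apply: (obs_FNS (Hgraph_gt0 hA)).
by apply: (FNS_in hA zD uD vD wD aux auy auz vx nvx' vy vz wx nawx wy wz) => //; rlra.
Qed.

(** If [q] and [q'] meet, exchanging vertices along edges leads to [type2] or to [EFS_FNS_case]. If
    they are disjoint, [q'] lies left of [q], and this drawn pair mediates between the two given
    ones. *)
Lemma kind22_ordered p q u p' q' u' : q \in D -> u \in D -> q' \in D -> u' \in D ->
  u = p \/ u -- p -> r u <= r q -> u' = p' \/ u' -- p' -> r u' <= r q' ->
  nonadj p q -> nonadj p' q' -> tied p q q' p' -> r q' <= r q -> obstructed S.
Proof.
move=> qD uD q'D u'D up ruq up' ruq' npq npq' t rqq.
have nqp : nonadj q p by rewrite nonadjC.
have nqp' : nonadj q' p' by rewrite nonadjC.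
have rle : r u' <= r q by exact: le_trans ruq' rqq.
have [eqq|neqq] := eqVneq q' q.
  by rewrite eqq in npq' t; exact: (@type2 _ _ _ o0 S p p' q u u').
have [lq [lq' lu']] := (drawn_le qD, (drawn_le q'D, drawn_le u'D)).
have [aqq|naqq] := boolP (q' -- q).
  have aqq' : q -- q' by rewrite adj_sym.
  have p'q : p' != q by rewrite eq_sym; apply: nonadj_ne_adj npq' aqq'.
  have [ap'q|nap'q] := boolP (p' -- q); last first.
    have np'q : nonadj p' q by rewrite /nonadj p'q.
    apply: (@type2 _ _ _ o0 S p p' q u u') => //.
    by apply: tied_trans t _; apply: tied_adj => //; rewrite nonadjC.
  have aqp' : q -- p' by rewrite adj_sym.
  case: up' => [e|au'p'].
    by apply: (@EFS_FNS_case p q u p' q' u') => //; left.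
  have [au'q'|nau'q'] := boolP (u' -- q').
    by apply: (@EFS_FNS_case p q u p' q' u') => //; right.
  have u'q' : u' != q' by exact: nonadj_ne_adj nqp' au'p'.
  have nu'q' : nonadj u' q' by rewrite /nonadj u'q'.
  have nq'u' : nonadj q' u' by rewrite nonadjC.
  have ap'u' : p' -- u' by rewrite adj_sym.
  have t' : tied p q q' u' by apply: tied_trans t _; exact: tied_adjr.
  have [au'q|nau'q] := boolP (u' -- q).
    apply: (@EFS_FNS_case p q u u' q' u') => //; first by left.
    by rewrite adj_sym.
  have u'q : u' != q by apply: contraNneq nau'q' => ->.
  have nu'q : nonadj u' q by rewrite /nonadj u'q.
  apply: (@type2 _ _ _ o0 S p u' q u u') => //; first by left.
  by apply: tied_trans t' _; apply: tied_adj => //; rewrite nonadjC.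
have nqq : nonadj q' q by rewrite /nonadj neqq.
have q'q : r q' < l q.
  case: (drawn_cases q'D qD nqq) => // h; exfalso; rlra.
have p'q : p' != q.
  apply/eqP=> e; case: up' => [e'|a].
    by have : l q <= r q'; [rewrite -e -e'; rlra|rlra].
  by rewrite e in a; have [? ?] := drawn_adjE u'D qD a; rlra.
have [ap'q|nap'q] := boolP (p' -- q).
  have au'p' : u' -- p'.
    case: up' => // e; exfalso; rewrite -e in ap'q.
    by have [? ?] := drawn_adjE u'D qD ap'q; rlra.
  by apply: (@two_conflict _ _ _ o0 S q' p' q u') => //; rewrite 1?adj_sym //; rlra.
have np'q : nonadj p' q by rewrite /nonadj p'q.
(* If neither tie below holds, one orientation has [q'] between [q] and [p'] and another has [p']
   between [q] and [q'], although [p' q'] is tied to a pair containing [q]. *)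
have [t1|/untied[lt1 o1 ne1]] := pselect (tied p' q' q q').
  apply: (@typei_mid _ _ _ o0 S p' q' q u' q) => //; [by left|rlra|by rewrite nonadjC].
have [t2|/untied[lt2 o2 ne2]] := pselect (tied p q q p').
  exact: (@type2 _ _ _ o0 S p p' q u u').
exfalso; apply: (@tied_not_both _ lt1 lt2 q q' p' p q) => //.
- exact: tied_sym.
- by right.
- move: ne1; rewrite /between_in (nonadj_neg o1 npq') (nonadj_neg o1 nqq).
  by case: (lt1 p' q') (lt1 q' q) => [] [].
have tr a b c : lt2 a b -> lt2 b c -> lt2 a c by apply: (orientation_tr o2); rewrite inE.
move: ne2 (t _ o2) (tr q p' q') (tr q' p' q) (tr p' q' q) (tr q q' p').
rewrite /between_in (nonadj_neg o2 npq') (nonadj_neg o2 nqq) (nonadj_neg o2 np'q).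
by case: (lt2 p q) (lt2 p' q') (lt2 q' q) (lt2 p' q) => [] [] [] [] //= _ _ h1 h2 h3 h4;
  first [have := h1 isT isT; done | have := h2 isT isT; done | have := h3 isT isT; done | have := h4 isT isT; done].
Qed.

End Kind22.

(** * Reduction of conflicts to pairs of arcs *)

Section Conflicts.
Variables (R : realType) (G : sgraph) (lt0 : rel G).
Hypothesis o0 : orientation [set: G] lt0.

(* p precedes q because p reaches at least as far left as u, which meets q. *)
Definition left_arc (S : partial_repr R G) (p q u : G) :=
  [/\ p \in predrawn S, u \in predrawn S, u = q \/ u -- q & lft S p <= lft S u].

Definition right_arc (S : partial_repr R G) (p q u : G) :=
  [/\ q \in predrawn S, u \in predrawn S, u = p \/ u -- p & rgt S u <= rgt S q].

Lemma left_arc_reflection S p q u : left_arc (reflection S) p q u <-> right_arc S q p u.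
Proof. by rewrite /left_arc /right_arc /= lerN2. Qed.

Lemma right_arc_reflection S p q u : right_arc (reflection S) p q u <-> left_arc S q p u.
Proof. by rewrite /left_arc /right_arc /= lerN2. Qed.

Lemma kind22 S p q u p' q' u' : right_arc S p q u -> right_arc S p' q' u' ->
  nonadj p q -> nonadj p' q' -> tied p q q' p' -> obstructed S.
Proof.
move=> [? ? ? ?] [? ? ? ?] n n' t; have [h|h] := leP (rgt S q') (rgt S q).
  exact: (@kind22_ordered _ _ _ o0 S p q u p' q' u').
apply: (@kind22_ordered _ _ _ o0 S p' q' u' p q u) => //; last exact: ltW.
by apply: tied_rev; exact: tied_sym.
Qed.

Lemma kind11 S p q u p' q' u' : left_arc S p q u -> left_arc S p' q' u' ->
  nonadj p q -> nonadj p' q' -> tied p q q' p' -> obstructed S.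
Proof.
move=> /right_arc_reflection a /right_arc_reflection a' n n' t.
apply: obstructed_reflection; apply: (kind22 a a'); rewrite 1?nonadjC //.
exact: tied_rev.
Qed.

(** If [u] misses [p], it lies right of [p] and can replace [q]; both vertices are then drawn, and
    the arc can also be read from the right. *)
Lemma left_arc_cases S p q u : left_arc S p q u -> nonadj p q ->
  (u -- p /\ u -- q) \/
  exists q1, [/\ right_arc S p q1 p, nonadj p q1 & tied p q p q1].
Proof.
move=> [pD uD uq h] npq; have [lp lu] := (drawn_le pD, drawn_le uD).
have up : u != p by case: uq => [->|uq]; [rewrite eq_sym; case/andP: npq|exact: nonadj_ne_adj npq uq].
have [aup|naup] := boolP (u -- p).
  left; split=> //; case: uq => // e; move: npq.
  by rewrite -e nonadjC /nonadj aup andbF.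
have npu : nonadj p u by rewrite nonadjC /nonadj up.
right; exists u; split=> //.
  split=> //; first by left.
  by case: (drawn_cases pD uD npu) => h'; rlra.
by case: uq => [->//|uq]; apply: tied_adjr; rewrite // adj_sym.
Qed.

Lemma right_arc_cases S p q u : right_arc S p q u -> nonadj p q ->
  (u -- p /\ u -- q) \/
  exists p1, [/\ left_arc S p1 q q, nonadj p1 q & tied p q p1 q].
Proof.
move=> /left_arc_reflection a npq; rewrite nonadjC in npq.
case: (left_arc_cases a npq) => [[? ?]|[p1 [/right_arc_reflection a' n t]]].
  by left.
by right; exists p1; split; [|rewrite nonadjC|exact: tied_rev].
Qed.

(** As [v] meets [y], the tie puts [x] and [z] on one side of [y], while [w] forces [y] before [z].
    In the end [u] exceeds [v] on the left: FDS if a vertex beginning inside [y], either [v] or [w],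
    reaches as far right as [u], and EFDS otherwise. *)
Lemma FDS_EFDS_case (S : partial_repr R G) x v u y z w :
  v \in predrawn S -> y \in predrawn S -> u \in predrawn S -> w \in predrawn S ->
  u -- x -> u -- v -> rgt S u <= rgt S v -> w -- y -> w -- z -> lft S y <= lft S w ->
  v -- y -> v -- z -> nonadj x v -> nonadj x y -> nonadj y z -> tied y z v x -> obstructed S.
Proof.
move=> vD yD uD wD ux uv ruv wy wz lyw vy vz nxv nxy nyz t.
have [lv [ly [lu lw]]] := (drawn_le vD, (drawn_le yD, (drawn_le uD, drawn_le wD))).
have [luv1 lvu1] := drawn_adjE uD vD uv.
have [lwy lyw1] := drawn_adjE wD yD wy; have [lvy lyv] := drawn_adjE vD yD vy.
have nvx : nonadj v x by rewrite nonadjC.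
have nyx : nonadj y x by rewrite nonadjC.
have nzy : nonadj z y by rewrite nonadjC.
have yv : y -- v by rewrite adj_sym.
have tyz : tied y z y x by apply: tied_trans t _; exact: tied_adj.
have t1 : tied x y z y by apply: tied_rev; exact: tied_sym.
have [lvu|luv] := leP (lft S v) (lft S u); first exact: (@two_conflict _ _ _ o0 S v x u u).
have [rwy|ryw] := leP (rgt S w) (rgt S y); first exact: (@two_conflict _ _ _ o0 S y z w w).
have [vx nvx'] := andP nvx; have uz : u -- y -> u -- z.
  move=> uy; have [L [H [LH ltE adjN nadjN _]]] := nat_model o0.
  have uz : u != z by exact: nonadj_ne_adj nzy uy.
  apply: contraT => nauz; have nuz : nonadj u z by rewrite /nonadj uz.
  have [? ?] := adjN _ _ uy; have [? ?] := adjN _ _ ux; have [? ?] := adjN _ _ vy.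
  have [? ?] := adjN _ _ vz; have [? [? ?]] := (LH x, (LH y, LH z)).
  by case: (tied_cases o0 ltE nadjN t1 nxy nzy) => -[? ?];
    case: (nadjN _ _ nuz) => ?; case: (nadjN _ _ nvx) => ?; nlia.
have uyI : lft S u <= rgt S y -> lft S y <= rgt S u -> u -- y.
  by apply: (drawn_adjI uD yD); exact: nonadj_ne_adj nyx ux.
have mid : rgt S u <= rgt S y -> obstructed S.
  by move=> h; apply: (@typei_mid _ _ _ o0 S x y z u w) => //; right.
have out w1 : w1 \in predrawn S -> w1 -- x -> lft S y <= lft S w1 -> obstructed S.
  move=> w1D w1x h; apply: (@typei_out _ _ _ o0 S y x v w1 u) => //; try by right.
  exact: tied_adj.
have fds v1 : v1 \in predrawn S -> v1 != x -> ~~ (v1 -- x) -> v1 -- y -> v1 -- z ->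
    lft S u < lft S y -> lft S y <= lft S v1 -> lft S v1 <= rgt S y -> u -- y ->
    rgt S y < rgt S u -> rgt S u <= rgt S v1 -> obstructed S.
  move=> v1D v1x nv1x v1y v1z h1 h2 h3 uy h4 h5.
  have [k [A hA]] := Hgraph_of_cover o0 t1 nxy nzy v1y v1z v1x nv1x.
  apply: (obs_FDS (Hgraph_gt0 hA)).
  exact: (FDS_in hA yD uD v1D ux uy (uz uy) v1x nv1x v1y v1z).
have [lyv2|lvy2] := leP (lft S y) (lft S v).
  have [lyu|luy] := leP (lft S y) (lft S u); first exact: (out u).
  have auy : u -- y by apply: uyI; rlra.
  have [ruy|ryu] := leP (rgt S u) (rgt S y); first exact: mid.
  exact: (fds v).
have [awx|nawx] := boolP (w -- x); first exact: (out w).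
have [ruy|ryu] := leP (rgt S u) (rgt S y); first exact: mid.
have auy : u -- y by apply: uyI; rlra.
have wx : w != x by exact: nonadj_ne_adj nxy wy.
have [ruw|rwu] := leP (rgt S u) (rgt S w); first by apply: (fds w) => //; rlra.
have [k [A hA]] := Hgraph_of_cover o0 t1 nxy nzy vy vz vx nvx'.
apply: (obs_EFDS (Hgraph_gt0 hA)).
exact: (EFDS_in hA yD uD vD wD ux auy (uz auy) vx nvx' vy vz wx nawx wy wz).
Qed.

(** The drawn vertices are [p] and [q']. If they are disjoint, comparing the given pairs with [p q']
    either reduces the kind of the conflict or leaves betweenness patterns restricted by
    [tied_not_both] and by the neighbours [u], [u']. *)
Lemma kind12_core (S : partial_repr R G) p q u p' q' u' :
  left_arc S p q u -> right_arc S p' q' u' -> u -- p -> u -- q -> u' -- p' -> u' -- q' ->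
  nonadj p q -> nonadj p' q' -> tied p q q' p' -> obstructed S.
Proof.
move=> a a' up uq up' uq' npq npq' t.
have [pD uD _ h] := a; have [q'D u'D _ h'] := a'.
have [lp [lq' [lu lu']]] := (drawn_le pD, (drawn_le q'D, (drawn_le uD, drawn_le u'D))).
have [hup1 hup2] := drawn_adjE uD pD up; have [huq1 huq2] := drawn_adjE u'D q'D uq'.
have nqp : nonadj q p by rewrite nonadjC.
have nqp' : nonadj q' p' by rewrite nonadjC.
have [L [H [LH ltE adjN nadjN adjP]]] := nat_model o0.
have [epq|npq1] := eqVneq p q'.
  rewrite -epq in t npq' h' q'D *.
  apply: (@typei_mid _ _ _ o0 S p' p q u' u) => //; [by right|by right|].
  by apply: tied_rev; exact: tied_sym.
have [eqp|nqp1] := eqVneq q p'.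
  rewrite -eqp in t up' nqp' *.
  by apply: (@typei_out _ _ _ o0 S p q q' u u') => //; by right.
have mid_q : nonadj q q' -> u' -- q -> tied p q q' q -> obstructed S.
  move=> nqq u'q tq; apply: (@typei_out _ _ _ o0 S p q q' u u') => //; try by right.
  by rewrite nonadjC.
have mid_p' : nonadj p p' -> u -- p' -> tied p p' q' p' -> obstructed S.
  by move=> npp u'p tp; apply: (@typei_out _ _ _ o0 S p p' q' u u') => //; by right.
have u'q1 : nonadj q q' -> u' != q by move=> n; apply: nonadj_ne_adj n uq'.
have up1 : nonadj p p' -> u != p' by move=> n; apply: nonadj_ne_adj up; rewrite nonadjC.
have [apq|napq] := boolP (p -- q').
  have apq' : q' -- p by rewrite adj_sym.
  have pp' : p != p' by apply: contraTneq apq => ->; case/andP: npq'.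
  have qq' : q != q'.
    by apply: contraTneq apq => <-; case/andP: npq.
  have [app|napp] := boolP (p -- p'); have [aqq|naqq] := boolP (q -- q').
  - have [? ?] := adjN _ _ apq; have [? ?] := adjN _ _ app; have [? ?] := adjN _ _ aqq.
    by exfalso; case: (tied_cases o0 ltE nadjN t npq nqp') => -[? ?]; nlia.
  - have nqq : nonadj q q' by rewrite /nonadj qq'.
    apply: obstructed_reflection.
    apply: (@FDS_EFDS_case (reflection S) q p u q' p' u') => //=; rewrite ?lerN2 //.
    exact: tied_sym.
  - have npp : nonadj p p' by rewrite /nonadj pp'.
    apply: (@FDS_EFDS_case S p' q' u' p q u) => //.
      by rewrite adj_sym.
    by rewrite nonadjC.
  have npp : nonadj p p' by rewrite /nonadj pp'.
  have nqq : nonadj q q' by rewrite /nonadj qq'.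
  have nqq' : nonadj q' q by rewrite nonadjC.
  have [u'q|u'q] := boolP (u' -- q).
    by apply: mid_q => //; exact: tied_adj.
  have [aup'|naup'] := boolP (u -- p').
    by apply: mid_p' => //; apply: tied_trans (tied_adj apq npp nqp') _.
  have n1 : nonadj u' q by rewrite /nonadj u'q1.
  have n2 : nonadj u p' by rewrite /nonadj up1.
  have [? ?] := adjN _ _ up; have [? ?] := adjN _ _ uq.
  have [? ?] := adjN _ _ up'; have [? ?] := adjN _ _ uq'; have [? ?] := adjN _ _ apq.
  have [[? ?] [? ?]] := ((LH p, LH q), (LH p', LH q')).
  by exfalso; case: (tied_cases o0 ltE nadjN t npq nqp') => -[? ?];
    case: (nadjN _ _ n1) => ?; case: (nadjN _ _ n2) => ?;
    case: (nadjN _ _ nqq) => ?; case: (nadjN _ _ npp) => ?; nlia.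
have npq'1 : nonadj p q' by rewrite /nonadj npq1.
have nq'p : nonadj q' p by rewrite nonadjC.
case: (drawn_cases pD q'D npq'1) => [pq|qp].
  have arc0 : right_arc S p q' p by split=> //; [left|rlra].
  have arc0' : left_arc S p q' q' by split=> //; [left|rlra].
  have by22 : tied p q p q' -> obstructed S.
    move=> tq; apply: (kind22 arc0 a') => //.
    exact: tied_trans (tied_sym tq) t.
  have by11 : tied p q q' p -> obstructed S by move=> tq; exact: (kind11 a arc0').
  have [eqq|qq'] := eqVneq q q'; first by apply: by22; rewrite eqq.
  have [aqq|naqq] := boolP (q -- q'); first by apply: by22; exact: tied_adjr.
  have [epp|pp'] := eqVneq p' p; first by apply: by11; rewrite epp in t.
  have [app|napp] := boolP (p' -- p).
    by apply: by11; apply: tied_trans t _; apply: tied_adjr => //; rewrite nonadjC.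
  have nqq : nonadj q q' by rewrite /nonadj qq'.
  have nq'q : nonadj q' q by rewrite nonadjC.
  have npp' : nonadj p' p by rewrite /nonadj pp'.
  have npp : nonadj p p' by rewrite nonadjC.
  (* [lt1] refutes the reduction to two left arcs and [lt2] the one to two right arcs; their
     betweenness patterns are then played against each other. *)
  have [tq|/untied[lt1 o1 ne1]] := pselect (tied p q q' p); first exact: by11.
  have [tq|/untied[lt2 o2 ne2]] := pselect (tied p q p q'); first exact: by22.
  have p_mid : between_in lt2 q' p q.
    move: ne2; rewrite /between_in (nonadj_neg o2 npq) (nonadj_neg o2 npq'1).
    by case: (lt2 p q) (lt2 p q') => [] [].
  have q'_mid : between_in lt1 p q' p'.
    have := t _ o1; move: ne1; rewrite /between_in (nonadj_neg o1 npq'1) (nonadj_neg o1 npq').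
    by case: (lt1 p q) (lt1 p q') (lt1 p' q') => [] [] [] //=.
  have q_or_q' : between_in lt1 q' q p \/ between_in lt1 p q' q.
    move: ne1; rewrite /between_in (nonadj_neg o1 npq) (nonadj_neg o1 npq'1) (nonadj_neg o1 nqq).
    by case: (lt1 p q) (lt1 p q') (lt1 q q') => [] [] [] //= _; auto.
  case: q_or_q' => [q_mid|q'_mid2].
    exfalso; apply: (@tied_not_both _ lt2 lt1 q' p q q' p') => //; first by left.
  have p'_or_p : between_in lt2 q' p p'.
    have p_or_p' : between_in lt2 p p' q' \/ between_in lt2 q' p p'.
      have := t _ o2; move: p_mid; rewrite /between_in.
      rewrite (nonadj_neg o2 npq) (nonadj_neg o2 npq'1) (nonadj_neg o2 npq') (nonadj_neg o2 npp).
      by case: (lt2 p q) (lt2 p q') (lt2 p' q') (lt2 p p') => [] [] [] [] //=; auto.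
    case: p_or_p' => // p'_mid; exfalso.
    by apply: (@tied_not_both _ lt1 lt2 p q' p' p q) => //; [exact: tied_sym|left].
  have [u'q|u'q] := boolP (u' -- q).
    apply: mid_q => //; apply: contrapT => /untied[lt3 o3 ne3].
    apply: (@tied_not_both _ lt2 lt3 q' p q q' p') => //; first by left.
    move: ne3; rewrite /between_in (nonadj_neg o3 npq) (nonadj_neg o3 nqq).
    by case: (lt3 p q) (lt3 q q') => [] [].
  have [aup'|naup'] := boolP (u -- p').
    apply: mid_p' => //; apply: contrapT => /untied[lt3 o3 ne3].
    apply: (@tied_not_both _ lt1 lt3 p q' p' p q) => //; [exact: tied_sym|by left|].
    move: ne3; rewrite /between_in (nonadj_neg o3 npp) (nonadj_neg o3 npq').
    by case: (lt3 p p') (lt3 p' q') => [] [].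
  have [L2 [H2 [LH2 ltE2 adjN2 nadjN2 _]]] := nat_model o2.
  have n1 : nonadj u' q by rewrite /nonadj u'q1.
  have n2 : nonadj u p' by rewrite /nonadj up1.
  have [? ?] := adjN2 _ _ up; have [? ?] := adjN2 _ _ uq.
  have [? ?] := adjN2 _ _ up'; have [? ?] := adjN2 _ _ uq'.
  have [[? ?] [? ?]] := ((LH2 p, LH2 q), (LH2 p', LH2 q')).
  move: p_mid p'_or_p; rewrite /between_in !ltE2 => h1 h2; exfalso.
  by case/orP: h1 => /andP[? ?]; case/orP: h2 => /andP[? ?];
    case: (nadjN2 _ _ n1) => ?; case: (nadjN2 _ _ n2) => ?; nlia.
have [eqq|qq'] := eqVneq q q'.
  by exfalso; rewrite eqq in uq; have [? ?] := drawn_adjE uD q'D uq; rlra.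
have [aqq|naqq] := boolP (q' -- q).
  by apply: (@two_conflict _ _ _ o0 S p q u q') => //; rlra.
have [epp|pp'] := eqVneq p' p.
  by exfalso; rewrite epp in up'; have [? ?] := drawn_adjE u'D pD up'; rlra.
have [app|napp] := boolP (p -- p').
  by apply: (@two_conflict _ _ _ o0 S q' p' p u') => //; rlra.
have nqq : nonadj q q' by rewrite /nonadj qq' adj_sym.
have npp' : nonadj p' p by rewrite /nonadj pp' adj_sym.
have npp : nonadj p p' by rewrite nonadjC.
have u'p : u' != p by apply: contraTneq uq' => ->.
have nu'p : ~~ (u' -- p).
  by apply/negP=> e; have [? ?] := drawn_adjE u'D pD e; rlra.
have [t1|/untied[lt1 o1 ne1]] := pselect (tied p' q' p q').
  by apply: (@typei_mid _ _ _ o0 S p' q' p u' p) => //; [right|left|rlra].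
have [t2|/untied[lt2 o2 ne2]] := pselect (tied q' p q p).
  by apply: (@typei_mid _ _ _ o0 S q' p q q' u) => //; [left|rlra|right].
exfalso.
have q'_mid : between_in lt1 p q' p'.
  move: ne1; rewrite /between_in (nonadj_neg o1 npq'1) (nonadj_neg o1 npq').
  by case: (lt1 p q') (lt1 p' q') => [] [].
have p_mid : between_in lt2 q' p q.
  move: ne2; rewrite /between_in (nonadj_neg o2 npq) (nonadj_neg o2 npq'1).
  by case: (lt2 p q) (lt2 p q') => [] [].
have : between_in lt2 p p' q' \/ between_in lt2 p' p q'.
  have := t _ o2; move: p_mid; rewrite /between_in.
  rewrite (nonadj_neg o2 npq) (nonadj_neg o2 npq'1) (nonadj_neg o2 npq') (nonadj_neg o2 npp).
  by case: (lt2 p q) (lt2 p q') (lt2 p' q') (lt2 p p') => [] [] [] [] //=; auto.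
case=> [p'_mid|p_mid'].
  by apply: (@tied_not_both _ lt1 lt2 p q' p' p q) => //; [exact: tied_sym|left].
(* [u'] meets [p'] and [q'], so it would also meet [p]; but it ends no later than [q'], hence left
   of [p]. *)
have : u' -- p.
  apply: (@between_adj _ lt1 lt2 p' q' p u') => //.
  by move: q'_mid; rewrite /between_in orbC.
by rewrite (negbTE nu'p).
Qed.

Lemma kind12 S p q u p' q' u' : left_arc S p q u -> right_arc S p' q' u' ->
  nonadj p q -> nonadj p' q' -> tied p q q' p' -> obstructed S.
Proof.
move=> a a' n n' t; case: (left_arc_cases a n) => [[up uq]|[q1 [a1 n1 t1]]].
  case: (right_arc_cases a' n') => [[up' uq']|[p1 [a1 n1 t1]]].
    exact: (kind12_core a a').
  apply: (kind11 a a1) => //; apply: tied_trans t _; exact: tied_rev.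
apply: (kind22 a1 a') => //; exact: tied_trans (tied_sym t1) t.
Qed.

(** If both bounds come from drawn neighbours, [v] of [p] and [u] of [q], then [v] replaces [p] when
    it misses [q], and [u] replaces [q] when it misses [p]. If neither happens, both meet [p] and
    [q], and [r v <= l u] yields an SE. *)
Lemma forced_cases (S : partial_repr R G) (p q : G) : forced S p q -> nonadj p q -> obstructed S \/
  exists p1 q1 u, [/\ left_arc S p1 q1 u \/ right_arc S p1 q1 u, nonadj p1 q1 & tied p q p1 q1].
Proof.
move=> /asboolP[a [b [pa qb ab]]] npq; have nqp : nonadj q p by rewrite nonadjC.
case: pa qb ab => [[pD ->]|[v /andP[vD vp] ->]] [[qD ->]|[u /andP[uD uq] ->]] h.
- right; exists p, q, q; split=> //; left; split=> //; first by left.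
  have := drawn_le pD; have := drawn_le qD => ? ?.
  by case: (drawn_cases pD qD npq) => h'; rlra.
- by right; exists p, q, u; split=> //; left; split=> //; right.
- by right; exists p, q, v; split=> //; right; split=> //; right.
have [lv lu] := (drawn_le vD, drawn_le uD).
have vq : v != q by exact: nonadj_ne_adj nqp vp.
have up : u != p by exact: nonadj_ne_adj npq uq.
have [avq|navq] := boolP (v -- q); last first.
  have nvq : nonadj v q by rewrite /nonadj vq.
  right; exists v, q, u; split=> //; first by left; split=> //; [right|rlra].
  by apply: tied_adj => //; rewrite adj_sym.
have [aup|naup] := boolP (u -- p); last first.
  have npu : nonadj p u by rewrite nonadjC /nonadj up.
  right; exists p, u, v; split=> //; first by right; split=> //; [right|rlra].
  by apply: tied_adjr => //; rewrite adj_sym.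
left; apply: (@SE_core _ _ _ o0 S v u p q) => //; rewrite 1?adj_sym //; rlra.
Qed.

Lemma conflict_obstructed (S : partial_repr R G) : conflict [set: G] (forced S) -> obstructed S.
Proof.
move=> [p [q [p' [q' [_ /andP[n n'] /andP[a a'] t]]]]].
case: (forced_cases a n) => [//|[p1 [q1 [u [b m s]]]]].
case: (forced_cases a' n') => [//|[p2 [q2 [u' [b' m' s']]]]].
have {}t : tied p1 q1 q2 p2.
  apply: tied_trans (tied_sym s) _; apply: tied_trans (tied_rev s').
  exact: t.
case: b b' => [b|b] [b'|b'].
- exact: (kind11 b b').
- exact: (kind12 b b').
- by apply: (kind12 b' b) => //; apply: tied_rev; exact: tied_sym.
- exact: (kind22 b b').
Qed.

End Conflicts.

(** * Conclusion *)

Lemma extendible_contains (R : realType) (G : sgraph) (S : partial_repr R G) C :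
  extendible S -> ~ contains S C.
Proof. by move=> ext [H [SH [ne _ co]]]; apply: ne; exact: contained_extendible co ext. Qed.

(** LB disposes of graphs without any representation; otherwise a representation supplies the
    orientation [lt0] on which the reductions rest. *)
Lemma extendible_or_obstructed (R : realType) (G : sgraph) (S : partial_repr R G) :
  extendible S \/ obstructed S.
Proof.
have [[l [r rep]]|nrep] := pselect (has_repr R [set: G]); last first.
  by right; apply: obs_LB; exact: LB_in.
have o0 := orientation_of_repr rep.
have [|[lt [o sat]]|conf] := orientation_extends (A := [set: G]) (@ferrers_forced R G S).
- by eexists; exact: o0.
- by left; exact: orientation_extendible o sat.
by right; exact: conflict_obstructed o0 _ conf.
Qed.

Theorem theorem1p1 (R : realType) (G : sgraph) (S : partial_repr R G) :
  extendible S <->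
  [/\ ~ contains S (@LB R),
      ~ contains S (@SE R),
      forall k : nat, (1 <= k)%N ->
        [/\ ~ contains S (@FAT R k) /\ ~ contains S (@FS R k),
            ~ contains S (@EFS R k) /\ ~ contains S (@FB R k),
            ~ contains S (@EFB R k) /\ ~ contains S (@FDS R k),
            ~ contains S (@EFDS R k)
          & ~ contains S (@FNS R k)],
      forall k : nat, k = 1%N \/ k = 2%N -> ~ contains S (@BI R k)
    & forall k m : nat, (1 <= m)%N -> (m <= k)%N ->
        m = 1%N \/ (k = 2%N /\ m = 2%N) -> ~ contains S (@CE R k m)].
Proof.
split=> [ext|[nLB nSE nk nBI nCE]].
  have nc C : ~ contains S C by exact: extendible_contains.
  by split=> *; try exact: nc; do ?split; exact: nc.
case: (extendible_or_obstructed S) => // obs; exfalso.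
case: obs => [//|//|k k0|k k0|k k0|k k0|k k0|k k0|k k0|k k0|k k0|k m m0 mk km] c.
1-8: by case: (nk k k0) => -[n1 n2] [n3 n4] [n5 n6] n7 n8; tauto.
- exact: nBI k k0 c.
- exact: nCE k m m0 mk km c.
Qed.
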